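(* The function $F$, $F(n,\ell)=F_n(\ell)$ for $n>0$ and $0\le\ell<2^{n(M+1)}$, which encodes the sequence $\{F_n\}$ of admissible permutations, is P-TIME relative to $\tau^O_1$.
   Context: Work in the probability space $(0,1)$ with Lebesgue measure. For $x\in(0,1)$ write $x=\sum_{i\ge1}\varepsilon_i(x)2^{-i}$ with $\varepsilon_i(x)\in\{0,1\}$ and $\varepsilon_i(x)=0$ for infinitely many $i$. Fix an integer $M\ge 0$, put $m=2^{M+1}$, and fix a random variable $O:(0,1)\to\mathbb{R}$ such that $O(x)$ depends bijectively on $(\varepsilon_1(x),\ldots,\varepsilon_{M+1}(x))$. Its $m$ distinct outcomes are enumerated increasingly as $o_1<\cdots<o_m$; they are equally likely, $\sum_s o_s=0$, and $O$ has variance $1$, i.e. $\sum_s o_s^2=m$. Let $\varsigma_s\in\{0,1\}^{M+1}$ be such that $O(x)=o_s$ iff $(\varepsilon_1(x),\ldots,\varepsilon_{M+1}(x))=\varsigma_s$. Arrange the positive integers consecutively, in increasing order, in rows indexed by $\rho=1,2,\ldots$, where row $\rho$ has length $b$, the unique positive integer with $(b-1)(M+1)<\rho\le b(M+1)$. Let $J_i$ be the $i$-th column (the set of $i$-th entries of all rows of length $\ge i$), enumerated increasingly as $j_{i,1}<j_{i,2}<\cdots$; let $\overline J_i=\{j_{i,1},\ldots,j_{i,M+1}\}$ and $\overline J^n=\overline J_1\cup\cdots\cup\overline J_n$. Let $P_i(x)$ be the number with $\varepsilon_k(P_i(x))=\varepsilon_{j_{i,k}}(x)$ for all $k$, and $R_i(x)=O(P_i(x))$;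 that is, for every $x\in(0,1)$, $R_i(x)=o_s$ iff $(\varepsilon_{j_{i,1}}(x),\ldots,\varepsilon_{j_{i,M+1}}(x))=\varsigma_s$. Put $S_n=\sum_{i=1}^n R_i$. The quantile $S^*_n$ of $S_n$ is $S^*_n(x)=\inf\{t\in\mathbb{R}\mid C(t)>x\}$ for $x\in(0,1)$, where $C$ is the cumulative distribution function of $S_n$. For $0\le\ell<2^{n(M+1)}$: $D_{n,0}=(0,2^{-n(M+1)})$ and $D_{n,\ell}=[\ell 2^{-n(M+1)},(\ell+1)2^{-n(M+1)})$ for $\ell>0$. Let $(\vec e_\ell\mid 0\le\ell<2^{n(M+1)})$ be the lexicographically increasing enumeration of $\{0,1\}^{\overline J^n}$ (coordinates $\overline J^n$ taken in increasing order), and $E_{n,\ell}=\{x\in(0,1)\mid \varepsilon_j(x)=(\vec e_\ell)_j\text{ for all }j\in\overline J^n\}$. $S^*_n$ is constant on each $D_{n,\ell}$ and $S_n$ is constant on each $E_{n,\ell}$. A permutation $\pi$ of $\{0,\ldots,2^{n(M+1)}-1\}$ is admissible iff for all $0\le\ell<2^{n(M+1)}$: $S^*_n(x)=S_n(y)$ for all $x\in D_{n,\ell}$ and all $y\in E_{n,\pi(\ell)}$. $\mathbf{K}_n$ is the set of $\vec k=(k_1,\ldots,k_m)$ of non-negative integers with sum $n$; $\binom{n}{\vec k}=\frac{n!}{k_1!\cdots k_m!}$; $\vec k\cdot\vec o=k_1o_1+\cdots+k_mo_m$. Let $(v_n^t\mid 0\le t\le T_n)$ be the increasing enumeration of the set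 of values $\{\vec k\cdot\vec o\mid\vec k\in\mathbf{K}_n\}$ (the values of $S_n$). $\mathrm{SMC}^O(n,t)=\sum\binom{n}{\vec k}$, the sum over $\vec k\in\mathbf{K}_n$ with $\vec k\cdot\vec o<v_n^t$. $\mathrm{IStep}(n,\ell)$ is the unique $t$ such that $S^*_n$ has constant value $v_n^t$ on $D_{n,\ell}$. $\mathrm{I}B_{n,t}$ is the set of $\ell<2^{n(M+1)}$ such that $S_n$ has constant value $v_n^t$ on $E_{n,\ell}$, and $(b_{n,t,s}\mid 1\le s\le|\mathrm{I}B_{n,t}|)$ is its increasing enumeration. $F_n$ is the (admissible) permutation of $\{0,\ldots,2^{n(M+1)}-1\}$ given by $F_n(\ell)=b_{n,t,s}$, where $t=\mathrm{IStep}(n,\ell)$ and $s=1+\ell-\mathrm{SMC}^O(n,t)$ (so $\ell$ is the $s$-th element of $\{\ell'\mid\mathrm{IStep}(n,\ell')=t\}$). $\tau^O_1$ is the $\{0,1\}$-valued function on tuples $(n,k_1,\ldots,k_m,t)$ with $n>0$, $0\le t\le T_n$, $\vec k\in\mathbf{K}_n$, with $\tau^O_1(n,\vec k,t)=1$ iff $\vec k\cdot\vec o=v_n^t$ (as an oracle it answers $0$ outside this domain). A function is P-TIME relative to $\tau^O_1$ if it is computed by a Turing machine with oracle $\tau^O_1$ in time polynomial in $n$ (the first argument), integer arguments being given in binary; $M$ (hence $m$) and $O$ are fixed. *)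

(* Defs.v *)
From HB Require Import structures.
From mathcomp Require Import all_boot all_order all_algebra.
From mathcomp Require Import all_classical all_reals all_analysis.

Set Implicit Arguments.
Unset Strict Implicit.
Unset Printing Implicit Defensive.

Import Order.TTheory GRing.Theory Num.Theory.
Import numFieldNormedType.Exports.

Local Open Scope classical_set_scope.
Local Open Scope ring_scope.

Section BinaryExpansion.
Variable R : realType.

(* The value [e 0] is irrelevant (digits are indexed from 1); it is pinned to
   [false] so that the expansion of a point of (0,1) is unique. *)
Definition binary_expansion (x : R) (e : nat -> bool) : Prop :=
  [/\ e 0%N = false,
      (fun N : nat => \sum_(1 <= i < N.+1) (e i)%:R * (2 : R) ^- i) @ \oo --> x
    & forall N : nat, exists2 i : nat, (N <= i)%N & e i = false].

(* [eps x i] is the i-th binary digit of x, for 0 < x < 1 and i >= 1. *)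
Definition eps (x : R) : nat -> bool :=
  xget (fun=> false) [set e | binary_expansion x e].

End BinaryExpansion.

Section Rows.
Variable M : nat.
Local Open Scope nat_scope.

(* For rho > 0 this is the b with (b - 1) * M.+1 < rho <= b * M.+1. *)
Definition row_len (rho : nat) : nat := (rho.-1 %/ M.+1).+1.

Definition jrow (rho : nat) : seq nat :=
  iota (\sum_(1 <= r < rho) row_len r).+1 (row_len rho).

(* [jcol i k] is j_{i,k} (i, k >= 1): the k-th of the i-th entries of the rows
   of length >= i.  Those rows are the rho > i.-1 * M.+1, so at least k of them
   occur among the rows 1, ..., i * M.+1 + k. *)
Definition jcol (i k : nat) : nat :=
  nth 0 [seq nth 0 (jrow rho) i.-1
        | rho <- iota 1 (i * M.+1 + k) & i <= row_len rho] k.-1.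

(* The set \overline J^n, listed increasingly. *)
Definition Jbar (n : nat) : seq nat :=
  sort leq (undup [seq jcol i k | i <- iota 1 n, k <- iota 1 M.+1]).

(* \vec e_l: the l-th word of length n * M.+1 in the lexicographic order
   (with false < true). *)
Definition evec (n l : nat) : seq bool :=
  nth [::] [seq val w | w <- sort <=%O
                              (enum {: (n * M.+1).-tuplelexi bool})] l.

End Rows.

Section Walk.
Variables (R : realType) (M : nat).
Notation m := (2 ^ M.+1)%N.
Notation bits := (M.+1.-tuple bool).

(* The outcomes o_1 < ... < o_m are indexed by 'I_m, and [vs s] is
   \varsigma_s.  That the outcomes are equally likely, so that the two sums
   express mean 0 and variance 1, follows from [outcome_iff]. *)
Record outcomes (O : R -> R) (o : 'I_m -> R) (vs : 'I_m -> bits) : Prop := {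
  outcomes_incr : forall s s' : 'I_m, (s < s')%N -> o s < o s';
  codes_bij : bijective vs;
  outcome_iff : forall x, 0 < x < 1 -> forall s,
    O x = o s <-> [tuple eps x k.+1 | k < M.+1] = vs s;
  outcomes_mean : \sum_s o s = 0;
  outcomes_var : \sum_s o s ^+ 2 = m%:R }.

Variables (o : 'I_m -> R) (vs : 'I_m -> bits).

(* R_i(x) = o_s iff the digits of x at j_{i,1}, ..., j_{i,M+1} form
   \varsigma_s; the default value is never taken when [vs] is bijective. *)
Definition Rvar (i : nat) (x : R) : R :=
  if [pick s | vs s == [tuple eps x (jcol M i k.+1) | k < M.+1]] is Some s
  then o s else 0.

Definition Sn (n : nat) (x : R) : R := \sum_(1 <= i < n.+1) Rvar i x.

Definition cdf_Sn (n : nat) (t : R) : \bar R :=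
  lebesgue_measure [set x : R | 0 < x < 1 /\ Sn n x <= t].

Definition quantile_Sn (n : nat) (x : R) : R :=
  inf [set t : R | (x%:E < cdf_Sn n t)%E].

(* Requiring 0 < x only matters for l = 0. *)
Definition Dset (n l : nat) : set R :=
  [set x | 0 < x /\
           l%:R * 2 ^- (n * M.+1) <= x < l.+1%:R * 2 ^- (n * M.+1)].

Definition Eset (n l : nat) : set R :=
  [set x | 0 < x < 1 /\ [seq eps x j | j <- Jbar M n] = evec M n l].

Definition Kset (n : nat) : {set {ffun 'I_m -> 'I_n.+1}} :=
  [set k : {ffun 'I_m -> 'I_n.+1} | (\sum_s k s)%N == n]%SET.

Definition multinomial (n : nat) (k : {ffun 'I_m -> 'I_n.+1}) : nat :=
  (n`! %/ \prod_s (k s)`!)%N.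

Definition dot (n : nat) (k : {ffun 'I_m -> 'I_n.+1}) : R :=
  \sum_s (k s)%:R * o s.

Definition values (n : nat) : seq R :=
  sort <=%R (undup [seq dot k | k <- enum (Kset n)]).

Definition Tn (n : nat) : nat := (size (values n)).-1.

Definition v (n t : nat) : R := nth 0 (values n) t.

Definition SMC (n t : nat) : nat :=
  (\sum_(k in Kset n | (dot k < v n t)%R) multinomial k)%N.

Definition IStep (n l : nat) : nat :=
  xget 0%N [set t : nat | (t <= Tn n)%N /\
              forall x, Dset n l x -> quantile_Sn n x = v n t].

(* I B_{n,t}, listed increasingly. *)
Definition IB (n t : nat) : seq nat :=
  [seq l <- iota 0 (2 ^ (n * M.+1))
  | `[< forall x, Eset n l x -> Sn n x = v n t >]].

Definition Fperm (n l : nat) : nat :=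
  let t := IStep n l in
  let s := (1 + l - SMC n t)%N in
  nth 0%N (IB n t) s.-1.

(* \tau^O_1, on argument lists n, k_1, ..., k_m, t; it is [false] on every list
   that is not of this form. *)
Definition tau1 (a : seq nat) : bool :=
  `[< exists (n t : nat) (k : {ffun 'I_m -> 'I_n.+1}),
      [/\ a = n :: rcons [seq val (k s) | s <- enum 'I_m] t,
          (0 < n)%N /\ (t <= Tn n)%N, k \in Kset n & dot k = v n t] >].

End Walk.

(* Deterministic multitape oracle Turing machines over the tape alphabet
   {blank, separator, 0, 1}. *)
Definition sym : Type := option (option bool).
Definition blank : sym := None.
Definition sep : sym := Some None.
Definition bit (b : bool) : sym := Some (Some b).

Inductive dir := GoLeft | Stay | GoRight.

(* A two-way infinite tape: (l, r) has r under and to the right of the head,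
   l to the left of the head (nearest cell first), and blanks elsewhere. *)
Definition tape : Type := (seq sym * seq sym)%type.

Definition tape_read (T : tape) : sym := head blank T.2.

Definition tape_act (T : tape) (w : sym * dir) : tape :=
  match w.2 with
  | GoLeft => (behead T.1, head blank T.1 :: w.1 :: behead T.2)
  | Stay => (T.1, w.1 :: behead T.2)
  | GoRight => (w.1 :: T.1, behead T.2)
  end.

(* The word from the head up to the next blank. *)
Definition tape_word (T : tape) : seq sym := take (index blank T.2) T.2.

Inductive instr (Q I : finType) :=
  | Halt
  | Query (yes no : Q)
  | Act (delta : {ffun I -> sym} -> Q * {ffun I -> sym * dir}).

Record otm := OTM {
  tm_state : finType;
  tm_tape : finType;
  tm_start : tm_state;
  tm_in : tm_tape;
  tm_query : tm_tape;
  tm_out : tm_tape;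
  tm_prog : tm_state -> instr tm_state tm_tape }.

Section Run.
Variables (A : seq sym -> Prop) (tm : otm).

Definition config : Type := (tm_state tm * {ffun tm_tape tm -> tape})%type.

Definition init (w : seq sym) : config :=
  (tm_start tm, [ffun i => if i == tm_in tm then ([::], w) else ([::], [::])]).

Definition step (c : config) : config :=
  match tm_prog c.1 with
  | Halt => c
  | Query yes no =>
      (if `[< A (tape_word (c.2 (tm_query tm))) >] then yes else no, c.2)
  | Act delta =>
      let qa := delta [ffun i => tape_read (c.2 i)] in
      (qa.1, [ffun i => tape_act (c.2 i) (qa.2 i)])
  end.

Definition halted (c : config) : bool :=
  if tm_prog c.1 is Halt then true else false.

(* Since [step] fixes halted configurations, this says that the machine halts
   after at most [time] steps with output [u]. *)
Definition computes_within (w u : seq sym) (time : nat) : Prop :=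
  let c := iter time step (init w) in
  halted c /\ tape_word (c.2 (tm_out tm)) = u.

End Run.

(* Binary notation, most significant digit first, without leading zeros
   (and "0" for 0). *)
Definition bin (n : nat) : seq sym :=
  [seq bit (odd (n %/ 2 ^ i)) | i <- rev (iota 0 (trunc_log 2 n).+1)]%N.

Definition encode (a : seq nat) : seq sym :=
  flatten [seq rcons (bin x) sep | x <- a].

(* An oracle for a {0,1}-valued function of tuples of naturals; ill-formed
   queries are answered negatively. *)
Definition oracle (tau : seq nat -> bool) (w : seq sym) : Prop :=
  exists2 a : seq nat, w = encode a & tau a.

(* P-TIME relative to tau, for a function f(n, l) with domain D; time is
   measured in the value of n. *)
Definition ptime_relative (tau : seq nat -> bool) (D : nat -> nat -> Prop)
    (f : nat -> nat -> nat) : Prop :=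
  exists (tm : otm) (c d : nat), forall n l : nat, D n l ->
    computes_within (oracle tau) tm (encode [:: n; l]) (bin (f n l))
      (c * n ^ d + c)%N.

(* Main.v *)
Require Import Defs.
From HB Require Import structures.
From mathcomp Require Import all_boot all_order all_algebra.
From mathcomp Require Import all_classical all_reals all_analysis.
From mathcomp Require Import zify ring lra.
Import numFieldNormedType.Exports.

Set Implicit Arguments.
Unset Strict Implicit.
Unset Printing Implicit Defensive.

Import Order.TTheory GRing.Theory Num.Theory.

(** There are [M.+1] rows of length [i], and their last entries are
    [jcol M i 1, ..., jcol M i M.+1]. So [Jbar M n] in increasing order consists
    of [n] successive blocks of [M.+1] positions, one for each [Rvar i], and the
    [l]-th word in lexicographic order is the word of [n] letters whose digits
    form [l] in base [m = 2 ^ M.+1]. Points with prescribed digits at given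
    positions have the measure that independent fair coins would give, so the
    distribution function of [Sn] counts words and its quantile runs through
    the values [v n t] in blocks of as many [l] as there are words with that
    value ([cdf_SnE], [quantileE]). Hence [Fperm n l] is the entry of index
    [l - SMC n T] in the increasing list of the ranks of the words with value
    [v n T], where [T] is the block that contains [l] ([FpermE]).

    Such an entry is found by dynamic programming. The oracle recognises the
    letter counts [k] of the complete words that have value [v n t]; the number
    of completions of a prefix depends only on its letter counts, and it is the
    sum over the letters of the numbers for the prefix that is one letter
    longer. There are at most [n.+1 ^ m] vectors of counts for each length of
    the prefix, a polynomial number since [m] is fixed. Written one after the
    other, with the counts as digits in base [n.+1] and the length as the leading
    digit, these numbers satisfy one linear recurrence at fixed distances: adding
    the letter [i] moves by [n.+1 ^ m + n.+1 ^ i] places ([nth_table]). So the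
    table is a stack onto which sums of entries at fixed depths are pushed, and
    no multinomial coefficient has to be computed. Its top entry is the number of
    words with value [v n t]. These numbers are subtracted from [l] for
    [t = 0, 1, ...] as long as possible, and [t] stays below [n.+1 ^ m]; then a
    walk down the last table finds the letters one by one, each by comparing what
    is left of [l] with the numbers of completions ([answerE]).

    The machine is not written down state by state. Programs over finitely many
    stacks are compiled to multitape machines, one tape for each stack, with a
    cost semantics that is exact ([exec_sound]). Numbers up to a power of [n.+1]
    are kept in unary, which makes them loop counters; the entries of the table
    and [l] are kept in binary. For the time bound it suffices that a push of
    a sum of [m] entries lengthens the longest numeral by at most [m] digits. *)

(** * Stack programs and their compilation to Turing machines *)

Section StackPrograms.
Variables (I : finType) (rq : I) (A : seq sym -> Prop).

Definition store := I -> seq (option bool).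

Definition upd (s : store) (i : I) (x : seq (option bool)) : store :=
  fun j => if j == i then x else s j.

Definition tops (s : store) : {ffun I -> sym} := [ffun i => ohead (s i)].

(** Programs over finitely many stacks whose entries are separators and bits
    but never blanks; all control decisions look at the vector of the top
    symbols, as the transition function of a machine does. *)
Inductive cmd :=
  | Skip
  | Push of I & option bool
  | Pop of I
  | Seq of cmd & cmd
  | Case of {ffun I -> sym} -> cmd
  | While of ({ffun I -> sym} -> bool) & cmd
  | Ask of cmd & cmd.

(** The last argument is the exact number of steps of the compiled machine, hence
    2 for a push: the head of a tape cannot move and write the new cell at once. *)
Inductive exec : cmd -> store -> store -> nat -> Prop :=
  | exec_skip s : exec Skip s s 1
  | exec_push i a s : exec (Push i a) s (upd s i (a :: s i)) 2
  | exec_pop i s : exec (Pop i) s (upd s i (behead (s i))) 1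
  | exec_seq c1 c2 s s1 s2 k1 k2 : exec c1 s s1 k1 -> exec c2 s1 s2 k2 ->
      exec (Seq c1 c2) s s2 (k1 + k2)
  | exec_case f s s' k : exec (f (tops s)) s s' k -> exec (Case f) s s' k.+1
  | exec_while_end (b : {ffun I -> sym} -> bool) c s :
      ~~ b (tops s) -> exec (While b c) s s 1
  | exec_while_next (b : {ffun I -> sym} -> bool) c s s1 s2 k1 k2 :
      b (tops s) -> exec c s s1 k1 -> exec (While b c) s1 s2 k2 ->
      exec (While b c) s s2 (k1 + k2).+1
  | exec_ask c1 c2 s s' k :
      exec (if `[< A (map Some (s rq)) >] then c1 else c2) s s' k ->
      exec (Ask c1 c2) s s' k.+1.

Fixpoint pts (c : cmd) : finType :=
  match c with
  | Skip | Pop _ => unit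
  | Push _ _ => bool
  | Seq a b => (pts a + pts b)%type
  | Case f => option {h : {ffun I -> sym} & pts (f h)}
  | While _ a => option (pts a)
  | Ask a b => option (pts a + pts b)%type
  end.

Fixpoint entry (c : cmd) : pts c :=
  match c with
  | Skip | Pop _ => tt
  | Push _ _ => true
  | Seq a b => inl (entry a)
  | Case f => None
  | While _ a => None
  | Ask a b => None
  end.

Definition keep (h : {ffun I -> sym}) : {ffun I -> sym * dir} :=
  [ffun i => (h i, Stay)].

Definition act1 (h : {ffun I -> sym}) (i : I) (x : sym * dir) :
  {ffun I -> sym * dir} := [ffun j => if j == i then x else (h j, Stay)].

(** The code of [c] inside a larger machine: [e] embeds the control points of
    [c] among the states and [x] is the state to go to when [c] is finished.
    A stack is the part of a tape to the right of the head, so that a pop is a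
    move to the right and a push takes a move to the left and a writing step;
    what is to the left of the head never matters. *)
Fixpoint code (c : cmd) : forall Q : finType,
    (pts c -> Q) -> Q -> pts c -> instr Q I :=
  match c with
  | Skip => fun Q e x _ => Defs.Act (fun h => (x, keep h))
  | Push i a => fun Q e x p =>
      if p then Defs.Act (fun h => (e false, act1 h i (h i, GoLeft)))
      else Defs.Act (fun h => (x, act1 h i (Some a, Stay)))
  | Pop i => fun Q e x _ => Defs.Act (fun h => (x, act1 h i (h i, GoRight)))
  | Seq a b => fun Q e x p =>
      match p with
      | inl q => code (fun q => e (inl q)) (e (inr (entry b))) q
      | inr q => code (fun q => e (inr q)) x q
      end
  | Case f => fun Q e x p =>
      match p with
      | None => Defs.Act (fun h => (e (Some (existT _ h (entry (f h)))), keep h))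
      | Some (existT h q) => code (fun q => e (Some (existT _ h q))) x q
      end
  | While b a => fun Q e x p =>
      match p with
      | None =>
          Defs.Act (fun h => (if b h then e (Some (entry a)) else x, keep h))
      | Some q => code (fun q => e (Some q)) (e None) q
      end
  | Ask a b => fun Q e x p =>
      match p with
      | None => Query I (e (Some (inl (entry a)))) (e (Some (inr (entry b))))
      | Some (inl q) => code (fun q => e (Some (inl q))) x q
      | Some (inr q) => code (fun q => e (Some (inr q))) x q
      end
  end.

(** A head that has visited the bottom of a stack leaves blanks there, whence the
    padding. *)
Definition holds (T : {ffun I -> tape}) (s : store) : Prop :=
  forall i, exists k, (T i).2 = map Some (s i) ++ nseq k blank.

Lemma holds_read T s : holds T s -> [ffun i => tape_read (T i)] = tops s.
Proof.
move=> hT; apply/ffunP => i; rewrite !ffunE /tape_read.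
by have [k ->] := hT i; case: (s i) => //=; case: k.
Qed.

Lemma holds_word T s i : holds T s -> tape_word (T i) = map Some (s i).
Proof.
move=> hT; rewrite /tape_word; have [k ->] := hT i.
have -> : index blank (map Some (s i) ++ nseq k blank) = size (map Some (s i)).
  rewrite index_cat; case: ifP => [/mapP[] //|_].
  by case: k => [|k] /=; rewrite ?eqxx addn0.
by rewrite take_size_cat.
Qed.

Lemma holds_keep T s : holds T s ->
  holds [ffun i => tape_act (T i) (keep (tops s) i)] s.
Proof.
move=> hT i; rewrite !ffunE /tape_act /=; have [k ->] := hT i.
case: (s i) => [|a l] /=; last by exists k.
by exists k.-1.+1; case: k.
Qed.

Lemma holds_pop T s i : holds T s ->
  holds [ffun j => tape_act (T j) (act1 (tops s) i (tops s i, GoRight) j)]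
        (upd s i (behead (s i))).
Proof.
move=> hT j; have := holds_keep hT j; rewrite !ffunE /upd.
case: eqP => [->|_] // _; rewrite /tape_act /=; have [k ->] := hT i.
case: (s i) => [|a l] /=; last by exists k.
by exists k.-1; case: k.
Qed.

Lemma holds_left T s i : holds T s ->
  exists y, forall j, exists k,
    ([ffun j => tape_act (T j) (act1 (tops s) i (tops s i, GoLeft) j)] j).2 =
    (if j == i then [:: y] else [::]) ++ map Some (s j) ++ nseq k blank.
Proof.
move=> hT; exists (head blank (T i).1) => j.
have := holds_keep hT j; rewrite !ffunE.
case: eqP => [->|_] // _; rewrite /tape_act /=; have [k ->] := hT i.
case: (s i) => [|a l] /=; last by exists k.
by exists k.-1.+1; case: k.
Qed.

(** The statement is about code at any place of any machine, since a loop or a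
    sequence runs the code of its parts with other exits. *)
Lemma exec_sound (Q : finType) (start : Q) (rin rout : I)
    (prog : Q -> instr Q I) c s s' k (e : pts c -> Q) (x : Q) T :
  let tm := OTM start rin rq rout prog in
  exec c s s' k -> (forall p, prog (e p) = code e x p) -> holds T s ->
  exists2 T', holds T' s' & iter k (@step A tm) (e (entry c), T) = (x, T').
Proof.
move=> tm ex; rewrite {}/tm.
elim: ex Q start e x prog T => {c s s' k}.
- move=> s Q start e x prog T hp hT; eexists; last first.
    by rewrite /= /step /= hp /=; congr pair.
  by rewrite (holds_read hT); exact: holds_keep.
- move=> i a s Q start e x prog T hp hT; eexists; last first.
    by rewrite /= /step /= hp /= hp /=; congr pair.
  rewrite (holds_read hT); have [y hy] := holds_left i hT.
  move=> j; move: (hy j) => [k]; rewrite !ffunE /upd.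
  case: eqP => [->|_] /=.
    by rewrite /tape_act /= => -[_ ->]; exists k.
  rewrite {1}/tape_act /= => ->.
  by exists k.
- move=> i s Q start e x prog T hp hT; eexists; last first.
    by rewrite /= /step /= hp /=; congr pair.
  by rewrite (holds_read hT); exact: holds_pop.
- move=> c1 c2 s s1 s2 k1 k2 _ IH1 _ IH2 Q start e x prog T hp hT.
  have [T1 hT1 e1] := IH1 _ start (fun q => e (inl q))
    (e (inr (entry c2))) prog T (fun p => hp (inl p)) hT.
  have [T2 hT2 e2] := IH2 _ start (fun q => e (inr q))
    x prog T1 (fun p => hp (inr p)) hT1.
  by exists T2 => //; rewrite addnC iterD [X in iter k2 _ X]e1 e2.
- move=> f s s' k _ IH Q start e x prog T hp hT.
  have [T' hT' e'] := IH _ start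
    (fun q => e (Some (existT _ (tops s) q))) x prog _
    (fun p => hp (Some (existT _ (tops s) p))) (holds_keep hT).
  exists T' => //; rewrite iterSr -e'; congr iter.
  by rewrite /step /= hp /= (holds_read hT).
- move=> b c s nb Q start e x prog T hp hT; eexists; last first.
    rewrite /= /step /= hp /= (holds_read hT) (negPf nb); congr pair.
  exact: holds_keep.
- move=> b c s s1 s2 k1 k2 hb _ IH1 _ IH2 Q start e x prog T hp hT.
  have [T1 hT1 e1] := IH1 _ start (fun q => e (Some q))
    (e None) prog _ (fun p => hp (Some p)) (holds_keep hT).
  have [T2 hT2 e2] := IH2 _ start e x prog T1 hp hT1.
  exists T2 => //; rewrite -addSn addnC iterD -e2; congr iter.
  rewrite iterSr -e1; congr iter.
  by rewrite /step /= hp /= (holds_read hT) hb.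
- move=> c1 c2 s s' k _ IH Q start e x prog T hp hT.
  have stepE : step A ((e (entry (Ask c1 c2)), T) : config (OTM start rin rq rout prog)) =
      (if `[< A (map Some (s rq)) >] then e (Some (inl (entry c1)))
       else e (Some (inr (entry c2))), T).
    by rewrite /step /= hp /= (holds_word _ hT).
  move: IH stepE; case: asboolP => _ IH stepE.
    have [T' hT' e'] := IH _ start (fun q => e (Some (inl q)))
      x prog T (fun p => hp (Some (inl p))) hT.
    by exists T' => //; rewrite iterSr stepE.
  have [T' hT' e'] := IH _ start (fun q => e (Some (inr q)))
    x prog T (fun p => hp (Some (inr p))) hT.
  by exists T' => //; rewrite iterSr stepE.
Qed.

End StackPrograms.

(** * Routines on stacks *)

Section Routines.
Variables (I : finType) (rq : I) (A : seq sym -> Prop).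
Implicit Types (s : store I) (i j t : I) (js : seq I) (c : cmd I).

Definition run c s s' K := exists2 k, k <= K & exec rq A c s s' k.

Lemma run_le c s s' K s'' K' :
  run c s s' K -> s' = s'' -> K <= K' -> run c s s'' K'.
Proof. by move=> [k h e] <- h'; exists k => //; apply: leq_trans h'. Qed.

Lemma run_skip s : run (Skip I) s s 1.
Proof. by exists 1 => //; apply: exec_skip. Qed.

Lemma run_push i a s : run (Push i a) s (upd s i (a :: s i)) 2.
Proof. by exists 2 => //; apply: exec_push. Qed.

Lemma run_pop i s : run (Pop i) s (upd s i (behead (s i))) 1.
Proof. by exists 1 => //; apply: exec_pop. Qed.

Lemma run_seq c1 c2 s s1 s2 K1 K2 :
  run c1 s s1 K1 -> run c2 s1 s2 K2 -> run (Seq c1 c2) s s2 (K1 + K2).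
Proof.
move=> [k1 h1 e1] [k2 h2 e2]; exists (k1 + k2); first exact: leq_add.
exact: exec_seq e1 e2.
Qed.

Lemma run_case f s s' K : run (f (tops s)) s s' K -> run (Case f) s s' K.+1.
Proof. by move=> [k h e]; exists k.+1 => //; apply: exec_case. Qed.

Lemma run_ask c1 c2 s s' K :
  run (if `[< A (map Some (s rq)) >] then c1 else c2) s s' K ->
  run (Ask c1 c2) s s' K.+1.
Proof. by move=> [k h e]; exists k.+1 => //; apply: exec_ask. Qed.

Lemma run_while_end (b : {ffun I -> sym} -> bool) c s :
  ~~ b (tops s) -> run (While b c) s s 1.
Proof. by move=> h; exists 1 => //; apply: exec_while_end. Qed.

Lemma run_while_next (b : {ffun I -> sym} -> bool) c s s1 s2 K1 K2 :
  b (tops s) -> run c s s1 K1 -> run (While b c) s1 s2 K2 ->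
  run (While b c) s s2 (K1 + K2).+1.
Proof.
move=> hb [k1 h1 e1] [k2 h2 e2]; exists (k1 + k2).+1.
  by rewrite ltnS leq_add.
exact: exec_while_next hb e1 e2.
Qed.

(** The intermediate stores are given by a function, so that the invariant of a
    loop is stated as an equation. *)
Lemma run_while (b : {ffun I -> sym} -> bool) c n (st : nat -> store I) K :
  (forall p, p < n -> b (tops (st p)) /\ run c (st p) (st p.+1) K) ->
  ~~ b (tops (st n)) -> run (While b c) (st 0) (st n) (n * K.+1 + 1).
Proof.
elim: n st => [|n IH] st h hn; first exact: run_while_end.
have [b0 r0] := h 0 isT.
apply: run_le (run_while_next b0 r0 (IH (fun p => st p.+1) _ hn)) _ _ => //.
  by move=> p hp; apply: h.
by rewrite mulSn; lia.
Qed.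

Definition unary k : seq (option bool) := nseq k (Some true).

Lemma size_unary k : size (unary k) = k. Proof. exact: size_nseq. Qed.

Definition full i (h : {ffun I -> sym}) : bool := h i != None.

Lemma full_tops i s : full i (tops s) = (s i != [::]).
Proof. by rewrite /full ffunE; case: (s i). Qed.

Definition Loop i c := While (full i) (Seq (Pop i) c).

Lemma run_loop i c n (st : nat -> store I) K :
  (forall p, p <= n -> st p i = unary (n - p)) ->
  (forall p, p < n -> run c (upd (st p) i (unary (n - p.+1))) (st p.+1) K) ->
  run (Loop i c) (st 0) (st n) (n * K.+2 + 1).
Proof.
move=> hi hb; apply: run_while => [p hp|]; last first.
  by rewrite full_tops hi // subnn.
have e : n - p = (n - p.+1).+1 by lia.
split; first by rewrite full_tops hi ?(ltnW hp) // e.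
apply: run_le (run_seq (run_pop _ _) _) erefl _.
  by rewrite hi ?(ltnW hp) // e /=; apply: hb.
by [].
Qed.

Definition pushes (js : seq I) a := foldr (fun j c => Seq (Push j a) c) (Skip I) js.

Definition topis i (p : pred (option bool)) (h : {ffun I -> sym}) : bool :=
  if h i is Some a then p a else false.

(** One routine serves for deleting, moving and duplicating, according as [js]
    has no, one or two elements. *)
Definition pours p i js := While (topis i p)
  (Case (fun h => if h i is Some a then Seq (Pop i) (pushes js a) else Skip I)).

Definition poured s i (js : seq I) x y : store I :=
  fun r => if r == i then y else if r \in js then catrev x (s r) else s r.

Lemma run_pushes js a s : uniq js ->
  run (pushes js a) s (fun r => if r \in js then a :: s r else s r)
      (2 * size js + 1).
Proof.
elim: js s => [|j js IH] s /=; first by move=> _; apply: run_skip.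
move=> /andP[hj /IH{}IH]; apply: run_le (run_seq (run_push _ _ _) (IH _)) _ _.
  apply/funext => r; rewrite in_cons /upd; case: eqP => [->|_] //=.
  by rewrite (negPf hj).
by lia.
Qed.

Lemma run_pours p i js s x y : s i = x ++ y -> all p x ->
  (if y is a :: _ then ~~ p a else true) = true -> i \notin js -> uniq js ->
  run (pours p i js) s (poured s i js x y) (size x * (2 * size js + 4) + 1).
Proof.
move=> + + hy hi hu; elim: x s => [|a x IH] s /= hs.
  move=> _; apply: run_le (run_while_end _ _) _ _ => //.
    by rewrite /topis ffunE hs; case: y hy {hs}.
  apply/funext => r; rewrite /poured -hs.
  by case: eqP => [->|] //; rewrite if_same.
move=> /andP[ha hx].
apply: run_le (run_while_next _ (run_case _)
  (IH (poured s i js [:: a] (x ++ y)) _ hx)) _ _.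
- by rewrite /topis ffunE hs.
- rewrite ffunE hs /=; apply: run_le (run_seq (run_pop _ _) (run_pushes _ _ hu)) _ _.
    apply/funext => r; rewrite /poured /upd hs /=.
    by case: eqP => [->|]//; rewrite (negPf hi).
  exact: leqnn.
- by rewrite /poured eqxx.
- apply/funext => r; rewrite /poured /=; case: eqP => // _.
  by case: (r \in js).
by rewrite mulSn; lia.
Qed.

Definition pour i js := pours xpredT i js.

Lemma run_pour i js s : i \notin js -> uniq js ->
  run (pour i js) s (poured s i js (s i) [::]) (size (s i) * (2 * size js + 4) + 1).
Proof. by move=> hi hu; apply: run_pours; rewrite ?cats0 ?all_predT. Qed.

Lemma run_clear i s : run (pour i [::]) s (upd s i [::]) (4 * size (s i) + 1).
Proof.
apply: run_le (run_pour _ _ _) _ _ => //; last by rewrite /=; lia.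
Qed.

Lemma run_move i j s : i != j ->
  run (pour i [:: j]) s (upd (upd s j (catrev (s i) (s j))) i [::])
      (6 * size (s i) + 1).
Proof.
move=> hij; apply: run_le (run_pour _ _ _) _ _; rewrite ?inE //=; last by lia.
by apply/funext => r; rewrite /poured /upd inE; do !case: eqP => //; move=> ->.
Qed.

(** Moving reverses, so a copy in the same order takes a detour through a scratch
    stack. *)
Definition copy i j t := Seq (pour i [:: t]) (pour t [:: i; j]).

Lemma run_copy i j t s : uniq [:: i; j; t] -> s t = [::] ->
  run (copy i j t) s (upd s j (s i ++ s j)) (14 * size (s i) + 2).
Proof.
rewrite /= !inE !andbT negb_or => /andP[/andP[ij it]] jt ht.
have ti : (t == i) = false by rewrite eq_sym; apply/negbTE.
have tj : (t == j) = false by rewrite eq_sym; apply/negbTE.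
apply: run_le (run_seq (run_move _ it) (run_pour _ _ _)) _ _.
- by rewrite !inE ti tj.
- by rewrite /= inE ij.
- apply/funext => r; rewrite /poured /upd !inE eqxx ti ht !catrevE cats0 revK.
  case: (eqVneq r t) => [->|rt]; first by rewrite tj.
  case: (eqVneq r i) => [->|ri] /=; first by rewrite (negPf ij) cats0.
  by case: (eqVneq r j) => [->|//].
rewrite /upd eqxx ti ht catrevE cats0 size_rev /=; lia.
Qed.

End Routines.

Arguments run_skip {I rq A} s.
Arguments run_push {I rq A} i a s.
Arguments run_pop {I rq A} i s.
Arguments run_while_end {I rq A b c s} _.
Arguments run_while {I rq A b c n} st {K} _ _.
Arguments run_loop {I rq A i c n} st {K} _ _.
Arguments run_pours {I rq A p i js s x y} _ _ _ _ _.
Arguments run_pour {I rq A i js} s _ _.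
Arguments run_clear {I rq A} i s.
Arguments run_move {I rq A i j} s _.
Arguments run_copy {I rq A i j t s} _ _.
Arguments run_pushes {I rq A js} a s _.

(** * Binary numerals, least significant bit first *)

Fixpoint bval (s : seq bool) : nat :=
  if s is b :: s' then b + (bval s').*2 else 0.

Lemma bval_head (s : seq bool) : bval s = head false s + (bval (behead s)).*2.
Proof. by case: s. Qed.

Lemma bval_cat (s1 s2 : seq bool) :
  bval (s1 ++ s2) = bval s1 + 2 ^ size s1 * bval s2.
Proof.
elim: s1 => [|b s1 IH] /=; first by rewrite mul1n.
by rewrite IH expnS -!muln2; nia.
Qed.

Lemma bval_lt (s : seq bool) : bval s < 2 ^ size s.
Proof. by elim: s => [|b s IH] //=; rewrite expnS -muln2; case: b; lia. Qed.

Lemma bval_nth (s : seq bool) i : odd (bval s %/ 2 ^ i) = nth false s i.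
Proof.
elim: i s => [|i IH] [|b s] //=; rewrite ?div0n //.
  by rewrite divn1 oddD odd_double; case: b.
rewrite expnS divnMA -IH; congr (odd (_ %/ _)).
by case: b; lia.
Qed.

(** The most significant digit of a canonical numeral is 1, and zero is the
    empty numeral, so the printed form needs a case for zero. *)
Definition bprint (s : seq bool) : seq bool :=
  if s == [::] then [:: false] else rev s.

Lemma bin_bval (s : seq bool) : last true s -> bin (bval s) = map bit (bprint s).
Proof.
case: s => [|b s] hl; first by [].
rewrite /bprint -[_ :: _ == _]/false; move: hl; set w := b :: s => hl.
have hw : (trunc_log 2 (bval w)).+1 = size w.
  have hb := bval_lt w.
  have : 2 ^ (size w).-1 <= bval w.
    rewrite {hb} /w in hl *; elim: s b hl => [|c s IH] b /=; first by case: b.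
    by move=> hl; have := IH c hl; rewrite /= expnS -muln2; lia.
  rewrite {1 2}/w /= => h; congr S.
  by apply: trunc_log_eq => //; rewrite h.
have e : w = [seq odd (bval w %/ 2 ^ i) | i <- iota 0 (size w)].
  rewrite -[LHS](mkseq_nth false); apply: eq_map => i.
  by rewrite bval_nth.
by rewrite [in RHS]e /bin hw -map_rev -map_comp.
Qed.

Fixpoint incb (s : seq bool) : seq bool :=
  match s with
  | [::] => [:: true]
  | false :: s' => true :: s'
  | true :: s' => false :: incb s'
  end.

Lemma incbE (s : seq bool) :
  incb s = let k := find negb s in nseq k false ++ true :: drop k.+1 s.
Proof. by elim: s => [|[] s IH] //=; rewrite ?IH ?drop0. Qed.

Lemma bval_incb (s : seq bool) : bval (incb s) = (bval s).+1.
Proof. by elim: s => [|[] s IH] //=; rewrite IH; lia. Qed.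

Lemma last_incb (s : seq bool) : last true s -> last true (incb s).
Proof.
elim: s => [|b s IH] //=; case: b => //=; case: s IH => [|c s] //= IH h.
by have := IH h; case: c {IH h} => //=; case: (incb s).
Qed.

Definition nbits n := iter n incb [::].

Lemma bval_nbits n : bval (nbits n) = n.
Proof. by elim: n => //= n IH; rewrite bval_incb IH. Qed.

Lemma bin_nbits n : bin n = map bit (bprint (nbits n)).
Proof.
rewrite -bin_bval ?bval_nbits //.
by elim: n => //= n IH; apply: last_incb.
Qed.

Lemma size_incb (s : seq bool) : size (incb s) <= (size s).+1.
Proof. by elim: s => [|[] s IH]. Qed.

Lemma size_nbits n : size (nbits n) <= n.
Proof. by elim: n => //= n IH; apply: leq_trans (size_incb _) _. Qed.

(** Digitwise combination of [k] digits of two numerals with a carry [c]: the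
    digit produced is [x (+) y (+) c] for addition and subtraction alike, and
    [g] computes the next carry or borrow. *)
Fixpoint zipb (g : bool -> bool -> bool -> bool) k (a b : seq bool) c
    : seq bool * bool :=
  if k is k'.+1 then
    let x := head false a in let y := head false b in
    let r := zipb g k' (behead a) (behead b) (g x y c) in
    (x (+) y (+) c :: r.1, r.2)
  else ([::], c).

Definition carry x y c := (x && y) || (c && (x || y)).
Definition borrow x y c := (~~ x && (y || c)) || (y && c).

Lemma size_zipb g k a b c : size (zipb g k a b c).1 = k.
Proof. by elim: k a b c => //= k IH a b c; rewrite IH. Qed.

Lemma zipb_carry k a b (c : bool) : size a <= k -> size b <= k ->
  bval a + bval b + c =
  bval (zipb carry k a b c).1 + 2 ^ k * (zipb carry k a b c).2.
Proof.
elim: k a b c => [|k IH] a b c.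
  by rewrite !leqn0 !size_eq0 => /eqP -> /eqP -> /=; rewrite mul1n.
move=> ha hb; have {}IH := IH (behead a) (behead b)
  (carry (head false a) (head false b) c).
rewrite (bval_head a) (bval_head b) /= expnS -!muln2 in IH *.
move: IH; rewrite !size_behead => IH.
have {}IH := IH ltac:(lia) ltac:(lia).
by move: IH; case: (head _ a); case: (head _ b); case: c => /=; lia.
Qed.

Lemma zipb_borrow k a b (c : bool) : size a <= k -> size b <= k ->
  bval a + 2 ^ k * (zipb borrow k a b c).2 =
  bval b + c + bval (zipb borrow k a b c).1.
Proof.
elim: k a b c => [|k IH] a b c.
  by rewrite !leqn0 !size_eq0 => /eqP -> /eqP -> /=; rewrite mul1n; lia.
move=> ha hb; have {}IH := IH (behead a) (behead b)
  (borrow (head false a) (head false b) c).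
rewrite (bval_head a) (bval_head b) /= expnS -!muln2 in IH *.
move: IH; rewrite !size_behead => IH.
have {}IH := IH ltac:(lia) ltac:(lia).
by move: IH; case: (head _ a); case: (head _ b); case: c => /=; lia.
Qed.

Definition addb a b : seq bool :=
  let r := zipb carry (maxn (size a) (size b)) a b false in
  r.1 ++ nseq r.2 true.

Lemma bval_addb a b : bval (addb a b) = bval a + bval b.
Proof.
rewrite /addb bval_cat size_zipb.
have := @zipb_carry (maxn (size a) (size b)) a b false.
rewrite leq_maxl leq_maxr => /(_ isT isT).
by case: (zipb _ _ _ _ _).2 => /=; lia.
Qed.

Lemma size_addb a b : size (addb a b) <= (maxn (size a) (size b)).+1.
Proof. by rewrite size_cat size_zipb size_nseq; case: (zipb _ _ _ _ _).2; lia. Qed.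

Definition subb a b : seq bool :=
  (zipb borrow (maxn (size a) (size b)) a b false).1.

Definition ltb a b : bool :=
  (zipb borrow (maxn (size a) (size b)) a b false).2.

Lemma ltbE a b : ltb a b = (bval a < bval b).
Proof.
have := @zipb_borrow (maxn (size a) (size b)) a b false.
rewrite leq_maxl leq_maxr => /(_ isT isT).
have := bval_lt (zipb borrow (maxn (size a) (size b)) a b false).1.
by rewrite size_zipb /ltb; case: (zipb _ _ _ _ _).2 => /=; lia.
Qed.

Lemma bval_subb a b : ~~ ltb a b -> bval (subb a b) = bval a - bval b.
Proof.
have := @zipb_borrow (maxn (size a) (size b)) a b false.
rewrite leq_maxl leq_maxr => /(_ isT isT).
by rewrite /ltb /subb; case: (zipb _ _ _ _ _).2 => //=; lia.
Qed.

Lemma size_subb a b : size (subb a b) = maxn (size a) (size b).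
Proof. exact: size_zipb. Qed.

(** What the digitwise loop leaves of an operand that was the shorter one. *)
Fixpoint padb k (a : seq bool) : seq bool :=
  if k is k'.+1 then head false a :: padb k' (behead a) else [::].

Lemma bval_padb k a : size a <= k -> bval (padb k a) = bval a.
Proof.
elim: k a => [|k IH] a; first by rewrite leqn0 size_eq0 => /eqP ->.
by move=> h; rewrite /= IH ?size_behead -?bval_head //; lia.
Qed.

Lemma size_padb k a : size (padb k a) = k.
Proof. by elim: k a => //= k IH a; rewrite IH. Qed.

Definition bs (s : seq bool) : seq (option bool) := map Some s.

Lemma size_bs s : size (bs s) = size s. Proof. exact: size_map. Qed.

(** Separators end the numerals, so that zero can be the empty one. *)
Definition flat (es : seq (seq bool)) : seq (option bool) :=
  flatten [seq rcons (bs e) None | e <- es].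

Lemma flat_cons e es : flat (e :: es) = bs e ++ None :: flat es.
Proof. by rewrite /flat /= cat_rcons. Qed.

(** * Registers and arithmetic *)

Set Contextual Implicit.

(** [rIn], [rQuery] and [rOut] are the input, the query and the output. The
    unary registers are [rN] with [n], [rT] with the index of the current value,
    [rPow] with [n.+1 ^ m], [rOff i] with the depth at which the entry for the
    letter [i] is looked up, [rK i] with letter counts, and the counters [rC],
    [rCnt], [rCnt2]. [rL] holds what is left of the second input, [rTab] the
    table, [rRev] the digits found so far; [rGo] is emptied to stop the search.
    The others are scratch. *)
Inductive reg (m : nat) :=
  | rIn | rQuery | rOut | rN | rL | rTab | rAux | rX | rAcc | rCarry | rD | rS
  | rTmp | rC | rBits | rZ | rT | rPow | rW | rRev | rCnt | rCnt2 | rGo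
  | rK of 'I_m | rOff of 'I_m.

Unset Contextual Implicit.

Section Registers.
Variable m : nat.

Definition reg_code (r : reg m) : 'I_23 + 'I_m + 'I_m :=
  match r with
  | rIn => inl (inl (@Ordinal 23 0 isT))
  | rQuery => inl (inl (@Ordinal 23 1 isT))
  | rOut => inl (inl (@Ordinal 23 2 isT))
  | rN => inl (inl (@Ordinal 23 3 isT))
  | rL => inl (inl (@Ordinal 23 4 isT))
  | rTab => inl (inl (@Ordinal 23 5 isT))
  | rAux => inl (inl (@Ordinal 23 6 isT))
  | rX => inl (inl (@Ordinal 23 7 isT))
  | rAcc => inl (inl (@Ordinal 23 8 isT))
  | rCarry => inl (inl (@Ordinal 23 9 isT))
  | rD => inl (inl (@Ordinal 23 10 isT))
  | rS => inl (inl (@Ordinal 23 11 isT))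
  | rTmp => inl (inl (@Ordinal 23 12 isT))
  | rC => inl (inl (@Ordinal 23 13 isT))
  | rBits => inl (inl (@Ordinal 23 14 isT))
  | rZ => inl (inl (@Ordinal 23 15 isT))
  | rT => inl (inl (@Ordinal 23 16 isT))
  | rPow => inl (inl (@Ordinal 23 17 isT))
  | rW => inl (inl (@Ordinal 23 18 isT))
  | rRev => inl (inl (@Ordinal 23 19 isT))
  | rCnt => inl (inl (@Ordinal 23 20 isT))
  | rCnt2 => inl (inl (@Ordinal 23 21 isT))
  | rGo => inl (inl (@Ordinal 23 22 isT))
  | rK i => inl (inr i)
  | rOff i => inr i
  end.

Definition reg_decode (x : 'I_23 + 'I_m + 'I_m) : reg m :=
  match x with
  | inl (inl i) => nth rIn [:: rIn; rQuery; rOut; rN; rL; rTab; rAux; rX; rAcc;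
      rCarry; rD; rS; rTmp; rC; rBits; rZ; rT; rPow; rW; rRev; rCnt; rCnt2;
      rGo] i
  | inl (inr i) => rK i
  | inr i => rOff i
  end.

Lemma reg_codeK : cancel reg_code reg_decode. Proof. by case. Qed.

HB.instance Definition _ := Equality.copy (reg m) (can_type reg_codeK).
HB.instance Definition _ := Choice.copy (reg m) (can_type reg_codeK).
HB.instance Definition _ := Countable.copy (reg m) (can_type reg_codeK).
HB.instance Definition _ := Finite.copy (reg m) (can_type reg_codeK).

End Registers.

Ltac by_regs := apply/funext; case=> [|||||||||||||||||||||||?|?];
  rewrite /poured /upd /=.

Section Arithmetic.
Variable m : nat.
Notation reg := (reg m).
Variable A : seq sym -> Prop.
Notation run := (@run _ (@rQuery m) A).
Notation store := (store reg).
Implicit Types (s : store).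

Definition isbit (a : option bool) := a != None.

Lemma all_isbit e : all isbit (bs e).
Proof. by rewrite all_map; apply/allP. Qed.

Definition tbit (h : {ffun reg -> sym}) r : bool :=
  if h r is Some (Some b) then b else false.

Lemma tbit_bs s r e : s r = bs e -> tbit (tops s) r = head false e.
Proof. by rewrite /tbit ffunE => ->; case: e. Qed.

(** The digits of [r] are saved in [rS], because a comparison must be able to
    undo the subtraction by which it is made. *)
Definition zip_digits (g : bool -> bool -> bool -> bool) (r : reg) : cmd reg :=
  While (fun h => full r h || full rX h)
    (Case (fun h => let x := tbit h r in let y := tbit h rX in
      let c := tbit h rCarry in
      Seq (Pop r) (Seq (Pop rX) (Seq (Pop rCarry) (Seq (Push rCarry (Some (g x y c)))
        (Seq (Push rD (Some (x (+) y (+) c))) (Push rS (Some x)))))))).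

Definition zipped (g : bool -> bool -> bool -> bool) r s a b c : store :=
  let k := maxn (size a) (size b) in
  let z := zipb g k a b c in
  upd (upd (upd (upd (upd s r [::]) rX [::]) rCarry [:: Some z.2])
    rD (catrev (bs z.1) (s rD))) rS (catrev (bs (padb k a)) (s rS)).

Lemma run_zip_digits g r s a b c : r \notin [:: rX; rCarry; rD; rS] ->
  s r = bs a -> s rX = bs b -> s rCarry = [:: Some c] ->
  run (zip_digits g r) s (zipped g r s a b c) (maxn (size a) (size b) * 11 + 1).
Proof.
rewrite !inE !negb_or => /and4P[r1 r2 r3 r4].
have nr x : (r != x) -> (x == r) = false by move=> h; rewrite eq_sym; apply/negbTE.
rewrite /zipped; move e : (maxn _ _) => k.
elim: k a b c s e => [|k IH] a b c s e ha hb hc.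
  have [a0 b0] : a = [::] /\ b = [::].
    by case: (a) (b) e => [|? ?] [|? ?] //=; lia.
  apply: run_le (run_while_end _) _ _ => //.
    by rewrite !full_tops ha hb a0 b0.
  apply/funext => x; rewrite /upd /=.
  have [xE|_] := eqVneq x rS; first by rewrite ?xE.
  have [xE|_] := eqVneq x rD; first by rewrite ?xE.
  have [xE|_] := eqVneq x rCarry; first by rewrite ?xE hc.
  have [xE|_] := eqVneq x rX; first by rewrite ?xE hb b0.
  by have [xE|//] := eqVneq x r; rewrite ?xE ha a0.
apply: run_le (run_while_next _ (run_case _) (IH (behead a) (behead b)
  (g (head false a) (head false b) c)
  (upd (upd (upd (upd (upd s r (bs (behead a))) rX (bs (behead b)))
    rCarry [:: Some (g (head false a) (head false b) c)])
    rD (Some (head false a (+) head false b (+) c) :: s rD))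
    rS (Some (head false a) :: s rS)) _ _ _ _)) _ _.
- rewrite !full_tops ha hb; move: e; case: (a) => //=; case: (b) => //.
- rewrite (tbit_bs ha) (tbit_bs hb) (@tbit_bs _ _ [:: c] hc) /=.
  apply: run_le (run_seq (run_pop _ _) (run_seq (run_pop _ _)
    (run_seq (run_pop _ _) (run_seq (run_push _ _ _) (run_seq (run_push _ _ _)
    (run_push _ _ _)))))) _ _; last exact: leqnn.
  apply/funext => x; rewrite /upd /=.
  have [xE|_] := eqVneq x rS; first by rewrite ?xE ?nr.
  have [xE|_] := eqVneq x rD; first by rewrite ?xE ?nr.
  have [xE|_] := eqVneq x rCarry; first by rewrite ?xE ?nr ?hc.
  have [xE|_] := eqVneq x rX; first by rewrite ?xE ?nr // hb; case: (b).
  by have [xE|//] := eqVneq x r; rewrite ?xE ha; case: (a).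
- by rewrite !size_behead; lia.
- by rewrite /upd (negPf r1) (negPf r2) (negPf r3) (negPf r4) eqxx.
- by [].
- by [].
- apply/funext => x; rewrite /upd /=.
  have [xE|_] := eqVneq x rS; first by rewrite ?xE.
  have [xE|_] := eqVneq x rD; first by rewrite ?xE.
  have [xE|_] := eqVneq x rCarry; first by rewrite ?xE.
  have [xE|_] := eqVneq x rX; first by rewrite ?xE.
  by case: eqVneq.
by rewrite mulSn; lia.
Qed.

Definition add : cmd reg :=
  Seq (Push rCarry (Some false)) (Seq (zip_digits carry rAcc)
  (Seq (Case (fun h => if tbit h rCarry then Push rD (Some true) else Skip reg))
  (Seq (Pop rCarry) (Seq (pour rD [:: rAcc]) (pour rS [::]))))).

Lemma run_add s a b : s rAcc = bs a -> s rX = bs b -> s rCarry = [::] ->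
  s rD = [::] -> s rS = [::] ->
  run add s (upd (upd s rAcc (bs (addb a b))) rX [::])
    (21 * maxn (size a) (size b) + 20).
Proof.
move=> ha hb hc hd hs.
set r := zipb carry (maxn (size a) (size b)) a b false.
set s1 := zipped carry rAcc (upd s rCarry [:: Some false]) a b false.
have h1 : run (Case (fun h => if tbit h rCarry then Push rD (Some true) else Skip reg))
    s1 (upd s1 rD (nseq r.2 (Some true) ++ s1 rD)) 3.
  apply: run_case; rewrite (@tbit_bs _ _ [:: r.2]) // /head.
  case: (r.2); first exact: run_push.
  apply: run_le (run_skip _) _ _ => //.
  by apply/funext => x; rewrite /upd /=; case: eqP => // ->.
apply: run_le (run_seq (run_push _ _ _) (run_seq
  (@run_zip_digits carry rAcc _ a b false _ _ _ _)
  (run_seq _ (run_seq (run_pop _ _) (run_seq (run_move _ _)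
    (run_clear _ _)))))) _ _.
- by [].
- by rewrite /upd /= ha.
- by rewrite /upd /= hb.
- by rewrite /upd /= hc.
- by rewrite hc; apply: h1.
- by [].
- rewrite /s1 /zipped -/r; by_regs => //; rewrite ?hc ?hd ?hs ?catrevE ?cats0 //.
  by rewrite rev_cat revK rev_nseq /addb -/r /bs map_cat map_nseq.
rewrite /s1 /zipped /upd /= hd hs !catrevE !cats0 size_cat !size_rev !size_bs.
rewrite size_nseq size_zipb size_padb.
by case: (r.2) => /=; lia.
Qed.

(** The final borrow, which stays in [rCarry], tells whether the numeral in [rL]
    is the smaller one; then the subtraction is undone. *)
Definition compare : cmd reg :=
  Seq (Push rCarry (Some false)) (Seq (zip_digits borrow rL)
  (Case (fun h => if tbit h rCarry
     then Seq (pour rS [:: rL]) (pour rD [::])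
     else Seq (pour rD [:: rL]) (pour rS [::])))).

Definition reduceb a b : seq bool :=
  if ltb a b then padb (maxn (size a) (size b)) a else subb a b.

Lemma run_compare s a b : s rL = bs a -> s rX = bs b -> s rCarry = [::] ->
  s rD = [::] -> s rS = [::] ->
  run compare s
    (upd (upd (upd s rL (bs (reduceb a b))) rX [::]) rCarry [:: Some (ltb a b)])
    (21 * maxn (size a) (size b) + 20).
Proof.
move=> ha hb hc hd hs.
set r := zipb borrow (maxn (size a) (size b)) a b false.
set s1 := zipped borrow rL (upd s rCarry [:: Some false]) a b false.
have h2 : tbit (tops s1) rCarry = r.2 by rewrite (@tbit_bs _ _ [:: r.2]).
have hS : s1 rS = rev (bs (padb (maxn (size a) (size b)) a)).
  by rewrite /s1 /zipped /upd /= hs catrevE cats0.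
have hD : s1 rD = rev (bs r.1).
  by rewrite /s1 /zipped /upd /= hd catrevE cats0.
have hL : s1 rL = [::] by [].
have h1 : run (Case (fun h => if tbit h rCarry
     then Seq (pour rS [:: rL]) (pour rD [::])
     else Seq (pour rD [:: rL]) (pour rS [::])))
    s1 (upd (upd (upd s1 rS [::]) rD [::]) rL (bs (reduceb a b)))
    (10 * maxn (size a) (size b) + 4).
  move: (s1) h2 hS hD hL => s2 h2 hS hD hL.
  apply: run_le (run_case (K := 10 * maxn (size a) (size b) + 2) _) erefl _; last by lia.
  rewrite h2 /reduceb /ltb -/r; case: (r.2).
    apply: run_le (run_seq (run_move _ _) (run_clear _ _)) _ _ => //.
      by by_regs => //; rewrite hS hL catrevE revK cats0.
    rewrite /upd /= hS hD !size_rev !size_bs size_padb size_zipb; lia.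
  apply: run_le (run_seq (run_move _ _) (run_clear _ _)) _ _ => //.
    by by_regs => //; rewrite hD hL catrevE revK cats0.
  rewrite /upd /= hS hD !size_rev !size_bs size_padb size_zipb; lia.
apply: run_le (run_seq (run_push _ _ _) (run_seq
  (@run_zip_digits borrow rL _ a b false _ _ _ _) _)) _ _.
- by [].
- by rewrite /upd /= ha.
- by rewrite /upd /= hb.
- by rewrite /upd /= hc.
- by rewrite hc; apply: h1.
- by rewrite /s1 /zipped; by_regs => //; rewrite ?hd ?hs.
lia.
Qed.

End Arithmetic.

Arguments run_add {m A s a b} _ _ _ _ _.
Arguments run_compare {m A s a b} _ _ _ _ _.

(** * Reading the table *)

Section Tables.
Variable m : nat.
Notation reg := (reg m).
Variable A : seq sym -> Prop.
Notation run := (@run _ (@rQuery m) A).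
Notation store := (store reg).
Implicit Types (s : store).

Lemma size_flat_cons e es : size (flat (e :: es)) = size e + (size (flat es)).+1.
Proof. by rewrite flat_cons size_cat size_bs. Qed.

Lemma flat_cat es1 es2 : flat (es1 ++ es2) = flat es1 ++ flat es2.
Proof. by rewrite /flat map_cat flatten_cat. Qed.

Lemma size_flat_drop es k : size (flat (drop k es)) <= size (flat es).
Proof. by rewrite -[in leqRHS](cat_take_drop k es) flat_cat size_cat leq_addl. Qed.

(** On an empty table this does nothing, so a lookup beyond the end of the table
    finds the empty numeral, like [nth]. *)
Definition skip_entry (js : seq reg) : cmd reg :=
  Seq (pours isbit rTab js)
    (Case (fun h => if h rTab is Some None then Seq (Pop rTab) (pushes js None)
                    else Skip reg)).

Lemma run_skip_entry js s es : rTab \notin js -> uniq js -> s rTab = flat es ->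
  run (skip_entry js) s (poured s rTab js (flat (take 1 es)) (flat (drop 1 es)))
    ((size (flat es)).+1 * (2 * size js + 4) + 1).
Proof.
move=> hj hu ht; case: es ht => [|e es] ht.
  apply: run_le (run_seq (@run_pours _ _ _ _ _ _ _ [::] [::] _ _ _ _ _)
    (run_case _)) _ _ => //.
  - rewrite ffunE /poured eqxx /=; exact: run_skip.
  by rewrite /=; lia.
rewrite /= take0 drop0 !flat_cons in ht *.
apply: run_le (run_seq (run_pours (x := bs e) (y := None :: flat es) _ _ _ _ _)
    (run_case _)) _ _ => //.
- exact: all_isbit.
- rewrite ffunE {1}/poured eqxx /=.
  apply: run_le (run_seq (run_pop _ _) (run_pushes _ _ hu)) _ (leqnn _).
  apply/funext => r; rewrite /poured /upd; case: (r =P rTab) => [->|_].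
    by rewrite (negPf hj).
  by case: (r \in js) => //; rewrite !catrevE rev_cat.
by rewrite size_cat size_bs /=; nia.
Qed.

Definition skip_entries (d : 'I_m) (js : seq reg) : cmd reg :=
  Seq (copy (rOff d) rC rTmp) (Loop rC (skip_entry js)).

Lemma run_skip_entries d js s es k : rTab \notin js -> rC \notin js -> uniq js ->
  s rTab = flat es -> s (rOff d) = unary k -> s rC = [::] -> s rTmp = [::] ->
  run (skip_entries d js) s (poured s rTab js (flat (take k es)) (flat (drop k es)))
    (k * ((size (flat es)).+1 * (2 * size js + 4) + 17) + 3).
Proof.
move=> h1 h2 h3 ht hd hc hp.
pose st j := upd (poured s rTab js (flat (take j es)) (flat (drop j es))) rC
  (unary (k - j)).
apply: run_le (run_seq (run_copy _ _) (_ : run _ _ (st k) _)) _ _ => //.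
- have -> : upd s rC (s (rOff d) ++ s rC) = st 0.
    apply/funext => r; rewrite /st /upd hd hc cats0 subn0 /poured take0 drop0.
    by case: (r =P rC) => //; case: (r =P rTab) => [->|_ _] //; case: ifP.
  apply: (run_loop st (K := (size (flat es)).+1 * (2 * size js + 4) + 1)) => j hj.
    by rewrite /st /upd eqxx.
  apply: run_le (run_skip_entry (es := drop j es) h1 h3 _) _ _.
  + by rewrite /st /upd /= /poured eqxx.
  + rewrite -/(drop 1 (drop j es)) drop_drop add1n.
    have e1 : flat (take j.+1 es) = flat (take j es) ++ flat (take 1 (drop j es)).
      by rewrite -addn1 takeD flat_cat.
    apply/funext => r; rewrite /st /upd {1}/poured.
    case: (r =P rTab) => [->|n1] //=.
    case: (r =P rC) => [->|n2] //=; first by rewrite (negPf h2).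
    rewrite /poured; move/eqP/negbTE: n1 => ->; case: (r \in js) => //.
    by rewrite e1 !catrevE rev_cat catA.
  by have := size_flat_drop es j; nia.
- rewrite /st subnn; apply/funext => r; rewrite /upd.
  by case: (r =P rC) => // ->; rewrite /poured /= (negPf h2).
by rewrite hd size_unary; nia.
Qed.

(** The entries above the one wanted are parked on [rAux], reversed as a whole;
    moving them back restores them. *)
Definition fetch : cmd reg :=
  Seq (pours isbit rTab [:: rAux; rZ])
    (Seq (pour rAux [:: rTab]) (pour rZ [:: rX])).

Lemma run_fetch s es1 es2 : s rTab = flat es2 -> s rAux = rev (flat es1) ->
  s rX = [::] -> s rZ = [::] ->
  run fetch s (upd (upd (upd s rTab (flat (es1 ++ es2))) rAux [::])
      rX (bs (head [::] es2)))
    (20 * size (flat (es1 ++ es2)) + 3).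
Proof.
move=> ht ha hx hz.
have [y [hy1 hy2]] : exists y, s rTab = bs (head [::] es2) ++ y /\
    (if y is a :: _ then ~~ isbit a else true) = true.
  rewrite ht; case: (es2) => [|e es]; first by exists [::].
  by exists (None :: flat es); rewrite flat_cons.
have hsz : size (head [::] es2) + size y = size (flat es2).
  by rewrite -ht hy1 size_cat size_bs.
apply: run_le (run_seq (run_pours hy1 (all_isbit _) hy2 _ _)
  (run_seq (run_move _ _) (run_move _ _))) _ _ => //.
- by_regs => //; rewrite ?ha ?hx ?hz ?catrevE ?rev_cat ?revK ?cats0 ?revK //.
  by rewrite flat_cat -ht hy1 catA.
rewrite /poured /upd /= ha hz !catrevE !cats0 flat_cat !size_cat !size_rev size_bs.
by rewrite -hsz; lia.
Qed.

Definition lookup (d : 'I_m) : cmd reg :=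
  Seq (skip_entries d [:: rAux]) fetch.

Lemma run_lookup d s es k : s rTab = flat es -> s (rOff d) = unary k ->
  s rC = [::] -> s rTmp = [::] -> s rAux = [::] -> s rX = [::] -> s rZ = [::] ->
  run (lookup d) s (upd s rX (bs (nth [::] es k)))
    (k * (6 * size (flat es) + 23) + 20 * size (flat es) + 6).
Proof.
move=> ht hd hc hp ha hx hz.
apply: run_le (run_seq (run_skip_entries (es := es) _ _ _ _ hd _ _)
  (run_fetch (es1 := take k es) (es2 := drop k es) _ _ _ _)) _ _ => //.
- by rewrite /poured /= ha catrevE cats0.
- by rewrite cat_take_drop -nth0 nth_drop addn0; by_regs.
by rewrite cat_take_drop /=; nia.
Qed.

Definition drop_entries (d : 'I_m) : cmd reg := skip_entries d [::].

Lemma run_drop_entries d s es k : s rTab = flat es -> s (rOff d) = unary k ->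
  s rC = [::] -> s rTmp = [::] ->
  run (drop_entries d) s (upd s rTab (flat (drop k es)))
    (k * (4 * size (flat es) + 21) + 3).
Proof.
move=> ht hd hc hp.
apply: run_le (run_skip_entries (es := es) _ _ _ _ hd _ _) _ _ => //.
by rewrite /=; nia.
Qed.

End Tables.

Arguments run_fetch {m A s es1 es2} _ _ _ _.
Arguments run_lookup {m A d s es k} _ _ _ _ _ _ _.
Arguments run_drop_entries {m A d s es k} _ _ _ _.
Arguments run_skip_entry {m A js s es} _ _ _.

(** * Asking the oracle *)

Section Queries.
Variable m : nat.
Notation reg := (reg m).
Implicit Types (s : store reg).

Definition num n : seq (option bool) := rcons (bs (bprint (nbits n))) None.

Lemma size_num n : size (num n) <= n + 2.
Proof.
rewrite size_rcons size_bs /bprint; have := size_nbits n.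
by case: eqP => //= _; rewrite ?size_rev; lia.
Qed.

Lemma encode_num (a : seq nat) : encode a = map Some (flatten (map num a)).
Proof.
elim: a => //= x a IH; rewrite map_cat -IH /encode /=; congr (_ ++ _).
by rewrite bin_nbits /num map_rcons /bs -map_comp.
Qed.

Lemma bval_bprint e : bval (rev (bprint e)) = bval e.
Proof. by rewrite /bprint; case: eqP => [->|] //; rewrite revK. Qed.

(** The oracle is given a string; it answers by [tau] because only one list of
    numbers has that encoding. *)
Lemma encode_inj : injective encode.
Proof.
have num_inj x y u w : num x ++ u = num y ++ w -> x = y /\ u = w.
  rewrite /num !cat_rcons => e.
  have [e1 e2] : bprint (nbits x) = bprint (nbits y) /\ u = w.
    move: (bprint _) (bprint _) e => p q.
    by elim: p q => [|b p IH] [|c q] //= [] => [->|-> /IH[-> ->]].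
  split=> //; rewrite -(bval_nbits x) -(bval_nbits y) -bval_bprint e1.
  exact: bval_bprint.
move=> a b; rewrite !encode_num => /inj_map-/(_ (@Some_inj _)).
elim: a b => [|x a IH] [|y b] //=.
- by rewrite /num; case: bs.
- by rewrite /num; case: bs.
by move=> /num_inj[-> /IH ->].
Qed.

Lemma oracle_encode tau a : `[< oracle tau (encode a) >] = tau a.
Proof.
by apply/asboolP/idP => [[b /encode_inj ->]|h] //; exists a.
Qed.

Variable tau : seq nat -> bool.
Notation run := (@run _ (@rQuery m) (oracle tau)).

(** The trailing ones are popped and come back as zeros. *)
Definition increment : cmd reg :=
  Seq (pours (pred1 (Some true)) rBits [:: rW])
    (Seq (Pop rBits) (Seq (Push rBits (Some true))
      (Loop rW (Push rBits (Some false))))).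

Lemma run_increment s e : s rBits = bs e -> s rW = [::] ->
  run increment s (upd s rBits (bs (incb e))) (10 * size e + 10).
Proof.
move=> hb hw; set k := find negb e.
have hk : k <= size e := find_size _ _.
have e1 : take k e = nseq k true.
  have : all (pred1 true) (take k e).
    apply/(all_nthP true) => i; rewrite size_take_min => hi.
    rewrite nth_take; last by lia.
    have := @before_find _ true negb e i; rewrite -/k => /(_ ltac:(lia)).
    by case: nth.
  by move/all_pred1P => ->; rewrite size_take_min (minn_idPl hk).
have hb' : s rBits = unary k ++ bs (drop k e).
  by rewrite hb -[in LHS](cat_take_drop k e) e1 /bs map_cat map_nseq.
pose st j := upd (upd s rBits (nseq j (Some false) ++ Some true :: bs (drop k.+1 e)))
  rW (unary (k - j)).
apply: run_le (run_seq (run_pours hb' _ _ _ _) (run_seq (run_pop _ _)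
  (run_seq (run_push _ _ _) (_ : run _ _ (st k) _)))) _ _ => //.
- by apply/allP => x /nseqP[-> _] /=.
- have := @nth_find _ true negb e; rewrite has_find -/k.
  case: (ltnP k (size e)) => [lt /(_ isT)|ge _]; last by rewrite drop_oversize.
  by rewrite (drop_nth true lt) /=; case: nth.
- set s0 := upd _ _ _; have -> : s0 = st 0.
    rewrite /s0 /st subn0; by_regs => //; rewrite ?hw ?catrevE ?cats0.
      by rewrite -[k.+1]add1n -drop_drop; case: (drop k e) => //= ? ?; rewrite drop0.
    by rewrite /unary rev_nseq.
  apply: (run_loop st (K := 2)) => j hj; first by [].
  apply: run_le (run_push _ _ _) _ _ => //.
  by rewrite /st; by_regs.
- by rewrite /st subnn incbE /= -/k; by_regs => //; rewrite /bs map_cat map_nseq.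
by rewrite size_unary /=; lia.
Qed.

Definition numeral (i : reg) : cmd reg := Seq (copy i rC rTmp) (Loop rC increment).

Lemma run_numeral i s n : uniq [:: i; rC; rTmp] -> s i = unary n ->
  s rBits = [::] -> s rC = [::] -> s rW = [::] -> s rTmp = [::] ->
  run (numeral i) s (upd s rBits (bs (nbits n))) (n * (10 * n + 30) + 5).
Proof.
move=> hu hi hb hc hw ht.
pose st j := upd (upd s rBits (bs (nbits j))) rC (unary (n - j)).
apply: run_le (run_seq (run_copy hu ht) (_ : run _ _ (st n) _)) _ _ => //.
- have -> : upd s rC (s i ++ s rC) = st 0.
    by rewrite /st subn0 hi hc cats0; by_regs.
  apply: (run_loop st (K := 10 * n + 10)) => j hj; first by [].
  apply: run_le (run_increment (e := nbits j) _ _) _ _ => //.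
    by rewrite /st; by_regs.
  by have := size_nbits j; lia.
- by rewrite /st subnn; by_regs.
by rewrite hi size_unary; nia.
Qed.

(** A stack is filled from the back, so the separator comes first, and then the
    digits with the least significant one in front. *)
Definition push_num (i : reg) : cmd reg :=
  Seq (numeral i) (Seq (Push rQuery None)
    (Case (fun h => if full rBits h then pour rBits [:: rQuery]
                    else Push rQuery (Some false)))).

Lemma run_push_num i s n : uniq [:: i; rC; rTmp] -> s i = unary n ->
  s rBits = [::] -> s rC = [::] -> s rW = [::] -> s rTmp = [::] ->
  run (push_num i) s (upd s rQuery (num n ++ s rQuery)) (n * (10 * n + 40) + 15).
Proof.
move=> hu hi hb hc hw ht.
apply: run_le (run_seq (run_numeral hu hi hb hc hw ht) (run_seq (run_push _ _ _)
  (run_case (K := 6 * n + 3) (s' := upd s rQuery (num n ++ s rQuery)) _))) erefl _.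
  rewrite full_tops /= /num /bprint {2}/upd /=.
  have := size_nbits n; case: (nbits n) => [|b e] hsz.
    apply: run_le (run_push _ _ _) _ _; last by lia.
    by by_regs.
  rewrite /=; apply: run_le (run_move _ _) _ _ => //.
    by by_regs => //; rewrite ?hb // catrevE /bs cat_rcons map_rev /= rev_cons cat_rcons.
  by rewrite /upd /= size_map; move: hsz => /=; lia.
by lia.
Qed.

Definition push_digits (l : seq 'I_m) : cmd reg :=
  foldr (fun i c => Seq c (push_num (rK i))) (Skip reg) l.

Lemma run_push_digits l s (k : 'I_m -> nat) N : (forall i, s (rK i) = unary (k i)) ->
  (forall i, k i <= N) ->
  s rBits = [::] -> s rC = [::] -> s rW = [::] -> s rTmp = [::] ->
  run (push_digits l) s
    (upd s rQuery (flatten [seq num (k i) | i <- l] ++ s rQuery))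
    (size l * (N * (10 * N + 40) + 15) + 1).
Proof.
move=> hk hN hb hc hw ht; elim: l => [|i l IH] /=.
  by apply: run_le (run_skip _) _ _ => //; by_regs.
apply: run_le (run_seq IH (run_push_num (n := k i) _ _ _ _ _ _)) _ _ => //.
- by rewrite /upd /= hk.
- by by_regs => //; rewrite catA.
by have := hN i; nia.
Qed.

Definition ask_oracle : cmd reg :=
  Seq (push_num rT) (Seq (push_digits (enum 'I_m)) (Seq (push_num rN)
    (Ask (Seq (pour rQuery [::]) (Seq (Push rTab None) (Push rTab (Some true))))
         (Seq (pour rQuery [::]) (Push rTab None))))).

Definition cost_ask N T := (m.+2) * (N * (10 * N + 50) + 40) + T * (10 * T + 50) + 60.

Lemma size_flatten_num (a : seq nat) N : (forall x, x \in a -> x <= N) ->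
  size (flatten (map num a)) <= size a * (N + 2).
Proof.
elim: a => //= x a IH h; rewrite size_cat mulSn leq_add //.
  by apply: leq_trans (size_num x) _; rewrite leq_add2r h ?mem_head.
by apply: IH => y hy; apply: h; rewrite in_cons hy orbT.
Qed.

Lemma run_ask_oracle s n t (k : 'I_m -> nat) es :
  s rN = unary n -> s rT = unary t -> (forall i, s (rK i) = unary (k i)) ->
  (forall i, k i <= n) -> s rTab = flat es -> s rQuery = [::] ->
  s rBits = [::] -> s rC = [::] -> s rW = [::] -> s rTmp = [::] ->
  run ask_oracle s (upd s rTab
    (flat (nseq (tau (n :: rcons [seq k i | i <- enum 'I_m] t)) true :: es)))
    (cost_ask n t).
Proof.
move=> hn ht hk hkn hes hq hb hc hw hp.
set a := n :: rcons _ t.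
have eqQ : num n ++ flatten [seq num (k i) | i <- enum 'I_m] ++ num t ++ [::] =
    flatten (map num a).
  by rewrite /a /= map_rcons flatten_rcons -map_comp cats0.
apply: run_le (run_seq (run_push_num (n := t) _ ht hb hc hw hp)
  (run_seq (run_push_digits (k := k) (N := n) _ _ _ _ _ _ _)
  (run_seq (run_push_num (n := n) _ _ _ _ _ _)
    (run_ask (K := 4 * size (flatten (map num a)) + 5)
       (s' := upd s rTab (flat (nseq (tau a) true :: es))) _)))) erefl _ => //.
- rewrite {2}/upd /= {2}/upd /= {2}/upd /= hq eqQ -encode_num oracle_encode.
  case: (tau a).
    apply: run_le (run_seq (run_clear _ _) (run_seq (run_push _ _ _)
      (run_push _ _ _))) _ _; rewrite /upd /= ?hq ?eqQ //; last by lia.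
    by by_regs; rewrite ?hq ?hes.
  apply: run_le (run_seq (run_clear _ _) (run_push _ _ _)) _ _;
    rewrite /upd /= ?hq ?eqQ //; last by lia.
  by by_regs; rewrite ?hq ?hes.
have -> : size (flatten (map num a)) =
    size (num n) + size (flatten [seq num (k i) | i <- enum 'I_m]) + size (num t).
  by rewrite -eqQ !size_cat /= addn0 addnA.
have h1 := size_num n; have h2 := size_num t.
have h3 : size (flatten [seq num (k i) | i <- enum 'I_m]) <= m * (n + 2).
  rewrite (map_comp num k); apply: leq_trans (size_flatten_num (N := n) _) _.
    by move=> x /mapP[i _ ->].
  by rewrite size_map size_enum_ord.
rewrite size_enum_ord /cost_ask; nia.
Qed.

End Queries.

Arguments run_ask_oracle {m tau s n t k es} _ _ _ _ _ _ _ _ _ _.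

(** * Odometer, powers and input *)

Section Setup.
Variable m : nat.
Notation reg := (reg m).
Variable A : seq sym -> Prop.
Notation run := (@run _ (@rQuery m) A).
Implicit Types (s : store reg).

Definition dig n q (i : nat) : nat := (q %/ n.+1 ^ i) %% n.+1.

Definition updK s (f : 'I_m -> nat) : store reg :=
  fun r => if r is rK i then unary (f i) else s r.

Definition updOff s (f : 'I_m -> nat) : store reg :=
  fun r => if r is rOff i then unary (f i) else s r.

(** The letter counts of an entry of the table are the digits of its index in base
    [n.+1], and the entries are made by decreasing index; so the counts are
    updated by subtracting one, with borrow, and no division is needed. *)
Definition odometer_on (l : seq 'I_m) : cmd reg :=
  foldr (fun i c => Case (fun h => if full (rK i) h then Pop (rK i)
                          else Seq (copy rN (rK i) rTmp) c)) (Skip reg) l.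

Definition odometer := odometer_on (enum 'I_m).

Fixpoint borrow_digits n (l : seq 'I_m) (k : 'I_m -> nat) : 'I_m -> nat :=
  if l is i :: l' then
    if k i is k'.+1 then fun j => if j == i then k' else k j
    else borrow_digits n l' (fun j => if j == i then n else k j)
  else k.

Lemma run_odometer_on l s n (k : 'I_m -> nat) :
  s rN = unary n -> s rTmp = [::] -> (forall i, s (rK i) = unary (k i)) ->
  run (odometer_on l) s (updK s (borrow_digits n l k)) (size l * (14 * n + 5) + 1).
Proof.
elim: l s k => [|i l IH] s k hn ht hk /=.
  apply: run_le (run_skip _) _ _ => //.
  by rewrite /updK; apply/funext; case.
case ki : (k i) => [|k'].
  apply: run_le (run_case (K := 14 * n + 3 + (size l * (14 * n + 5) + 1)) _) erefl _.
    rewrite full_tops hk ki /=.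
    apply: run_le (run_seq (run_copy _ _) (IH _ (fun j => if j == i then n else k j) _ _ _)) _ _ => //.
    - by move=> j; rewrite /upd /= hn hk ki cats0 -[rK j == rK i]/(j == i); case: ifP; rewrite ?hk.
    - by rewrite /updK /upd; apply/funext; case.
    by rewrite hn size_unary; lia.
  by lia.
apply: run_le (run_case (K := 1) _) erefl _; last by lia.
rewrite full_tops hk ki /=.
apply: run_le (run_pop _ _) _ _ => //.
rewrite /updK /upd; apply/funext; case=> //= j.
by rewrite -[rK j == rK i]/(j == i) hk ki /=; case: ifP; rewrite ?hk.
Qed.

(** By induction on the digits that remain: a nonzero digit stops the borrow and
    leaves the higher digits alone, a zero digit becomes [n] and passes it on. *)
Lemma borrow_digitsE n q (i : 'I_m) :
  borrow_digits n (enum 'I_m) (fun i => dig n q.+1 i) i = dig n q i.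
Proof.
have gen j (l : seq 'I_m) (k : 'I_m -> nat) q' : map val l = iota j (m - j) ->
    (forall i : 'I_m, j <= i -> k i = dig n q'.+1 (i - j)) ->
    forall i : 'I_m, borrow_digits n l k i =
      if j <= i then dig n q' (i - j) else k i.
  elim: l j k q' => [|i0 l IH] j k q' hl hk i1.
    have : m - j = 0 by move: hl => /(congr1 size) /=; rewrite size_iota.
    by case: leqP => //= h1 h2; have := ltn_ord i1; lia.
  have hj : j < m by move: hl => /(congr1 size) /=; rewrite size_iota; lia.
  move: hl; have -> : m - j = (m - j.+1).+1 by lia.
  move=> /= [e0 hl]; rewrite hk e0 // subnn /=.
  have hdiv x y : dig n x y.+1 = dig n (x %/ n.+1) y.
    by rewrite /dig expnS divnMA.
  have [r er] : exists r, dig n q'.+1 0 = r by eexists.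
  have d0 x : dig n x 0 = x %% n.+1 by rewrite /dig divn1.
  rewrite er; move: er; rewrite d0; case: r => [|r] er.
    have e1 : q'.+1 = ((q'.+1 %/ n.+1).-1.+1 * n.+1).
      have := divn_eq q'.+1 n.+1; rewrite er addn0 => {1}->.
      by case: (_ %/ _) (divn_eq q'.+1 n.+1) => //; rewrite er mul0n.
    set q2 := (q'.+1 %/ n.+1).-1 in e1.
    have eq' : q' = q2 * n.+1 + n by rewrite mulSn in e1; lia.
    have eq2 : q' %/ n.+1 = q2 by rewrite eq' divnMDl // divn_small ?addn0.
    rewrite (IH j.+1 _ q2) //.
      case: (ltngtP j i1) => [lt|gt|/esym e].
      - have -> : i1 - j = (i1 - j.+1).+1 by lia.
        by rewrite hdiv eq2.
      - case: eqP => // e; move: gt; rewrite e e0 => gt; lia.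
      have -> : i1 == i0 by apply/eqP/val_inj; rewrite /= e e0.
      by rewrite e subnn d0 eq' modnMDl modn_small.
    move=> y ij; case: eqP => [e|_]; first by move: ij; rewrite e e0; lia.
    rewrite hk; last by lia.
    have -> : y - j = (y - j.+1).+1 by lia.
    rewrite hdiv; congr dig; rewrite [in LHS]e1 mulnK //.
  have e1 : q' = q'.+1 %/ n.+1 * n.+1 + r.
    by have := divn_eq q'.+1 n.+1; rewrite er; lia.
  have rn : r < n by have := ltn_pmod q'.+1 (ltn0Sn n); rewrite er; lia.
  case: (eqVneq i1 i0) => [->|ne].
    by rewrite e0 leqnn subnn d0 e1 modnMDl modn_small // ltnS ltnW.
  case: leqP => // ij.
  have lt : j < i1.
    by rewrite ltn_neqAle ij andbT; apply: contra_neq ne => e; apply: val_inj; rewrite /= e0 -e.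
  rewrite hk //; have -> : i1 - j = (i1 - j.+1).+1 by lia.
  rewrite !hdiv; congr dig; rewrite [q' in RHS]e1 divnMDl // (@divn_small r) ?addn0 //.
  by lia.
rewrite (gen 0 _ _ q) ?subn0 // => [|j _]; last by rewrite subn0.
by rewrite val_enum_ord.
Qed.

Lemma run_odometer s n q : s rN = unary n -> s rTmp = [::] ->
  (forall i, s (rK i) = unary (dig n q.+1 i)) ->
  run odometer s (updK s (fun i => dig n q i)) (m * (14 * n + 5) + 1).
Proof.
move=> hn ht hk; apply: run_le (run_odometer_on _ hn ht hk) _ _.
  by congr updK; apply/funext => i; rewrite borrow_digitsE.
by rewrite size_enum_ord.
Qed.

Definition mulN : cmd reg :=
  Seq (copy rN rC rTmp) (Seq (Loop rC (copy rPow rW rTmp)) (pour rW [:: rPow])).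

Lemma run_mulN s n p : s rN = unary n -> s rPow = unary p ->
  s rTmp = [::] -> s rC = [::] -> s rW = [::] ->
  run mulN s (upd s rPow (unary (p * n.+1))) (n * (20 * p + 20) + 10).
Proof.
move=> hn hp ht hc hw.
pose st j := upd (upd s rC (unary (n - j))) rW (unary (p * j)).
apply: run_le (run_seq (run_copy _ _) (run_seq (_ : run _ _ (st n) _)
  (run_move _ _))) _ _ => //.
- have -> : upd s rC (s rN ++ s rC) = st 0.
    by rewrite /st subn0 muln0 hn hc cats0; by_regs.
  apply: (run_loop st (K := 14 * p + 2)) => j hj; first by [].
  apply: run_le (run_copy _ _) _ _ => //.
    rewrite /st; by_regs => //.
    by rewrite hp /unary -nseqD; congr nseq; lia.
  by rewrite /st /upd /= hp size_unary.
- rewrite /st subnn; by_regs => //.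
  by rewrite hp catrevE /unary rev_nseq -nseqD; congr nseq; lia.
rewrite hn /st /upd /= !size_unary; nia.
Qed.

Definition powers_on (l : seq 'I_m) : cmd reg :=
  foldr (fun i c => Seq (copy rPow (rOff i) rTmp) (Seq mulN c)) (Skip reg) l.

Definition adjust_on (l : seq 'I_m) : cmd reg :=
  foldr (fun i c => Seq (copy rPow (rOff i) rTmp) (Seq (Pop (rOff i)) c))
    (Skip reg) l.

(** The entry for one more letter [i] has an index that is larger by
    [n.+1 ^ m + n.+1 ^ i]; the entry to be computed is not on the stack yet,
    whence the [- 1]. *)
Definition offset n (i : 'I_m) : nat := n.+1 ^ m + n.+1 ^ i - 1.

Definition powers : cmd reg :=
  Seq (Push rPow (Some true))
    (Seq (powers_on (enum 'I_m)) (adjust_on (enum 'I_m))).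

Lemma run_powers_on l s n (f : 'I_m -> nat) j : map val l = iota j (m - j) -> j <= m ->
  s rN = unary n -> s rPow = unary (n.+1 ^ j) ->
  (forall i, s (rOff i) = unary (f i)) -> (forall i, i \in l -> f i = 0) ->
  s rTmp = [::] -> s rC = [::] -> s rW = [::] ->
  run (powers_on l) s
    (upd (updOff s (fun i => if i \in l then n.+1 ^ i else f i))
       rPow (unary (n.+1 ^ m)))
    (size l * (n * (20 * n.+1 ^ m + 20) + 14 * n.+1 ^ m + 12) + 1).
Proof.
elim: l s f j => [|i l IH] s f j hl hj hn hp hf h0 ht hc hw.
  have e : m = j by move: hl => /(congr1 size) /=; rewrite size_iota; lia.
  apply: run_le (run_skip _) _ _ => //.
  by rewrite /upd /updOff; apply/funext; case=> //=; rewrite hp -e.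
have jm : j < m by move: hl => /(congr1 size) /=; rewrite size_iota; lia.
move: hl; have -> : m - j = (m - j.+1).+1 by lia.
move=> /= [ei hl].
have il : i \notin l.
  by apply/negP => /(map_f val); rewrite hl mem_iota /= ei ltnn.
have pj : n.+1 ^ j <= n.+1 ^ m by apply: leq_pexp2l => //; apply: ltnW.
apply: run_le (run_seq (run_copy _ _) (run_seq (run_mulN (n := n) (p := n.+1 ^ j) _ _ _ _ _)
  (IH _ (fun i' => if i' == i then n.+1 ^ i else f i') j.+1 hl _ _ _ _ _ _ _ _))) _ _ => //.
- by rewrite /upd /= expnSr.
- move=> i'; rewrite /upd /= -[rOff i' == rOff i]/(i' == i).
  case: eqP => _; last by rewrite hf.
  by rewrite hp hf h0 ?mem_head // cats0 -ei.
- move=> i' hi'; case: eqP => [e|_]; first by move: il; rewrite -e hi'.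
  by rewrite h0 // in_cons hi' orbT.
- rewrite /upd /updOff; apply/funext; case=> //= i'.
  rewrite in_cons; case: eqP => [->|_] //=; by rewrite (negPf il).
have h : n * (20 * n.+1 ^ j + 20) <= n * (20 * n.+1 ^ m + 20).
  by rewrite leq_mul2l; apply/orP; right; lia.
rewrite hp size_unary [in leqRHS]mulSn. by move: (size l * _) => X; lia.
Qed.

Lemma run_adjust_on l s p (f : 'I_m -> nat) : uniq l -> s rPow = unary p.+1 ->
  s rTmp = [::] -> (forall i, s (rOff i) = unary (f i)) ->
  run (adjust_on l) s (updOff s (fun i => if i \in l then p + f i else f i))
    (size l * (14 * p + 17) + 1).
Proof.
elim: l s f => [|i l IH] s f /=.
  move=> _ hp ht hf; apply: run_le (run_skip _) _ _ => //.
  by rewrite /updOff; apply/funext; case.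
move=> /andP[il hu] hp ht hf.
apply: run_le (run_seq (run_copy _ _) (run_seq (run_pop _ _)
  (IH _ (fun i' => if i' == i then p + f i else f i') hu _ _ _))) _ _ => //.
- move=> i'; rewrite /upd /= -[rOff i' == rOff i]/(i' == i) -[rOff i == rOff i]/(i == i) eqxx.
  case: eqP => _; last by rewrite hf.
  by rewrite hp hf /unary /= -nseqD.
- rewrite /upd /updOff; apply/funext; case=> //= i'.
  by rewrite in_cons; case: eqP => [->|_] //=; rewrite (negPf il).
rewrite hp /= size_nseq [in leqRHS]mulSn.
by move: (size l * _) => X; lia.
Qed.

Lemma run_powers s n : s rN = unary n -> s rPow = [::] ->
  (forall i, s (rOff i) = [::]) -> s rTmp = [::] -> s rC = [::] -> s rW = [::] ->
  run powers s (upd (updOff s (offset n)) rPow (unary (n.+1 ^ m)))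
    (m * (n * (20 * n.+1 ^ m + 20) + 28 * n.+1 ^ m + 40) + 10).
Proof.
move=> hn hp ho ht hc hw.
have p0 : n.+1 ^ m = (n.+1 ^ m).-1.+1 by rewrite prednK // expn_gt0.
apply: run_le (run_seq (run_push _ _ _) (run_seq
  (run_powers_on (n := n) (f := fun=> 0) (j := 0) _ _ _ _ _ _ _ _ _)
  (run_adjust_on (p := (n.+1 ^ m).-1) (f := fun i => n.+1 ^ i) _ _ _ _))) _ _ => //.
- by rewrite val_enum_ord subn0.
- by rewrite /upd /= hp.
- by rewrite enum_uniq.
- by rewrite -p0.
- by move=> i; rewrite /upd /= mem_enum.
- rewrite /upd /updOff; apply/funext; case=> //= i.
  by rewrite mem_enum /=; congr unary; rewrite /offset; have := expn_gt0 n.+1 i; lia.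
rewrite size_enum_ord; nia.
Qed.

(** Reading the input: the first number is turned into unary by Horner's rule,
    doubling for every digit; the second one is kept in binary. *)
Definition parse_unary : cmd reg :=
  While (topis rIn isbit) (Case (fun h =>
    Seq (Pop rIn) (Seq (pour rN [:: rTmp; rW]) (Seq (pour rTmp [:: rN])
      (Seq (pour rW [:: rN])
        (if tbit h rIn then Push rN (Some true) else Skip reg)))))).

Definition horner a (w : seq bool) : nat := foldl (fun x (b : bool) => x.*2 + b) a w.

Lemma leq_horner a w : a <= horner a w.
Proof. by elim: w a => //= b w IH a; apply: leq_trans (IH _); lia. Qed.

Lemma hornerE a w : horner a w = a * 2 ^ size w + bval (rev w).
Proof.
elim/last_ind: w => [|w b IH]; first by rewrite /= muln1 addn0.
rewrite /horner foldl_rcons -/(horner a w) IH rev_rcons size_rcons expnS /=.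
by rewrite -!muln2; lia.
Qed.

Lemma run_parse_unary s w y a N : s rIn = bs w ++ None :: y -> s rN = unary a ->
  horner a w <= N -> s rTmp = [::] -> s rW = [::] ->
  run parse_unary s (upd (upd s rIn (None :: y)) rN (unary (horner a w)))
    (size w * (22 * N + 20) + 1).
Proof.
elim: w s a => [|b w IH] s a hi hn hN ht hw.
  apply: run_le (run_while_end _) _ _ => //.
    by rewrite /topis ffunE hi.
  by by_regs; rewrite ?hi ?hn.
have ha : a <= N by apply: leq_trans hN; exact: leq_horner.
pose s1 := upd (upd s rIn (bs w ++ None :: y)) rN (unary (a.*2 + b)).
apply: run_le (run_while_next _ (run_case (K := 22 * N + 18) (s' := s1) _)
  (IH s1 (a.*2 + b) _ _ _ _ _)) _ _ => //.
- by rewrite /topis ffunE hi.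
- pose s2 := upd (upd s rIn (bs w ++ None :: y)) rN (unary a.*2).
  have hb : tbit (tops s) rIn = b by rewrite /tbit ffunE hi.
  have h2 s' : s' = s2 -> run (if b then Push rN (Some true) else Skip reg) s' s1 2.
    move=> ->; rewrite /s1; case: (b).
      apply: run_le (run_push _ _ _) _ _ => //.
      by rewrite /s2; by_regs => //; rewrite addn1.
    apply: run_le (run_skip _) _ _ => //.
    by rewrite /s2; by_regs => //; rewrite addn0.
  rewrite hb; apply: run_le (run_seq (run_pop _ _) (run_seq (run_pour _ _ _) (run_seq (run_move _ _)
    (run_seq (run_move _ _) (h2 _ _))))) _ _ => //.
    rewrite /s2; by_regs => //; first by rewrite hi.
    rewrite hn ht hw !catrevE !cats0 !revK -nseqD.
    by congr nseq; lia.
  rewrite /poured /upd /= hn ht hw !catrevE !size_cat !size_rev !size_unary /=; lia.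
- by rewrite /s1; by_regs.
by rewrite /= mulSn; lia.
Qed.

Definition parse : cmd reg :=
  Seq parse_unary (Seq (Pop rIn) (Seq (pours isbit rIn [:: rL]) (Pop rIn))).

Lemma run_parse s n l : s rIn = num n ++ num l -> s rN = [::] -> s rL = [::] ->
  s rTmp = [::] -> s rW = [::] ->
  run parse s (upd (upd (upd s rIn [::]) rN (unary n)) rL (bs (rev (bprint (nbits l)))))
    ((n + 1) * (22 * n + 20) + 6 * size (bprint (nbits l)) + 10).
Proof.
move=> hi hn hl ht hw.
have ehn : horner 0 (bprint (nbits n)) = n.
  by rewrite hornerE mul0n add0n bval_bprint bval_nbits.
apply: run_le (run_seq (run_parse_unary (w := bprint (nbits n))
    (y := num l) (a := 0) (N := n) _ _ _ _ _) (run_seq (run_pop _ _)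
  (run_seq (run_pours (x := bs (bprint (nbits l))) (y := [:: None]) _ (all_isbit _) _ _ _)
   (run_pop _ _)))) _ _ => //.
- by rewrite hi /num cat_rcons.
- by rewrite ehn.
- by rewrite /upd /= /num cats1.
- rewrite ehn; by_regs => //.
  by rewrite hl catrevE cats0 /bs map_rev.
have := size_num n; rewrite /num size_rcons !size_bs /=; nia.
Qed.

End Setup.

Arguments run_odometer {m A s n q} _ _ _.
Arguments run_powers {m A s n} _ _ _ _ _ _.
Arguments run_parse {m A s n l} _ _ _ _ _.

(** * Filling the table *)

Section Search.
Variable m : nat.
Notation reg := (reg m).
Variable tau : seq nat -> bool.
Notation run := (@run _ (@rQuery m) (oracle tau)).
Implicit Types (s : store reg).

(** What every phase may assume and must restore; nothing is said of the
    registers that vary from phase to phase. *)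
Definition readyK n (k : 'I_m -> nat) s : Prop := forall r : reg,
  match r with
  | rN => s r = unary n
  | rK i => s r = unary (k i)
  | rOff i => s r = unary (offset n i)
  | rPow => s r = unary (n.+1 ^ m)
  | rIn | rOut | rT | rTab | rL | rGo | rRev | rCnt | rCnt2 => True
  | _ => s r = [::]
  end.

Definition ready n s := readyK n (fun=> n) s.

Lemma readyK_upd n k s r x : readyK n k s ->
  (if r is (rIn | rOut | rT | rTab | rL | rGo | rRev | rCnt | rCnt2) then True
   else x = s r) -> readyK n k (upd s r x).
Proof.
move=> h hx r'; have := h r'; rewrite /upd; case: (r' =P r) => [->|//].
by case: r hx {r'} => //= *; congruence.
Qed.

Definition next_entry n (es : seq (seq bool)) : seq bool :=
  foldl (fun a i => addb a (nth [::] es (offset n i))) [::] (enum 'I_m).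

Definition extend_table n (es : seq (seq bool)) : seq (seq bool) :=
  next_entry n es :: es.

(** The entries for the complete words: one or zero, as the oracle says. *)
Definition last_level n t : seq (seq bool) :=
  [seq nseq (tau (n :: rcons [seq dig n q (i : 'I_m) | i <- enum 'I_m] t)) true
  | q <- iota 0 (n.+1 ^ m)].

Definition table n t : seq (seq bool) :=
  iter (n * n.+1 ^ m) (extend_table n) (last_level n t).

Definition narrow w (es : seq (seq bool)) : bool := all (fun e => size e <= w) es.

Lemma narrow_le w w' es : w <= w' -> narrow w es -> narrow w' es.
Proof. by move=> h; apply: sub_all => e he; apply: leq_trans h. Qed.

Lemma narrow_nth w es k : narrow w es -> size (nth [::] es k) <= w.
Proof.
move=> /(all_nthP [::]) h; case: (ltnP k (size es)) => [/h //|hk].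
by rewrite nth_default.
Qed.

Lemma narrow_flat w es : narrow w es -> size (flat es) <= size es * w.+1.
Proof.
by elim: es => //= e es IH /andP[h /IH]; rewrite size_flat_cons mulSn; lia.
Qed.

Lemma size_sum_entries n w es (l : seq 'I_m) a : narrow w es ->
  size a <= w + m - size l -> size l <= m ->
  size (foldl (fun a i => addb a (nth [::] es (offset n i))) a l) <= w + m.
Proof.
move=> hw; elim: l a => [|i l IH] a /= ha hl; first by lia.
apply: IH; last by lia.
have := size_addb a (nth [::] es (offset n i)).
by have := narrow_nth (offset n i) hw; lia.
Qed.

(** The only bound on the size of the entries that is needed: each of the [m]
    additions makes the sum at most one digit longer. *)
Lemma narrow_extend n w es : narrow w es -> narrow (w + m) (extend_table n es).
Proof.
move=> h; rewrite /= (narrow_le _ h) ?leq_addr // andbT.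
by apply: size_sum_entries => //; rewrite size_enum_ord //; lia.
Qed.

Lemma narrow_iter n w es q : narrow w es ->
  narrow (w + q * m) (iter q (extend_table n) es).
Proof.
move=> h; elim: q => [|q IH]; first by rewrite addn0.
by rewrite iterS mulSn [m + _]addnC addnA; apply: narrow_extend.
Qed.

Lemma size_iter_extend n q es : size (iter q (extend_table n) es) = q + size es.
Proof. by elim: q => //= q ->. Qed.

Lemma narrow_last_level n t : narrow 1 (last_level n t).
Proof. by apply/allP => e /mapP[q _ ->]; rewrite size_nseq; case: tau. Qed.

Lemma size_last_level n t : size (last_level n t) = n.+1 ^ m.
Proof. by rewrite size_map size_iota. Qed.

Definition add_entries_on (l : seq 'I_m) : cmd reg :=
  foldr (fun i c => Seq (lookup i) (Seq (add m) c)) (Skip reg) l.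

Definition extend : cmd reg :=
  Seq (add_entries_on (enum 'I_m)) (Seq (Push rTab None)
    (Seq (pour rAcc [:: rS]) (pour rS [:: rTab]))).

Definition cost_lookup o Z := o * (6 * Z + 23) + 20 * Z + 6.

Lemma run_lookup_le s d n k es w o Z : readyK n k s -> s rTab = flat es ->
  offset n d <= o -> size (flat es) <= Z -> narrow w es ->
  run (lookup d) s (upd s rX (bs (nth [::] es (offset n d)))) (cost_lookup o Z).
Proof.
move=> hs ht ho hz hw.
apply: run_le (run_lookup ht (hs (rOff d)) (hs rC) (hs rTmp) (hs rAux)
  (hs rX) (hs rZ)) erefl _.
rewrite /cost_lookup !leq_add // ?leq_mul // ?leq_add // ?leq_mul //.
Qed.

Lemma run_add_entries_on l s n es a w o Z : narrow w es -> size (flat es) <= Z ->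
  (forall i : 'I_m, offset n i <= o) -> ready n (upd s rAcc [::]) ->
  size a <= w + m - size l -> size l <= m ->
  s rTab = flat es -> s rAcc = bs a ->
  run (add_entries_on l) s
    (upd s rAcc (bs (foldl (fun a i => addb a (nth [::] es (offset n i))) a l)))
    (size l * (cost_lookup o Z + 21 * (w + m) + 20) + 1).
Proof.
move=> hw hz ho; elim: l s a => [|i l IH] s a hs ha hl ht hac.
  apply: run_le (run_skip _) _ _ => //.
  by by_regs; rewrite ?hac.
have hx := narrow_nth (offset n i) hw.
set x := nth [::] es (offset n i) in hx.
rewrite /= in ha hl *.
have off := hs (rOff i); rewrite /upd /= in off.
apply: run_le (run_seq (run_lookup (es := es) (k := offset n i) _ _ _ _ _ _ _)
  (run_seq (run_add (a := a) (b := x) _ _ _ _ _)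
  (IH _ (addb a x) _ _ _ _ _))) _ _ => //.
- exact: (hs rC).
- exact: (hs rTmp).
- exact: (hs rAux).
- exact: (hs rX).
- exact: (hs rZ).
- exact: (hs rCarry).
- exact: (hs rD).
- exact: (hs rS).
- by move=> r; have := hs r; rewrite /upd; case: r.
- by have := size_addb a x; lia.
- by lia.
- by have := hs rX; rewrite /upd /= => hX; by_regs => //; rewrite hX.
have h1 : offset n i * (6 * size (flat es) + 23) + 20 * size (flat es) + 6 <=
    cost_lookup o Z.
  by rewrite /cost_lookup !leq_add // ?leq_mul // ?leq_add // ?leq_mul.
rewrite [in leqRHS]mulSn; set c := cost_lookup o Z in h1 *.
move: (_ + 6) h1 => u hu; move: (size l * _) => X.
have : maxn (size a) (size x) <= w + m by lia.
lia.
Qed.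

Definition cost_extend o Z w :=
  m * (cost_lookup o Z + 21 * (w + m) + 20) + 12 * (w + m) + 5.

Lemma run_extend s n es w o Z : narrow w es -> size (flat es) <= Z ->
  (forall i : 'I_m, offset n i <= o) -> ready n s -> s rTab = flat es ->
  run extend s (upd s rTab (flat (extend_table n es))) (cost_extend o Z w).
Proof.
move=> hw hz ho hs ht.
have hsz : size (next_entry n es) <= w + m.
  by apply: size_sum_entries => //; rewrite size_enum_ord //; lia.
have hA := hs rAcc; have hS := hs rS.
apply: run_le (run_seq (run_add_entries_on (es := es) (a := [::]) hw hz ho _ _ _ _ _)
  (run_seq (run_push _ _ _) (run_seq (run_move _ _) (run_move _ _)))) _ _ => //.
- by apply: readyK_upd.
- by rewrite size_enum_ord.
- by_regs => //.
  by rewrite hS ht !catrevE cats0 revK /extend_table flat_cons.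
move: hsz; rewrite /upd /= hS !catrevE !cats0 size_rev size_bs size_enum_ord.
by rewrite /cost_extend -/(next_entry n es); move: (m * _) => X; lia.
Qed.

Definition fill_last : cmd reg :=
  Seq (copy rPow rCnt rTmp) (Loop rCnt (Seq (ask_oracle m) (odometer m))).

Definition cost_fill_last n t :=
  n.+1 ^ m * (cost_ask m n t + m * (14 * n + 5) + 17) + 3.

Lemma dig_mod n q (i : 'I_m) : dig n (n.+1 ^ m + q) i = dig n q i.
Proof.
rewrite /dig; have -> : n.+1 ^ m = n.+1 ^ (m - i.+1) * n.+1 * n.+1 ^ i.
  by rewrite -expnSr -expnD; congr expn; have := ltn_ord i; lia.
by rewrite divnMDl ?expn_gt0 // modnMDl.
Qed.

Lemma dig_top n (i : 'I_m) : dig n (n.+1 ^ m).-1 i = n.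
Proof.
rewrite /dig; set P := n.+1 ^ m.
have -> : P.-1 = (n.+1 ^ (m - i.+1)).-1 * n.+1 * n.+1 ^ i + n * n.+1 ^ i + (n.+1 ^ i).-1.
  have : P = n.+1 ^ (m - i.+1) * n.+1 * n.+1 ^ i.
    by rewrite -expnSr -expnD; congr expn; have := ltn_ord i; lia.
  have : 0 < n.+1 ^ i by rewrite expn_gt0.
  have : 0 < n.+1 ^ (m - i.+1) by rewrite expn_gt0.
  move: (n.+1 ^ i) (n.+1 ^ (m - i.+1)) P => [//|a] [//|b] P _ _ -> /=.
  by lia.
rewrite -mulnDl divnMDl ?expn_gt0 // divn_small; last by rewrite prednK ?expn_gt0.
by rewrite addn0 modnMDl modn_small.
Qed.

Lemma run_fill_last s n t : ready n s -> s rT = unary t -> s rTab = [::] ->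
  s rCnt = [::] ->
  run fill_last s (upd s rTab (flat (last_level n t))) (cost_fill_last n t).
Proof.
move=> hs ht hb hc; set P := n.+1 ^ m.
have P0 : 0 < P by rewrite expn_gt0.
pose ent q := nseq (tau (n :: rcons [seq dig n q (i : 'I_m) | i <- enum 'I_m] t)) true.
(* The digits start and end at [n]: the index runs from [2 * P - 1] down to
   [P - 1], one full turn of the odometer. *)
pose st j := upd (upd (updK s (fun i => dig n (2 * P - 1 - j) i)) rTab
  (flat [seq ent q | q <- iota (2 * P - j) j])) rCnt (unary (P - j)).
have dig0 (i : 'I_m) : dig n (2 * P - 1) i = n.
  have -> : 2 * P - 1 = P + P.-1 by lia.
  by rewrite dig_mod dig_top.
have digP (i : 'I_m) : dig n (2 * P - 1 - P) i = n.
  have -> : 2 * P - 1 - P = P.-1 by lia.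
  by rewrite dig_top.
have sK i : s (rK i) = unary n := hs (rK i).
apply: run_le (run_seq (run_copy _ _) (_ : run _ _ (st P) _)) _ _ => //.
- exact: hs rTmp.
- have -> : upd s rCnt (s rPow ++ s rCnt) = st 0.
    rewrite /st (hs rPow) hc cats0 /updK !subn0; by_regs => //.
    by rewrite sK dig0.
  apply: (run_loop st (K := cost_ask m n t + (m * (14 * n + 5) + 1))) => j hj.
    by [].
  have ej : 2 * P - 1 - j = (2 * P - 1 - j.+1).+1 by lia.
  apply: run_le (run_seq (run_ask_oracle (n := n) (t := t) (k := fun i => dig n (2 * P - 1 - j) i)
      (es := [seq ent q | q <- iota (2 * P - j) j]) _ _ _ _ _ _ _ _ _ _)
    (run_odometer (n := n) (q := 2 * P - 1 - j.+1) _ _ _)) _ _ => //.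
  + exact: (hs rN).
  + by move=> i; rewrite -ltnS ltn_pmod.
  + exact: (hs rQuery).
  + exact: (hs rBits).
  + exact: (hs rC).
  + exact: (hs rW).
  + exact: (hs rTmp).
  + exact: (hs rN).
  + exact: (hs rTmp).
  + by move=> i; rewrite -ej.
  rewrite /st /updK; by_regs => //.
  have -> : 2 * P - j = (2 * P - j.+1).+1 by lia.
  by have -> : 2 * P - 1 - j = 2 * P - j.+1 by lia.
- rewrite /st subnn /updK; by_regs => //; last by rewrite digP sK.
  have -> : 2 * P - P = P + 0 by lia.
  congr flat; rewrite iotaDl -map_comp; apply: eq_map => q /=.
  rewrite /ent; congr (nseq (tau (n :: rcons _ t)) true).
  by apply: eq_map => i; rewrite dig_mod.
rewrite (hs rPow) size_unary /cost_fill_last -/P; move: (cost_ask _ _ _) => c.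
by move: (m * _) => d; nia.
Qed.

Definition fill_table : cmd reg :=
  Seq fill_last (Seq (copy rN rCnt2 rTmp)
    (Loop rCnt2 (Seq (copy rPow rCnt rTmp) (Loop rCnt extend)))).

Definition width n := 1 + n * n.+1 ^ m * m.
Definition volume n := (n.+1 ^ m + n * n.+1 ^ m) * (width n).+1.

Lemma narrow_stage n t q : q <= n * n.+1 ^ m ->
  narrow (width n) (iter q (extend_table n) (last_level n t)).
Proof.
move=> hq; apply: narrow_le (narrow_iter n q (narrow_last_level n t)).
by rewrite /width leq_add2l leq_mul2r hq orbT.
Qed.

Lemma volume_stage n t q : q <= n * n.+1 ^ m ->
  size (flat (iter q (extend_table n) (last_level n t))) <= volume n.
Proof.
move=> hq; apply: leq_trans (narrow_flat (narrow_stage t hq)) _.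
rewrite /volume leq_mul2r size_iter_extend size_last_level.
by apply/orP; right; rewrite addnC leq_add2l.
Qed.

Lemma offset_le n (i : 'I_m) : offset n i <= 2 * n.+1 ^ m.
Proof.
have : n.+1 ^ i <= n.+1 ^ m by apply: leq_pexp2l => //; apply: ltnW.
by rewrite /offset; lia.
Qed.

Definition cost_stage n := cost_extend (2 * n.+1 ^ m) (volume n) (width n).

Definition cost_table n t := cost_fill_last n t +
  (n * (n.+1 ^ m * (cost_stage n + 20) + 20) + 14 * n + 10).

Lemma run_fill_table s n t : ready n s -> s rT = unary t -> s rTab = [::] ->
  s rCnt = [::] -> s rCnt2 = [::] ->
  run fill_table s (upd s rTab (flat (table n t))) (cost_table n t).
Proof.
move=> hs ht hb hc hc2; set P := n.+1 ^ m.
pose st j := upd (upd s rTab (flat (iter (j * P) (extend_table n) (last_level n t))))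
  rCnt2 (unary (n - j)).
apply: run_le (run_seq (run_fill_last hs ht hb hc) (run_seq (run_copy _ _)
  (_ : run _ _ (st n) _))) _ _ => //.
- exact: hs rTmp.
- set s1 := upd _ _ _; have -> : s1 = st 0.
    by rewrite /s1 /st subn0 mul0n /upd /= (hs rN) hc2 cats0; by_regs.
  apply: (run_loop st (K := P * (cost_stage n + 20) + 10)) => j hj; first by [].
  pose st2 i := upd (upd (upd s rTab
    (flat (iter (j * P + i) (extend_table n) (last_level n t))))
    rCnt2 (unary (n - j.+1))) rCnt (unary (P - i)).
  apply: run_le (run_seq (run_copy _ _) (_ : run _ _ (st2 P) _)) _ _ => //.
  + exact: hs rTmp.
  + set s2 := upd _ _ _; have -> : s2 = st2 0.
      rewrite /s2 /st2 /st subn0 addn0; by_regs => //.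
      by rewrite (hs rPow) hc cats0.
    apply: (run_loop st2 (K := cost_stage n)) => i hi; first by [].
    have hji : j * P + i <= n * P.
      have : j.+1 * P <= n * P by rewrite leq_mul2r hj orbT.
      by rewrite mulSn; lia.
    apply: run_le (run_extend (n := n) (w := width n) (o := 2 * P) (Z := volume n)
      (narrow_stage t hji) (volume_stage t hji) (@offset_le n) _ _) _ _ => //.
      by do 4!apply: readyK_upd => //.
    by rewrite /st2 addnS; by_regs.
  + by rewrite /st2 /st subnn mulSn addnC; by_regs.
  rewrite /st /upd /= (hs rPow) size_unary -/P.
  by move: (cost_stage n) => c; nia.
- by rewrite /st subnn; by_regs.
rewrite /upd /= (hs rN) size_unary /cost_table -/P.
by move: (cost_stage n) (cost_fill_last n t) => c d; nia.
Qed.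

End Search.

Arguments run_fill_table {m tau s n t} _ _ _ _ _.
Arguments run_lookup_le {m tau s d n k es w o Z} _ _ _ _ _.

(** * Search and unranking *)

Section Main.
Variable m : nat.
Notation reg := (reg m).
Variable tau : seq nat -> bool.
Notation run := (@run _ (@rQuery m) (oracle tau)).
Implicit Types (s : store reg).

Definition search : cmd reg :=
  While (full rGo) (Seq (fill_table m) (Seq (fetch m) (Seq (compare m)
    (Case (fun h => if tbit h rCarry then Seq (Pop rCarry) (Pop rGo)
      else Seq (Pop rCarry) (Seq (Push rT (Some true)) (pour rTab [::]))))))).

(** The numeral in [rL] when the [t]-th table is made. As [reduceb] changes nothing
    when it would have to subtract too much, the value at the stop is also the
    next one. *)
Fixpoint remainder n (L : seq bool) t : seq bool :=
  if t is t'.+1 then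
    reduceb (remainder n L t') (head [::] (table m tau n t'))
  else L.

Lemma size_reduceb a b : size (reduceb a b) = maxn (size a) (size b).
Proof. by rewrite /reduceb; case: ltb; rewrite ?size_padb ?size_subb. Qed.

Lemma size_remainder n L t : size (remainder n L t) <= maxn (size L) (width m n).
Proof.
elim: t => [|t IH] /=; first by rewrite leq_maxl.
rewrite size_reduceb geq_max IH -nth0.
by rewrite (leq_trans (narrow_nth 0 (narrow_stage tau t (leqnn _)))) ?leq_maxr.
Qed.

Definition cost_search n T W := T.+1 *
  (cost_table m n T + 24 * volume m n + 21 * W + 40) + 1.

Lemma cost_table_mono n t t' : t <= t' -> cost_table m n t <= cost_table m n t'.
Proof.
move=> h; rewrite /cost_table leq_add2r /cost_fill_last leq_add2r leq_mul2l.
apply/orP; right; rewrite /cost_ask ?leq_add2r ?leq_add2l.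
by apply: leq_mul; lia.
Qed.

(** The last round differs from the others in keeping the table and stopping, so
    the store after [j] rounds is defined by cases. *)
Lemma run_search s n L T W : ready n s -> s rT = [::] -> s rTab = [::] ->
  s rGo = [:: Some true] -> s rCnt = [::] -> s rCnt2 = [::] -> s rL = bs L ->
  maxn (size L) (width m n) <= W ->
  (forall t, t < T -> ~~ ltb (remainder n L t) (head [::] (table m tau n t))) ->
  ltb (remainder n L T) (head [::] (table m tau n T)) ->
  run search s (upd (upd (upd (upd s rT (unary T)) rTab (flat (table m tau n T)))
      rL (bs (remainder n L T.+1))) rGo [::])
    (cost_search n T W).
Proof.
move=> hs ht hb hg hc hc2 hL hW hge hlt.
pose st j := if j <= T then upd (upd s rT (unary j)) rL (bs (remainder n L j))
  else upd (upd (upd (upd s rT (unary T)) rTab (flat (table m tau n T)))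
      rL (bs (remainder n L T.+1))) rGo [::].
have e0 : s = st 0 by rewrite /st /=; by_regs => //; rewrite ?ht ?hL.
have eT : st T.+1 = upd (upd (upd (upd s rT (unary T)) rTab
  (flat (table m tau n T))) rL (bs (remainder n L T.+1))) rGo [::].
  by rewrite /st ltnn.
rewrite [X in run _ X _ _]e0 -eT; apply: run_le (run_while st
  (K := cost_table m n T + 24 * volume m n + 21 * W + 39) _ _) erefl _;
  last by rewrite /cost_search -addnS.
  move=> j; rewrite ltnS => hj; rewrite full_tops.
  have ej : st j = upd (upd s rT (unary j)) rL (bs (remainder n L j)).
    by rewrite /st hj.
  split; first by rewrite ej /upd /= hg.
  set x := head [::] (table m tau n j).
  have hx : size x <= W.
    apply: leq_trans hW; rewrite /x -nth0.
    by rewrite (leq_trans (narrow_nth 0 (narrow_stage tau j (leqnn _)))) ?leq_maxr.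
  have hR : size (remainder n L j) <= W := leq_trans (size_remainder n L j) hW.
  have hV : size (flat (table m tau n j)) <= volume m n :=
    volume_stage tau j (leqnn _).
  have hsj : ready n (st j) by rewrite ej; do 2!apply: readyK_upd => //.
  pose s1 := upd (upd (upd (st j) rTab (flat (table m tau n j)))
    rL (bs (reduceb (remainder n L j) x))) rCarry
    [:: Some (ltb (remainder n L j) x)].
  have h1 s' : s' = s1 -> run (Case (fun h => if tbit h rCarry then Seq (Pop rCarry) (Pop rGo)
      else Seq (Pop rCarry) (Seq (Push rT (Some true)) (pour rTab [::]))))
      s' (st j.+1) (4 * volume m n + 6).
    move=> ->; rewrite [_ + 6]addnS; apply: run_case.
    rewrite (@tbit_bs _ _ _ [:: ltb (remainder n L j) x]) //=.
    case: (ltngtP j T) hj => // [lt|e] _.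
      rewrite (negPf (hge _ lt)).
      apply: run_le (run_seq (run_pop _ _) (run_seq (run_push _ _ _)
        (run_clear _ _))) _ _.
        have -> : st j.+1 = upd (upd s rT (unary j.+1)) rL (bs (remainder n L j.+1)).
          by rewrite /st lt.
        by rewrite /s1 ej; by_regs => //; rewrite ?hb ?(hs rCarry).
      by rewrite /s1 ej /upd /=; lia.
    have hc3 : ltb (remainder n L j) x by rewrite /x e.
    rewrite hc3; apply: run_le (run_seq (run_pop _ _) (run_pop _ _)) _ _; last by lia.
    rewrite e eT /s1 /x ej e /=; by_regs => //; by rewrite ?hg ?(hs rCarry).
  apply: run_le (run_seq (run_fill_table (t := j) hsj _ _ _ _)
    (run_seq (run_fetch (es1 := [::]) (es2 := table m tau n j) _ _ _ _)
    (run_seq (run_compare (a := remainder n L j) (b := x) _ _ _ _ _)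
     (h1 _ _)))) erefl _.
  + by rewrite ej.
  + by rewrite ej.
  + by rewrite ej.
  + by rewrite ej.
  + by [].
  + exact: (hsj rAux).
  + exact: (hsj rX).
  + exact: (hsj rZ).
  + by rewrite ej.
  + by [].
  + exact: (hsj rCarry).
  + exact: (hsj rD).
  + exact: (hsj rS).
  + have hA := hsj rAux; have hX := hsj rX; rewrite /s1 {h1 s1}; move: (st j) hA hX => s2 hA hX.
    by by_regs => //; rewrite ?hA ?hX.
  have h4 := cost_table_mono n hj.
  have h5 : maxn (size (remainder n L j)) (size x) <= W by rewrite geq_max hR.
  by rewrite /=; lia.
by rewrite full_tops eT.
Qed.

Definition push_bits (w : seq bool) : cmd reg :=
  foldr (fun b c => Seq (Push rRev (Some b)) c) (Skip reg) w.

Lemma run_push_bits w s :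
  run (push_bits w) s (upd s rRev (catrev (bs w) (s rRev))) (2 * size w + 1).
Proof.
elim: w s => [|b w IH] s /=.
  by apply: run_le (run_skip _) _ _ => //; by_regs.
apply: run_le (run_seq (run_push _ _ _) (IH _)) _ _; last by lia.
by by_regs.
Qed.

(** The letters are tried in the order of their digits, so that what has been
    subtracted from [rL] when the right one is found is the total length of the
    earlier blocks. *)
Fixpoint pick_on (cs : seq ('I_m * seq bool)) : cmd reg :=
  if cs is (i, w) :: cs' then
    Seq (lookup i) (Seq (compare m) (Case (fun h => if tbit h rCarry
      then Seq (Pop rCarry) (Seq (drop_entries i) (push_bits w))
      else Seq (Pop rCarry) (pick_on cs'))))
  else Skip reg.

Fixpoint pick n (cs : seq ('I_m * seq bool)) (es : seq (seq bool)) (L : seq bool)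
    : seq (seq bool) * seq bool * seq bool :=
  if cs is (i, w) :: cs' then
    let x := nth [::] es (offset n i) in let L' := reduceb L x in
    if ltb L x then (drop (offset n i) es, L', w) else pick n cs' es L'
  else (es, L, [::]).

Definition picked s (r : seq (seq bool) * seq bool * seq bool) : store reg :=
  upd (upd (upd s rTab (flat r.1.1)) rL (bs r.1.2)) rRev (catrev (bs r.2) (s rRev)).

Definition cost_pick n c W := cost_lookup (2 * n.+1 ^ m) (volume m n) + 21 * W +
   2 * n.+1 ^ m * (4 * volume m n + 21) + 2 * c + 40.

Lemma run_pick_on n cs s es L W c : ready n s -> s rTab = flat es -> s rL = bs L ->
  size (flat es) <= volume m n -> narrow (width m n) es ->
  maxn (size L) (width m n) <= W -> all (fun x => size x.2 <= c) cs ->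
  run (pick_on cs) s (picked s (pick n cs es L)) (size cs * cost_pick n c W + 1).
Proof.
elim: cs s L => [|[i w] cs IH] s L hs ht hL hV hw hW /=.
  move=> _; apply: run_le (run_skip _) _ _ => //.
  by rewrite /picked; by_regs; rewrite ?ht ?hL.
move=> /andP[hc hcs]; set x := nth [::] es (offset n i).
have hx : size x <= W.
  by apply: leq_trans (narrow_nth _ hw) _; apply: leq_trans hW; rewrite leq_maxr.
pose s1 := upd (upd s rL (bs (reduceb L x))) rCarry [:: Some (ltb L x)].
set r := if _ then _ else _.
have h1 s' : s' = s1 -> run (Case (fun h => if tbit h rCarry
      then Seq (Pop rCarry) (Seq (drop_entries i) (push_bits w))
      else Seq (Pop rCarry) (pick_on cs))) s' (picked s r)
      (size cs * cost_pick n c W + 2 * n.+1 ^ m * (4 * volume m n + 21) + 2 * c + 8).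
  move=> ->; rewrite [_ + 8]addnS; apply: run_case.
  rewrite (@tbit_bs _ _ _ [:: ltb L x]) //= /r.
  case: ltb.
    apply: run_le (run_seq (run_pop _ _) (run_seq
      (run_drop_entries (es := es) (k := offset n i) _ _ _ _) (run_push_bits _ _))) _ _.
    - by [].
    - exact: (hs (rOff i)).
    - exact: (hs rC).
    - exact: (hs rTmp).
    - by rewrite /picked /s1; by_regs => //; rewrite (hs rCarry).
    have : offset n i * (4 * size (flat es) + 21) <=
      2 * n.+1 ^ m * (4 * volume m n + 21).
      by apply: leq_mul; [exact: offset_le|rewrite leq_add2r leq_mul2l hV].
    by move: hc => /=; lia.
  apply: run_le (run_seq (run_pop _ _) (IH _ (reduceb L x) _ _ _ hV hw _ hcs)) _ _.
  - by move=> r'; have := hs r'; rewrite /s1 /upd; case: r'.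
  - by [].
  - by [].
  - by rewrite size_reduceb; lia.
  - by rewrite /picked /s1; by_regs => //; rewrite (hs rCarry).
  by lia.
apply: run_le (run_seq (run_lookup_le hs ht (offset_le n i) hV hw)
  (run_seq (run_compare (a := L) (b := x) _ _ _ _ _) (h1 _ _))) erefl _ => //.
- exact: (hs rCarry).
- exact: (hs rD).
- exact: (hs rS).
- by have hX := hs rX; rewrite /s1; by_regs => //; rewrite hX.
rewrite [in leqRHS]mulSn {2}/cost_pick; have : maxn (size L) (size x) <= W by lia.
by move: (size cs * _) (cost_lookup _ _) (2 * _ * _) => X y z; lia.
Qed.

Variable cs : seq ('I_m * seq bool).

(** The top entry is dropped first, so that the offsets, which were made for the
    entry still to be pushed, fit. *)
Definition emit n (x : seq (seq bool) * seq bool * seq bool) :=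
  let r := pick n cs (behead x.1.1) x.1.2 in (r.1.1, r.1.2, x.2 ++ r.2).

Definition unrank : cmd reg :=
  Seq (copy rN rCnt rTmp) (Loop rCnt (Seq (skip_entry [::]) (pick_on cs))).

Lemma pick_narrow n cs' w V W es L : narrow w es -> size (flat es) <= V ->
  maxn (size L) w <= W ->
  [/\ narrow w (pick n cs' es L).1.1, size (flat (pick n cs' es L).1.1) <= V
    & maxn (size (pick n cs' es L).1.2) w <= W].
Proof.
move=> hw hV; elim: cs' L => [|[i v] cs' IH] L hW //=.
have hx := narrow_nth (offset n i) hw.
have hr : maxn (size (reduceb L (nth [::] es (offset n i)))) w <= W.
  by rewrite size_reduceb; lia.
case: ltb => /=; last exact: IH.
split=> //; last exact: leq_trans (size_flat_drop _ _) hV.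
apply/allP => e he; apply: (allP hw); exact: mem_drop he.
Qed.

Definition cost_unrank n c W := n * (size cs * cost_pick n c W +
  4 * volume m n + 20) + 14 * n + 10.

Lemma run_unrank n s es L W c : ready n s -> s rTab = flat es -> s rL = bs L ->
  s rRev = [::] -> s rCnt = [::] ->
  size (flat es) <= volume m n -> narrow (width m n) es ->
  maxn (size L) (width m n) <= W -> all (fun x => size x.2 <= c) cs ->
  let x := iter n (emit n) (es, L, [::]) in
  run unrank s (picked s x) (cost_unrank n c W).
Proof.
move=> hs ht hL hr hc hV hw hW hcs x.
pose y j := iter j (emit n) (es, L, [::]).
have hy j : [/\ narrow (width m n) (y j).1.1, size (flat (y j).1.1) <= volume m n
    & maxn (size (y j).1.2) (width m n) <= W].
  elim: j => [|j [h1 h2 h3]] //.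
  rewrite [y j.+1]/(emit n (y j)) /emit /=; apply: pick_narrow => //.
    by move: h1; rewrite -drop1 => h1; apply/allP => e he; apply: (allP h1); exact: mem_drop he.
  by apply: leq_trans h2; rewrite -drop1 size_flat_drop.
pose st j := upd (picked s (y j)) rCnt (unary (n - j)).
apply: run_le (run_seq (run_copy _ _) (_ : run _ _ (st n) _)) _ _ => //.
- exact: (hs rTmp).
- have -> : upd s rCnt (s rN ++ s rCnt) = st 0.
    by rewrite /st subn0 /picked /y /= (hs rN) hc cats0; by_regs.
  apply: (run_loop st (K := size cs * cost_pick n c W + 4 * volume m n + 10)) => j hj.
    by [].
  have [h1 h2 h3] := hy j.
  apply: run_le (run_seq (run_skip_entry (es := (y j).1.1) _ _ _)
    (run_pick_on (n := n) (es := behead (y j).1.1) (L := (y j).1.2) (c := c) (W := W)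
       _ _ _ _ _ _ _)) _ _ => //.
  + move=> r; have := hs r; rewrite /poured /st /picked /upd.
    by case: r.
  + by rewrite /poured /= drop1.
  + by apply: leq_trans h2; rewrite -drop1 size_flat_drop.
  + by apply/allP => e; rewrite -drop1 => he; apply: (allP h1); exact: mem_drop he.
  + rewrite /st [y j.+1]/(emit n (y j)) /emit /picked /poured.
    by by_regs => //; rewrite hr !catrevE !cats0 /bs map_cat rev_cat.
  rewrite /=; move: (size cs * _) => X; lia.
- by rewrite /st subnn /picked; by_regs.
rewrite (hs rN) size_unary /cost_unrank; move: (size cs * _) => X; nia.
Qed.

(** Leading zeros are removed, except that zero itself is printed as one digit. *)
Definition finish : cmd reg :=
  Seq (pour rRev [:: rOut]) (Seq (pours (pred1 (Some false)) rOut [::])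
    (Case (fun h => if full rOut h then Skip reg else Push rOut (Some false)))).

Lemma run_finish s (w : seq bool) : s rRev = rev (bs w) -> s rOut = [::] ->
  exists2 s', run finish s s' (10 * size w + 10)
    & map Some (s' rOut) = bin (bval (rev w)).
Proof.
move=> hr ho; set k := find id w.
have e1 : take k w = nseq k false.
  have : all (pred1 false) (take k w).
    apply/(all_nthP true) => i; rewrite size_take_min => hi.
    rewrite nth_take; last by lia.
    have := @before_find _ true id w i; rewrite -/k => /(_ ltac:(lia)).
    by case: nth.
  have hk : k <= size w := find_size _ _.
  by move/all_pred1P => ->; rewrite size_take_min (minn_idPl hk).
set v := drop k w.
have hwv : w = nseq k false ++ v by rewrite -e1 cat_take_drop.
have hv : if v is b :: _ then b else true.
  have := @nth_find _ true id w; rewrite has_find -/k /v.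
  case: (ltnP k (size w)) => [lt /(_ isT)|ge _]; last by rewrite drop_oversize.
  by rewrite (drop_nth true lt).
exists (upd (upd s rRev [::]) rOut (bs (bprint (rev v)))).
  pose s1 := upd (upd s rRev [::]) rOut (bs v).
  have h1 s' : s' = s1 -> run (Case (fun h => if full rOut h then Skip reg
      else Push rOut (Some false))) s' (upd (upd s rRev [::]) rOut (bs (bprint (rev v)))) 3.
    move=> ->; apply: run_case; rewrite full_tops /s1 {1}/upd /=.
    have [v0|v1] := eqVneq v [::].
      by rewrite v0; apply: run_le (run_push _ _ _) _ _ => //; by_regs.
    have -> : bprint (rev v) = v.
      by rewrite /bprint -size_eq0 size_rev size_eq0 (negPf v1) revK.
    rewrite -size_eq0 size_bs size_eq0 v1.
    exact: run_le (run_skip _) erefl _.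
  apply: run_le (run_seq (run_move _ _) (run_seq
    (run_pours (x := nseq k (Some false)) (y := bs v) _ _ _ _ _) (h1 _ _))) erefl _ => //.
  - by rewrite /upd /= hr ho catrevE revK cats0 {1}hwv /bs map_cat map_nseq.
  - by apply/allP => x /nseqP[-> _] /=.
  - by case: (v) hv => //= b v' ->.
  - by rewrite /s1; by_regs.
  rewrite hr size_rev size_bs size_nseq /=.
  have : k <= size w := find_size _ _.
  by lia.
rewrite /upd /= -map_comp.
have -> : bval (rev w) = bval (rev v).
  rewrite [in LHS]hwv rev_cat bval_cat rev_nseq.
  have -> : bval (nseq k false) = 0 by elim: (k) => //= ? ->.
  by rewrite muln0 addn0.
rewrite bin_bval //.
by case: (v) hv => //= b v' ->; rewrite rev_cons last_rcons.
Qed.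

Definition copyN_on (l : seq 'I_m) : cmd reg :=
  foldr (fun i c => Seq (copy rN (rK i) rTmp) c) (Skip reg) l.

Lemma run_copyN_on l s n : uniq l -> s rN = unary n -> s rTmp = [::] ->
  (forall i, i \in l -> s (rK i) = [::]) ->
  run (copyN_on l) s
    (fun r => if r is rK i then if i \in l then unary n else s r else s r)
    (size l * (14 * n + 2) + 1).
Proof.
elim: l s => [|i l IH] s /=.
  by move=> *; apply: run_le (run_skip _) _ _ => //; apply/funext; case.
move=> /andP[il hu] hn ht hk.
apply: run_le (run_seq (run_copy _ _) (IH _ hu _ _ _)) _ _ => //.
- move=> j hj; rewrite /upd -[rK j == rK i]/(j == i).
  case: eqP hj il => [->|_ hj _]; first by move=> ->.
  by rewrite hk // in_cons hj orbT.
- apply/funext; case=> //= j; rewrite /upd /= -[rK j == rK i]/(j == i) in_cons.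
  by case: eqP => [->|//] /=; rewrite (negPf il) hn hk ?mem_head // cats0.
by rewrite hn size_unary [in leqRHS]mulSn; move: (size l * _) => X; lia.
Qed.

Definition main : cmd reg :=
  Seq (parse m) (Seq (copyN_on (enum 'I_m)) (Seq (powers m)
    (Seq (Push rGo (Some true)) (Seq search (Seq unrank finish))))).

Definition start n l : store reg :=
  fun r => if r == rIn then num n ++ num l else [::].

Definition cost_main n T z c :=
  (n + 1) * (22 * n + 20) + 6 * z + 10 + (m * (14 * n + 2) + 1) +
  (m * (n * (20 * n.+1 ^ m + 20) + 28 * n.+1 ^ m + 40) + 10) + 2 +
  cost_search n T (z + width m n) + cost_unrank n c (z + width m n) +
  (10 * (n * c) + 10).

Lemma pick_size n cs' es L c : all (fun x => size x.2 <= c) cs' ->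
  size (pick n cs' es L).2 <= c.
Proof.
elim: cs' L => [|[i w] cs' IH] L //= /andP[h1 h2].
by case: ltb => //=; apply: IH.
Qed.

Definition rest n l t :=
  remainder n (rev (bprint (nbits l))) t.

Definition answer n l T : seq bool :=
  (iter n (emit n) (table m tau n T, rest n l T.+1, [::])).2.

Lemma run_main n l T z c :
  (forall t, t < T -> ~~ ltb (rest n l t) (head [::] (table m tau n t))) ->
  ltb (rest n l T) (head [::] (table m tau n T)) ->
  size (bprint (nbits l)) <= z -> all (fun x => size x.2 <= c) cs ->
  exists2 s', run main (start n l) s' (cost_main n T z c)
    & map Some (s' rOut) = bin (bval (rev (answer n l T))).
Proof.
move=> hge hlt hz hcs; set L := rev (bprint (nbits l)) in hge hlt *.
have hW : maxn (size L) (width m n) <= z + width m n by rewrite /L size_rev; lia.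
pose s1 : store reg := fun r => match r with
  | rN | rK _ => unary n
  | rL => bs L
  | rOff i => unary (offset n i)
  | rPow => unary (n.+1 ^ m)
  | rGo => [:: Some true]
  | _ => [::] end.
pose s2 := upd (upd (upd (upd s1 rT (unary T)) rTab (flat (table m tau n T)))
      rL (bs (remainder n L T.+1))) rGo [::].
have r1 : run search s1 s2 (cost_search n T (z + width m n)).
  by apply: run_search => //; case.
have r2 : run unrank s2 (picked s2 (iter n (emit n)
    (table m tau n T, remainder n L T.+1, [::])))
    (cost_unrank n c (z + width m n)).
  apply: run_unrank => //.
  - by case.
  - exact: volume_stage.
  - exact: narrow_stage.
  by rewrite geq_max (leq_trans (size_remainder n L T.+1) hW) leq_addl.
have hsz : size (answer n l T) <= n * c.
  have hj j x : size (iter j (emit n) x).2 <= size x.2 + j * c.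
    elim: j => [|j IH] /=; first by rewrite addn0.
    by rewrite size_cat mulSn addnC addnCA leq_add // pick_size.
  exact: hj.
have [|//|s3 r3 e3] := @run_finish (picked s2 (iter n (emit n)
    (table m tau n T, remainder n L T.+1, [::]))) (answer n l T) _ _.
  by rewrite /picked /upd /= catrevE cats0.
exists s3 => //.
apply: run_le (run_seq (run_parse (n := n) (l := l) _ _ _ _ _)
  (run_seq (run_copyN_on (n := n) _ _ _ _) (run_seq (run_powers (n := n) _ _ _ _ _ _)
  (run_seq (run_push _ _ _) (_ : run _ _ s3 (cost_search n T (z + width m n) +
   (cost_unrank n c (z + width m n) + (10 * size (answer n l T) + 10)))))))) erefl _ => //.
- by rewrite enum_uniq.
- set s0 := upd _ _ _; have -> : s0 = s1.
    rewrite /s0 /s1 /updOff /upd; apply/funext; case=> //= i.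
    by rewrite mem_enum.
  exact: run_seq r1 (run_seq r2 r3).
rewrite /cost_main size_enum_ord.
have : 6 * size (bprint (nbits l)) <= 6 * z by rewrite leq_mul2l.
move: (cost_search _ _ _) (cost_unrank _ _ _) (m * _) (m * _) ((n + 1) * _) => *.
lia.
Qed.

End Main.

(** * What the table counts *)

Section Meaning.
Variables (m n : nat) (tau : seq nat -> bool) (t : nat).
Notation base := (n.+1 ^ m).
Local Notation es := (table m tau n t).

Definition incr (k : 'I_m -> nat) (i : 'I_m) : 'I_m -> nat :=
  fun j => k j + (j == i).

(** The number of ways to extend a word with letter counts [k] by [r] letters so
    that the oracle accepts the counts of the result. *)
Fixpoint completions r (k : 'I_m -> nat) : nat :=
  if r is r'.+1 then \sum_(i <- enum 'I_m) completions r' (incr k i)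
  else tau (n :: rcons [seq k i | i <- enum 'I_m] t).

Definition pack (k : 'I_m -> nat) : nat := \sum_(i < m) k i * n.+1 ^ i.

Lemma pack_incr k i : pack (incr k i) = pack k + n.+1 ^ i.
Proof.
rewrite /pack (bigD1 i) //= [in RHS](bigD1 i) //= /incr eqxx mulnDl mul1n.
have -> : \sum_(j < m | j != i) (k j + (j == i)) * n.+1 ^ j =
    \sum_(j < m | j != i) k j * n.+1 ^ j.
  by apply: eq_bigr => j /negbTE ->; rewrite addn0.
by rewrite addnAC.
Qed.

Lemma sum_incr k i : \sum_j incr k i j = (\sum_j k j).+1.
Proof.
by rewrite big_split /= -big_mkcond /= big_pred1_eq addn1.
Qed.

Lemma pack_recl (j : nat) (k : nat -> nat) :
  \sum_(i < j.+1) k i * n.+1 ^ i = k 0 + n.+1 * \sum_(i < j) k i.+1 * n.+1 ^ i.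
Proof.
rewrite big_ord_recl muln1 big_distrr /=; congr addn.
by apply: eq_bigr => i _; rewrite expnS mulnCA.
Qed.

Lemma pack_digits (j : nat) (k : nat -> nat) : (forall i, k i <= n) ->
  \sum_(i < j) k i * n.+1 ^ i < n.+1 ^ j /\
  forall i, i < j -> dig n (\sum_(i < j) k i * n.+1 ^ i) i = k i.
Proof.
elim: j k => [|j IH] k hk; first by rewrite big_ord0.
have [h1 h2] := IH (fun i => k i.+1) (fun i => hk i.+1).
have hk0 := hk 0; rewrite pack_recl; move: h1 h2.
move: (\sum_(i < j) _) => x h1 h2; split.
  by rewrite expnS; nia.
move=> [|i] hi; rewrite /dig; first by rewrite divn1 addnC mulnC modnMDl modn_small.
rewrite expnS divnMA addnC mulnC divnMDl // [k 0 %/ _]divn_small // addn0.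
exact: h2.
Qed.

Lemma packP k : (forall i, k i <= n) ->
  pack k < base /\ forall i : 'I_m, dig n (pack k) i = k i.
Proof.
move=> hk; pose k' i := if insub i is Some i' then k i' else 0.
have k'E (i : 'I_m) : k' i = k i by rewrite /k' valK.
have e : pack k = \sum_(i < m) k' i * n.+1 ^ i.
  by apply: eq_bigr => i _; rewrite k'E.
have [h1 h2] := @pack_digits m k' (fun i => ltac:(by rewrite /k'; case: insub)).
by rewrite e; split=> // i; rewrite h2 // k'E.
Qed.

Lemma bval_sum_entries (l : seq 'I_m) ts a :
  bval (foldl (fun a i => addb a (nth [::] ts (offset n i))) a l) =
  bval a + \sum_(i <- l) bval (nth [::] ts (offset n i)).
Proof.
elim: l a => [|i l IH] a /=; first by rewrite big_nil addn0.
by rewrite IH bval_addb big_cons addnA.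
Qed.

Lemma nth_iter_extend q ts i : i < q ->
  bval (nth [::] (iter q (extend_table m n) ts) i) =
  \sum_(s <- enum 'I_m) bval (nth [::] (iter q (extend_table m n) ts)
                               (i.+1 + offset n s)).
Proof.
elim: q i => // q IH [|i] hi.
  by rewrite /= bval_sum_entries.
by rewrite iterS [LHS]IH.
Qed.

(** Adding one letter moves by [base + n.+1 ^ i] entries, one level down and
    one unit of the digit [i], whatever the counts so far. *)
Lemma nth_table k j : j <= n -> \sum_i k i = j ->
  bval (nth [::] es (j * base + pack k)) = completions (n - j) k.
Proof.
move=> hj; move e : (n - j) => r; elim: r j k hj e => [|r IH] j k hj e hk /=.
  have ej : j = n by lia.
  have hkn i : k i <= n by rewrite -ej -hk (bigD1 i) //= leq_addr.
  have [h1 h2] := packP hkn.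
  rewrite /table; set q := n * base; have -> : j * base = q by rewrite ej.
  have -> : forall ts, nth [::] (iter q (extend_table m n) ts) (q + pack k) =
      nth [::] ts (pack k).
    by move=> ts; elim: (q) => //= q' ->.
  rewrite (nth_map 0) ?size_iota // nth_iota // add0n.
  have -> : [seq dig n (pack k) (i : 'I_m) | i <- enum 'I_m] =
      [seq k i | i <- enum 'I_m] by apply: eq_map => i; rewrite h2.
  by case: tau.
have hkn i : k i <= n by apply: leq_trans hj; rewrite -hk (bigD1 i) //= leq_addr.
have [h1 h2] := packP hkn.
rewrite /table nth_iter_extend; last first.
  by apply: leq_trans (_ : j.+1 * base <= _); rewrite ?mulSn ?leq_mul2r; lia.
apply: eq_bigr => i _; rewrite -(IH j.+1) ?sum_incr ?hk //; try lia.
congr (bval (nth _ _ _)); rewrite pack_incr mulSn /offset.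
have := expn_gt0 n.+1 i; have := expn_gt0 n.+1 m; rewrite /=; lia.
Qed.

Variables (letter : nat -> 'I_m) (word : nat -> seq bool) (len : nat).
Hypothesis letters : perm_eq [seq letter d | d <- iota 0 m] (enum 'I_m).
Hypothesis size_word : forall d, d < m -> size (word d) = len.
Hypothesis bval_word : forall d, d < m -> bval (rev (word d)) = d.
Hypothesis mE : m = 2 ^ len.

Definition codes_on (l : seq nat) := [seq (letter d, word d) | d <- l].

(** The ranks of the accepted completions, in increasing order: a word is
    ranked by the number with digits of its letters in base [m]. *)
Fixpoint accepted r (k : 'I_m -> nat) : seq nat :=
  if r is r'.+1 then
    flatten [seq [seq d * m ^ r' + x | x <- accepted r' (incr k (letter d))]
            | d <- iota 0 m]
  else if tau (n :: rcons [seq k i | i <- enum 'I_m] t) then [:: 0] else [::].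

Lemma size_accepted r k : size (accepted r k) = completions r k.
Proof.
elim: r k => [|r IH] k /=; first by case: tau.
rewrite size_flatten /shape -map_comp sumnE big_map.
rewrite -(perm_big _ letters) big_map; apply: eq_bigr => d _.
by rewrite /= size_map IH.
Qed.

(** The ranks of the completions with first letter [d] form one block of the list,
    as long as the entry of the table for [d]; subtracting the lengths of the
    blocks before it leaves the position in the block. *)
Lemma pickE l es' L x0 (f : nat -> seq nat) (g : nat -> nat) :
  {subset l <= gtn m} ->
  (forall d, d \in l -> bval (nth [::] es' (offset n (letter d))) = size (f d)) ->
  bval L < size (flatten [seq [seq g d + x | x <- f d] | d <- l]) ->
  exists d, [/\ d \in l, (pick n (codes_on l) es' L).1.1 = drop (offset n (letter d)) es',
    (pick n (codes_on l) es' L).2 = word d,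
    bval (pick n (codes_on l) es' L).1.2 < size (f d) &
    nth x0 (flatten [seq [seq g d + x | x <- f d] | d <- l]) (bval L) =
      g d + nth 0 (f d) (bval (pick n (codes_on l) es' L).1.2)].
Proof.
elim: l L => [|d l IH] L //= hl hf hL.
have hd := hf d (mem_head _ _).
rewrite nth_cat size_map -hd -ltbE; case: ifP => hlt.
  have e : reduceb L (nth [::] es' (offset n (letter d))) =
      padb (maxn (size L) (size (nth [::] es' (offset n (letter d))))) L.
    by rewrite /reduceb hlt.
  exists d; rewrite mem_head /= e bval_padb ?leq_maxl //.
  move: hlt; rewrite ltbE hd => hlt; split=> //.
  by rewrite (nth_map 0).
have e : reduceb L (nth [::] es' (offset n (letter d))) =
    subb L (nth [::] es' (offset n (letter d))) by rewrite /reduceb hlt.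
have eb : bval (subb L (nth [::] es' (offset n (letter d)))) =
   bval L - bval (nth [::] es' (offset n (letter d))) by rewrite bval_subb ?hlt.
rewrite e -eb; move: hL; rewrite size_cat size_map => hL.
have [||| d' [h1 h2 h3 h4 h5]] := IH (subb L (nth [::] es' (offset n (letter d)))).
- by move=> x hx; apply: hl; rewrite in_cons hx orbT.
- by move=> x hx; apply: hf; rewrite in_cons hx orbT.
- by rewrite eb; move/negbT: hlt; rewrite ltbE hd; lia.
by exists d'; rewrite in_cons h1 orbT.
Qed.

(** The invariant of the walk: it is at the entry of the letters emitted so far,
    and [L] is the position of the word sought among the completions. *)
Lemma answerE L r j k x : \sum_i k i = j -> j + r = n ->
  x.1.1 = drop (j * base + pack k) es -> x.1.2 = L ->
  bval L < completions r k ->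
  bval (rev (iter r (emit (codes_on (iota 0 m)) n) x).2) =
    bval (rev x.2) * m ^ r + nth 0 (accepted r k) (bval L).
Proof.
elim: r j k L x => [|r IH] j k L x hk hj hx hL hlt.
  rewrite /= in hlt *; case: (tau _) hlt => //= hlt.
  by rewrite muln1; case: (bval L) hlt => // _; rewrite addn0.
rewrite -size_accepted /= in hlt.
have heb : behead x.1.1 = drop (j * base + pack k).+1 es.
  by rewrite hx -drop1 drop_drop add1n.
have hoff d : (offset n (letter d) + (j * base + pack k).+1) =
    j.+1 * base + pack (incr k (letter d)).
  rewrite pack_incr mulSn /offset.
  have := expn_gt0 n.+1 (letter d); have := expn_gt0 n.+1 m; rewrite /=; lia.
have [||d [hd h1 h2 h3 h4]] := @pickE (iota 0 m) (behead x.1.1) L 0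
   (fun d => accepted r (incr k (letter d))) (fun d => d * m ^ r) _ _ hlt.
- by move=> d; rewrite mem_iota.
- move=> d _; rewrite heb nth_drop addnC hoff size_accepted nth_table ?sum_incr ?hk; try lia.
  by congr completions; lia.
have dm : d < m by move: hd; rewrite mem_iota.
rewrite iterSr (IH j.+1 (incr k (letter d)) (pick n (codes_on (iota 0 m)) (behead x.1.1) L).1.2).
- rewrite /emit /= hL h2 h4 rev_cat bval_cat size_rev size_word // bval_word //.
  by rewrite -mE expnS; lia.
- by rewrite sum_incr hk.
- by lia.
- by rewrite /emit /= hL h1 heb drop_drop hoff.
- by rewrite /emit /= hL.
by rewrite -size_accepted.
Qed.

Lemma answer0 L : bval L < size (accepted n (fun=> 0)) ->
  bval (rev (iter n (emit (codes_on (iota 0 m)) n) (es, L, [::])).2) =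
  nth 0 (accepted n (fun=> 0)) (bval L).
Proof.
rewrite size_accepted => hL.
rewrite (@answerE L n 0 (fun=> 0)) ?mul0n ?add0n //.
  by rewrite big1.
by rewrite /pack big1 ?drop0.
Qed.

Lemma head_table : bval (head [::] es) = size (accepted n (fun=> 0)).
Proof.
rewrite size_accepted -[in RHS](subn0 n) -(@nth_table _ 0) ?big1 //.
by rewrite /pack big1 // nth0.
Qed.

End Meaning.

(** * Binary digits and Lebesgue measure *)

Section BinaryDigits.
Variable R : realType.
Local Open Scope ring_scope.
Local Open Scope classical_set_scope.
Implicit Types x : R.

(** The number formed by the first [N] binary digits of [x]; the [N]-th digit is
    its parity. *)
Definition prefix x N : nat := Num.truncn (2 ^+ N * x).

Lemma prefix_itv x N : 0 <= x ->
  (prefix x N)%:R <= 2 ^+ N * x < (prefix x N).+1%:R.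
Proof. by move=> x0; apply: truncn_itv; rewrite mulr_ge0 ?exprn_ge0. Qed.

Lemma prefix_half x N : 0 <= x -> (prefix x N.+1 %/ 2)%N = prefix x N.
Proof.
move=> x0; apply/esym/truncn_def; have /andP[h1 h2] := prefix_itv N.+1 x0.
have e := divn_eq (prefix x N.+1) 2.
have l : (prefix x N.+1 %% 2 < 2)%N by rewrite ltn_pmod.
move: e l h1 h2; move: (_ %/ 2)%N (_ %% 2)%N => q r e l.
rewrite e exprS -mulrA; set y := _ * x.
have : (r%:R : R) <= 1%:R by rewrite ler_nat.
have : (0 : R) <= r%:R by rewrite ler0n.
rewrite -!natr1 natrD natrM => h3 h4 h5 h6.
by apply/andP; split; lra.
Qed.

Lemma prefix0 x : 0 < x < 1 -> prefix x 0 = 0%N.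
Proof. by move=> /andP[x0 x1]; apply: truncn_def; rewrite expr0 mul1r ltW. Qed.

Lemma prefix_lt x N : 0 < x < 1 -> (prefix x N < 2 ^ N)%N.
Proof.
move=> /andP[x0 x1]; have /andP[h _] := prefix_itv N (ltW x0).
rewrite -(ltr_nat R) natrX; apply: le_lt_trans h _.
by rewrite -[ltRHS]mulr1 ltr_pM2l // exprn_gt0.
Qed.

Lemma prefix_div x N k : 0 <= x -> (prefix x (N + k) %/ 2 ^ k)%N = prefix x N.
Proof.
move=> x0; elim: k => [|k IH]; first by rewrite addn0 divn1.
by rewrite expnS divnMA addnS prefix_half.
Qed.

Fixpoint digits_val (e : nat -> bool) N : nat :=
  if N is N'.+1 then ((digits_val e N').*2 + e N)%N else 0%N.

Definition partial (e : nat -> bool) (N : nat) : R :=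
  \sum_(1 <= i < N.+1) (e i)%:R * (2 : R) ^- i.

Lemma partialE e N : partial e N = (digits_val e N)%:R / 2 ^+ N.
Proof.
elim: N => [|N IH]; first by rewrite /partial big_geq // mul0r.
rewrite /partial big_nat_recr //= -/(partial e N) IH natrD -muln2 natrM exprS.
have : (2 : R) ^+ N != 0 by rewrite expf_neq0 // pnatr_eq0.
by move: (2 ^+ N) => y hy; field.
Qed.

(** Lower and upper bounds for the expanded number, from its first digits; they
    get better with every digit. *)
Lemma digits_val_mono e i j : (i <= j)%N ->
  (digits_val e i)%:R / 2 ^+ i <= (digits_val e j)%:R / 2 ^+ j :> R /\
  (digits_val e j).+1%:R / 2 ^+ j <= (digits_val e i).+1%:R / 2 ^+ i :> R.
Proof.
move=> /subnK <-; elim: (j - i)%N => [|k [IH1 IH2]]; first by rewrite add0n.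
have h : 0 < (2 : R) ^+ (k + i) by rewrite exprn_gt0.
split.
  apply: le_trans IH1 _; rewrite addSn exprS /= ler_pdivrMr // mulrAC.
  rewrite ler_pdivlMr ?mulr_gt0 // natrD -muln2 natrM.
  move: h; case: (e _) => /=;
    move: ((digits_val e (k + i))%:R : R) (2 ^+ (k + i) : R) => a y h; nra.
apply: le_trans IH2; rewrite addSn exprS /= ler_pdivrMr ?mulr_gt0 // mulrAC.
rewrite ler_pdivlMr // -[X in X * _ <= _]natr1 -[X in _ <= X * _]natr1.
rewrite natrD -muln2 natrM.
move: h; case: (e _) => /=;
  move: ((digits_val e (k + i))%:R : R) (2 ^+ (k + i) : R) => a y h; nra.
Qed.

(** A digit 0 after the first [N] makes the upper bound strictly smaller; this is
    where the expansions that end in ones are excluded. *)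
Lemma binary_expansion_prefix x e : binary_expansion x e ->
  forall N, prefix x N = digits_val e N.
Proof.
move=> [_ hx hz] N; apply: truncn_def.
have h2 k : 0 < (2 : R) ^+ k by rewrite exprn_gt0.
have [i hi ei] := hz N.+1.
rewrite [_ * x]mulrC -ler_pdivrMr // -ltr_pdivlMr //; apply/andP; split.
  apply: (cvgr_to_ge hx); near=> K; rewrite -/(partial e K) partialE.
  by apply: (digits_val_mono e _).1; near: K; exact: nbhs_infty_ge.
case: i hi ei => // i; rewrite ltnS => hi ei.
apply: le_lt_trans (lt_le_trans (_ : (digits_val e i.+1).+1%:R / 2 ^+ i.+1 < _)
   (digits_val_mono e hi).2).
  apply: (cvgr_to_le hx); near=> K; rewrite -/(partial e K) partialE.
  apply: le_trans (digits_val_mono e (_ : (i < K)%N)).2.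
    by rewrite ler_pM2r ?invr_gt0 // ler_nat.
  by near: K; exact: nbhs_infty_gt.
rewrite /= ei addn0 exprS ltr_pdivrMr ?mulr_gt0 // mulrAC ltr_pdivlMr //.
rewrite -[X in X * _ < _]natr1 -[X in _ < X * _]natr1 -muln2 natrM; have := h2 i.
by move: ((digits_val e i)%:R : R) (2 ^+ i : R) => a y h; nra.
Unshelve. all: by end_near.
Qed.

Lemma binary_expansion_digit x e i : 0 < x < 1 -> binary_expansion x e ->
  e i = odd (prefix x i).
Proof.
move=> x01 he; case: i => [|i]; first by rewrite prefix0 //; case: he.
by rewrite (binary_expansion_prefix he) /= oddD odd_double; case: (e _).
Qed.

Lemma prefix_digits_val x N : 0 < x < 1 ->
  digits_val (fun i => odd (prefix x i)) N = prefix x N.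
Proof.
move=> x01; have x0 : 0 <= x by case/andP: x01 => /ltW.
elim: N => [|N IH] /=; first by rewrite prefix0.
by rewrite IH -(prefix_half N x0) -muln2 -modn2 -divn_eq.
Qed.

(** If the digits ended in ones after the [N]-th, [2 ^+ N * x] would be within
    [2 ^- k] of the next integer for all [k]. *)
Lemma binary_expansion_exists x : 0 < x < 1 ->
  binary_expansion x (fun i => odd (prefix x i)).
Proof.
move=> x01; have x0 : 0 <= x by case/andP: x01 => /ltW.
have h2 k : 0 < (2 : R) ^+ k by rewrite exprn_gt0.
have pE k : partial (fun i => odd (prefix x i)) k = (prefix x k)%:R / 2 ^+ k.
  by rewrite partialE prefix_digits_val.
have gap k : 0 <= x - (prefix x k)%:R / 2 ^+ k < 2 ^- k.
  have /andP[h3 h4] := prefix_itv k x0.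
  rewrite subr_ge0 ler_pdivrMr // mulrC h3 /= ltrBlDr -{1}[2 ^- k]mul1r -mulrDl.
  by rewrite ltr_pdivlMr // mulrC addrC natr1.
have small (d : R) : 0 < d -> exists k, 2 ^- k < d.
  move=> d0; have := @cvg_expr R (2^-1) _.
  rewrite ger0_norm ?invr_ge0 // invf_lt1 // ltr1n => /(_ isT)/cvgrPdist_lt/(_ d d0).
  move=> [k _ /(_ k (leqnn k))]; rewrite /= sub0r normrN ger0_norm ?exprn_ge0 ?invr_ge0 //.
  by rewrite exprVn; exists k.
split; first by rewrite prefix0.
- apply/cvgrPdist_lt => d d0; have [k hk] := small d d0.
  near=> K; rewrite -/(partial _ K) pE.
  have /andP[h3 h4] := gap K; rewrite ger0_norm //.
  apply: lt_trans h4 (le_lt_trans _ hk).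
  rewrite lef_pV2 ?posrE // ler_eXn2l ?ltr1n //.
  by near: K; exact: nbhs_infty_ge.
move=> N; apply: contrapT => hN.
have h1 i : (N <= i)%N -> odd (prefix x i).
  by move=> hi; apply: contrapT => /negP/negbTE hf; apply: hN; exists i.
have grow k : ((prefix x (N + k)).+1 = 2 ^ k * (prefix x N).+1)%N.
  elim: k => [|k IH]; first by rewrite addn0 mul1n.
  have := divn_eq (prefix x (N + k).+1) 2; rewrite prefix_half // modn2 h1; last first.
    by rewrite -addnS leq_addr.
  by rewrite addnS expnS => ->; move: IH; nia.
have /andP[_ h3] := prefix_itv N x0.
have [k hk] := small ((prefix x N).+1%:R - 2 ^+ N * x) ltac:(by rewrite subr_gt0).
have /andP[h4 _] := prefix_itv (N + k) x0.
move: hk; rewrite ltNge => /negP; apply.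
rewrite -[leRHS]mul1r ler_pdivlMr // mulrBl lerBlDr -natrX -natrM mulnC -grow.
by rewrite -natr1 addrC lerD2l natrX mulrAC -exprD.
Unshelve. all: by end_near.
Qed.

Lemma epsE x i : 0 < x < 1 -> eps x i = odd (prefix x i).
Proof.
move=> x01; apply: binary_expansion_digit => //; rewrite /eps.
by case: xgetP => [e -> //|/(_ _ (binary_expansion_exists x01))].
Qed.

Lemma eps_prefix x N i : 0 < x < 1 -> (i <= N)%N ->
  eps x i = odd (prefix x N %/ 2 ^ (N - i)).
Proof.
move=> x01 hi; have x0 : 0 <= x by case/andP: x01 => /ltW.
by rewrite epsE // -(@prefix_div x i (N - i)) // subnKC.
Qed.

(** The midpoint of the dyadic interval, since its left end is 0 for [a = 0]. *)
Lemma prefix_mid N a : (a < 2 ^ N)%N ->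
  let x := (a%:R + 2^-1) / 2 ^+ N in 0 < x < 1 /\ prefix x N = a.
Proof.
move=> ha x; have h2 : 0 < (2 : R) ^+ N by rewrite exprn_gt0.
have hx : 2 ^+ N * x = a%:R + 2^-1 by rewrite /x mulrC divfK ?gt_eqF.
have ha' : (a.+1%:R : R) <= 2 ^+ N by rewrite -natrX ler_nat.
have ha0 : (0 : R) <= a%:R by [].
rewrite -[a.+1%:R]natr1 in ha'; split; last first.
  by apply: truncn_def; rewrite hx -[a.+1%:R]natr1; apply/andP; split; lra.
by rewrite /x divr_gt0 ?ltr_pdivrMr //=; lra.
Qed.

(** For [a = 0] the left end is excluded, because 0 is not a point of the space. *)
Lemma prefix_set N a : (a < 2 ^ N)%N ->
  [set x | 0 < x < 1 /\ prefix x N = a] =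
  [set` Interval (BSide (a != 0%N) (a%:R / 2 ^+ N)) (BLeft (a.+1%:R / 2 ^+ N))].
Proof.
move=> ha; have h2 : 0 < (2 : R) ^+ N by rewrite exprn_gt0.
have ha' : (a.+1%:R : R) <= 2 ^+ N by rewrite -natrX ler_nat.
apply/seteqP; split=> x /=; rewrite in_itv /=.
  move=> [x01 pa]; have x0 : 0 < x by case/andP: x01.
  have := prefix_itv N (ltW x0); rewrite pa => /andP[h3 h4].
  rewrite ltr_pdivlMr // [x * _]mulrC h4 andbT.
  by case: (eqVneq a 0%N) => [-> | _] /=; rewrite ?mul0r // ler_pdivrMr // mulrC.
move=> /andP[h3]; rewrite ltr_pdivlMr // => h4.
have h5 : a%:R <= x * 2 ^+ N.
  by move: h3; case: (a != 0%N) => /=; rewrite ?ltr_pdivrMr ?ler_pdivrMr // => /ltW.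
have x0 : 0 < x.
  move: h3; case: (eqVneq a 0%N) => [->|a0] /=; first by rewrite mul0r.
  by apply: lt_le_trans; rewrite divr_gt0 // ltr0n lt0n.
split; last by apply: truncn_def; rewrite mulrC h5.
by rewrite x0 /= -(ltr_pM2r h2) mul1r; apply: lt_le_trans h4 ha'.
Qed.

Lemma measure_prefix N (P : pred nat) :
  lebesgue_measure [set x : R | 0 < x < 1 /\ P (prefix x N)] =
  ((count P (iota 0 (2 ^ N)))%:R / 2 ^+ N)%:E.
Proof.
have h2 : 0 < (2 : R) ^+ N by rewrite exprn_gt0.
pose F (a : 'I_(2 ^ N)) := [set x : R | 0 < x < 1 /\ prefix x N = a].
have -> : [set x : R | 0 < x < 1 /\ P (prefix x N)] =
    \big[setU/set0]_(a < 2 ^ N | P a) F a.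
  pose G a := if P a then [set x : R | 0 < x < 1 /\ prefix x N = a] else set0.
  have -> : \big[setU/set0]_(a < 2 ^ N | P a) F a = \big[setU/set0]_(a < 2 ^ N) G a.
    by rewrite big_mkcond; apply: eq_bigr.
  rewrite -bigcup_mkord; apply/seteqP; split=> x /=.
    by move=> [x01 hP]; exists (prefix x N); rewrite /= ?prefix_lt // /G hP.
  by move=> [a _]; rewrite /G; case: ifP => //= hP [x01 ->].
have mF (a : 'I_(2 ^ N)) : lebesgue_measure (F a) = ((2 ^+ N)^-1)%:E.
  rewrite /F prefix_set // lebesgue_measure_itv /= ifT; last first.
    by rewrite lte_fin ltr_pM2r ?invr_gt0 // ltr_nat.
  by rewrite -EFinD -mulrBl -natrB // subSnn mul1r.
rewrite measure_bigsetU_ord_cond.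
- rewrite (eq_bigr (fun=> ((2 ^+ N)^-1)%:E)); last by move=> a _; exact: mF.
  rewrite sumEFin; congr EFin.
  rewrite -sum1_count natr_sum mulr_suml.
  by rewrite -(big_mkord P (fun=> (2 ^+ N)^-1)) /index_iota subn0; apply: eq_bigr => a _; rewrite mul1r.
- by move=> a _; rewrite /F prefix_set //; exact: measurable_itv.
by move=> a b _ _ [x [[_ ha] [_ hb]]]; apply: val_inj; rewrite /= -ha.
Qed.

End BinaryDigits.

(** * Words, positions and letters *)

Section Words.

Fixpoint bitw N a : seq bool :=
  if N is N'.+1 then odd (a %/ 2 ^ N') :: bitw N' a else [::].

Lemma size_bitw N a : size (bitw N a) = N.
Proof. by elim: N => //= N ->. Qed.

Lemma bval_bitw N a : bval (rev (bitw N a)) = a %% 2 ^ N.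
Proof.
elim: N => [|N IH] /=; first by rewrite modn1.
rewrite rev_cons -cats1 bval_cat IH size_rev size_bitw /= addn0.
have e1 := divn_eq a (2 ^ N); have l1 := ltn_pmod a (expn_gt0 2 N).
have e2 : a %/ 2 ^ N = (a %/ 2 ^ N.+1) * 2 + odd (a %/ 2 ^ N).
  by rewrite expnS [2 * _]mulnC divnMA -modn2 -divn_eq.
have e : a = a %/ 2 ^ N.+1 * 2 ^ N.+1 + (odd (a %/ 2 ^ N) * 2 ^ N + a %% 2 ^ N).
  by move: (a %/ 2 ^ N.+1) e2 => q2 e2; rewrite {1}e1 {1}e2 expnS; lia.
rewrite [in RHS]e modnMDl [RHS]modn_small; first by rewrite addnC mulnC.
by rewrite expnS; case: odd => /=; lia.
Qed.

Lemma bitw_div N k a : bitw N (a %/ 2 ^ k) = take N (bitw (N + k) a).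
Proof.
elim: N => [|N IH] /=; first by rewrite take0.
by rewrite IH expnD mulnC divnMA.
Qed.

Lemma drop_bitw N k a : drop N (bitw (N + k) a) = bitw k a.
Proof. by elim: N => [|N IH] /=; rewrite ?drop0. Qed.

Lemma bitw_mod N a : bitw N (a %% 2 ^ N) = bitw N a.
Proof.
have gen j : j <= N -> bitw j (a %% 2 ^ N) = bitw j a.
  elim: j => //= j IH hj; rewrite IH ?(ltnW hj) //; congr (_ :: _).
  rewrite [in RHS](divn_eq a (2 ^ N)) -(subnK hj) addnS -addSn expnD mulnA.
  rewrite divnMDl ?expn_gt0 // oddD oddM oddX /= andbF //.
exact: gen.
Qed.

Lemma bitw_inj N a b : a < 2 ^ N -> b < 2 ^ N -> bitw N a = bitw N b -> a = b.
Proof.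
move=> ha hb /(congr1 (fun w => bval (rev w))).
by rewrite !bval_bitw !modn_small.
Qed.

Fixpoint words k : seq (seq bool) :=
  if k is k'.+1 then map (cons false) (words k') ++ map (cons true) (words k')
  else [:: [::]].

Lemma wordsE N : words N = [seq bitw N a | a <- iota 0 (2 ^ N)].
Proof.
elim: N => [|N IH] //; rewrite expnS mul2n -addnn iotaD map_cat /= IH -!map_comp.
congr (_ ++ _); last rewrite [0 + _]addnC iotaDl -map_comp.
  apply/eq_in_map => a; rewrite mem_iota => /andP[_ ha] /=.
  by rewrite divn_small.
apply/eq_in_map => a; rewrite mem_iota => /andP[_ ha] /=.
rewrite divnDl // divnn expn_gt0 divn_small //=; congr (_ :: _).
by rewrite -(bitw_mod N (2 ^ N + a)) modnDl modn_small.
Qed.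

Lemma mem_words w k : (w \in words k) = (size w == k).
Proof.
elim: k w => [|k IH] [|b w] //=.
  by rewrite mem_cat; apply/negbTE; rewrite negb_or; apply/andP; split; apply/mapP => -[].
rewrite mem_cat eqSS -IH; apply/orP/idP => [[]/mapP[w' hw' [_ ->]] //|hw].
by case: b; [right|left]; apply: map_f.
Qed.

Lemma words_uniq k : uniq (words k).
Proof.
elim: k => //= k IH; rewrite cat_uniq !map_inj_uniq ?IH //=; try by move=> x y [].
by rewrite andbT; apply/hasPn => w /mapP[w' _ ->]; apply/mapP => -[].
Qed.

Definition lex_le (u v : seq bool) : bool :=
  ((u : seqlexi bool) <= (v : seqlexi bool))%O.

Lemma words_sorted k : sorted lex_le (words k).
Proof.
have tr : transitive lex_le by move=> u v w; exact: le_trans.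
rewrite sorted_pairwise //; elim: k => //= k IH.
rewrite pairwise_cat !pairwise_map; apply/and3P; split.
- by apply/allrelP => _ _ /mapP[u _ ->] /mapP[v _ ->]; rewrite /lex_le lexi_cons.
- apply: sub_pairwise IH => u v; rewrite /lex_le /= lexi_cons lexx.
  by move=> ->.
apply: sub_pairwise IH => u v; rewrite /lex_le /= lexi_cons lexx.
by move=> ->.
Qed.

(** By induction on the mask: an unselected position is free and doubles the
    count, a selected one is the first digit of the word tested. *)
Lemma count_mask (mu : bitseq) (Q : pred (seq bool)) :
  count (fun w => Q (mask mu w)) (words (size mu)) * 2 ^ count id mu =
  2 ^ size mu * count Q (words (count id mu)).
Proof.
elim: mu Q => [|b mu IH] Q /=; first by rewrite muln1 mul1n.
rewrite count_cat !count_map /=; case: b => /=.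
  have e c : preim (cons c) (fun w : seq bool => Q (mask (true :: mu) w)) =1
      (fun w => (preim (cons c) Q) (mask mu w)) by [].
  rewrite add1n /= count_cat !count_map !(eq_count (e _)) !expnS.
  by rewrite mulnCA mulnDl (IH (preim _ Q)) (IH (preim _ Q)) -mulnDr mulnA.
have e c : preim (cons c) (fun w : seq bool => Q (mask (false :: mu) w)) =1
    (fun w => Q (mask mu w)) by [].
by rewrite !(eq_count (e _)) add0n addnn -mul2n -mulnA IH expnS mulnA.
Qed.

End Words.

Section Positions.
Variable M : nat.

Definition row_end rho := \sum_(1 <= r < rho.+1) row_len M r.

Lemma row_endS rho : row_end rho.+1 = row_end rho + row_len M rho.+1.
Proof. by rewrite /row_end big_nat_recr. Qed.

Lemma row_end_mono r1 r2 : r1 < r2 -> row_end r1 < row_end r2.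
Proof.
move=> /subnK <-; elim: (r2 - r1.+1) => [|k IH]; first by rewrite add0n row_endS addnS ltnS leq_addr.
by rewrite addSn row_endS; apply: leq_trans IH (leq_addr _ _).
Qed.

(** Column [i] starts where the rows of length [i] start, and there are [M.+1]
    of them, in each of which its entry is the last one. *)
Lemma jcolE i k : k < M.+1 -> jcol M i.+1 k.+1 = row_end (i * M.+1 + k.+1).
Proof.
move=> hk; rewrite /jcol.
have -> : i.+1 * M.+1 + k.+1 = i * M.+1 + (M.+1 + k.+1) by rewrite mulSn; lia.
rewrite iotaD filter_cat map_cat.
have -> : [seq rho <- iota 1 (i * M.+1) | i < row_len M rho] = [::].
  apply/eqP; rewrite -[_ == _]negbK -has_filter; apply/negP => /hasP[r].
  rewrite mem_iota /row_len ltnS => /andP[h1 h2].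
  by rewrite leq_divRL //; lia.
have /all_filterP -> : all (fun rho => i < row_len M rho)
    (iota (1 + i * M.+1) (M.+1 + k.+1)).
  apply/allP => r; rewrite mem_iota /row_len ltnS => /andP[h1 h2].
  by rewrite leq_divRL //; lia.
rewrite cat0s (nth_map 0) ?size_iota; last by lia.
rewrite nth_iota; last by lia.
have -> : 1 + i * M.+1 + k.+1.-1 = i * M.+1 + k.+1 by rewrite /= addnS add1n addSn.
have hl : row_len M (i * M.+1 + k.+1) = i.+1.
  by rewrite /row_len addnS /= divnMDl // divn_small // addn0.
rewrite /jrow hl nth_iota // addnS row_endS -[in RHS]addnS hl /=.
by rewrite addSn addnS.
Qed.

Lemma jbar_flat n : [seq jcol M i k | i <- iota 1 n, k <- iota 1 M.+1] =
  [seq row_end r | r <- iota 1 (n * M.+1)].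
Proof.
elim: n => [|n IH] //.
have -> : iota 1 n.+1 = iota 1 n ++ [:: n.+1] by rewrite -(addn1 n) iotaD add1n addn1.
rewrite allpairs_cat IH mulSn [M.+1 + _]addnC iotaD map_cat.
congr (_ ++ _); rewrite allpairs1l addnC iotaDl -map_comp.
apply/eq_in_map => k; rewrite mem_iota => /andP[k1 k2] /=.
by rewrite -(prednK k1) jcolE //; lia.
Qed.

Lemma JbarE n : Jbar M n = [seq row_end r | r <- iota 1 (n * M.+1)].
Proof.
rewrite /Jbar jbar_flat.
have hs : sorted ltn [seq row_end r | r <- iota 1 (n * M.+1)].
  rewrite sorted_map; apply: sub_sorted (iota_ltn_sorted _ _).
  by move=> r1 r2; exact: row_end_mono.
rewrite undup_id; last exact: sorted_uniq ltn_trans ltnn _ hs.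
by rewrite sorted_sort //; [exact: leq_trans|apply: sub_sorted hs; exact: ltnW].
Qed.

(** The list of all words is sorted for the lexicographic order and has the same
    elements as the enumeration that [evec] sorts. *)
Lemma evecE n l : l < 2 ^ (n * M.+1) -> evec M n l = bitw (n * M.+1) l.
Proof.
move=> hl; rewrite /evec; set q := n * M.+1 in hl *.
have -> : [seq val w | w <- sort <=%O (enum {: q.-tuplelexi bool})] = words q.
  have -> : [seq val w | w <- sort <=%O (enum {: q.-tuplelexi bool})] =
      sort lex_le [seq val w | w <- enum {: q.-tuplelexi bool}].
    by apply/esym; rewrite sort_map.
  apply: (@sorted_eq _ lex_le).
  - by move=> u v w; exact: le_trans.
  - by move=> u v; exact: le_anti.
  - by apply: sort_sorted => u v; exact: le_total.
  - exact: words_sorted.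
  apply: uniq_perm; rewrite ?sort_uniq ?words_uniq //.
    by rewrite map_inj_uniq ?enum_uniq //; exact: val_inj.
  move=> w; rewrite mem_sort mem_words; apply/mapP/idP => [[t _ ->]|hw].
    by rewrite size_tuple.
  by exists (Tuple hw); rewrite ?mem_enum.
by rewrite wordsE (nth_map 0) ?size_iota // nth_iota.
Qed.

End Positions.

(** * The distribution of the sum *)

Section Letters.
Variables (R : realType) (M : nat).
Notation m := (2 ^ M.+1)%N.
Variables (o : 'I_m -> R) (vs : 'I_m -> M.+1.-tuple bool).
Hypothesis vs_bij : bijective vs.

Definition letter_of (w : seq bool) : 'I_m :=
  odflt (Ordinal (expn_gt0 2 M.+1)) [pick s | vs s == w :> seq bool].

Lemma letter_ofK w : size w = M.+1 -> vs (letter_of w) = w :> seq bool.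
Proof.
move=> /eqP hw; have [g _ gK] := vs_bij.
rewrite /letter_of; case: pickP => [s /eqP //|/(_ (g (Tuple hw)))].
by rewrite gK eqxx.
Qed.

Lemma letter_of_vs s : letter_of (vs s) = s.
Proof. by apply: (bij_inj vs_bij); apply: val_inj; rewrite /= letter_ofK ?size_tuple. Qed.

Definition letter d := letter_of (bitw M.+1 d).

Lemma letters : perm_eq [seq letter d | d <- iota 0 m] (enum 'I_m).
Proof.
have hu : uniq [seq letter d | d <- iota 0 m].
  rewrite map_inj_in_uniq ?iota_uniq // => d d'; rewrite !mem_iota => hd hd' e.
  apply: (@bitw_inj M.+1) => //.
  have := congr1 (fun s => val (vs s)) e.
  by rewrite /= /letter !letter_ofK ?size_bitw.
apply: uniq_perm; rewrite ?enum_uniq //.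
have [||_ h] := @uniq_min_size _ _ (enum 'I_m) hu.
- by move=> i _; rewrite mem_enum.
- by rewrite size_enum_ord size_map size_iota.
exact: h.
Qed.

Fixpoint word_sum n (w : seq bool) : R :=
  if n is n'.+1 then (o (letter_of (take M.+1 w)) + word_sum n' (drop M.+1 w))%R
  else 0%R.

Lemma word_sumS n w : word_sum n.+1 w =
  (o (letter_of (take M.+1 w)) + word_sum n (drop M.+1 w))%R.
Proof. by []. Qed.

Lemma RvarE i x : Rvar o vs i.+1 x =
  o (letter_of [seq eps x (jcol M i.+1 k) | k <- iota 1 M.+1]).
Proof.
rewrite /Rvar; set w := [seq _ | k <- iota 1 M.+1].
have e : [tuple eps x (jcol M i.+1 k.+1) | k < M.+1] = w :> seq bool.
  by rewrite /= /w -[iota 1 _]/(iota (1 + 0) _) iotaDl -map_comp -val_enum_ord -map_comp.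
have -> : [pick s | vs s == [tuple eps x (jcol M i.+1 k.+1) | k < M.+1]] =
    Some (letter_of w).
  case: pickP => [s /eqP hs|h]; first by rewrite -e -hs letter_of_vs.
  have [g _ gK] := vs_bij; have := h (g [tuple eps x (jcol M i.+1 k.+1) | k < M.+1]).
  by rewrite gK eqxx.
by [].
Qed.

Lemma SnE n x : Sn o vs n x = word_sum n [seq eps x j | j <- Jbar M n].
Proof.
rewrite JbarE /Sn.
have gen a : (\sum_(a.+1 <= i < a + n.+1) Rvar o vs i x =
    word_sum n [seq eps x j | j <- [seq row_end M r | r <- iota (a * M.+1).+1 (n * M.+1)]])%R.
  elim: n a => [|n IH] a; first by rewrite addn1 big_geq.
  rewrite big_ltn; last by lia.
  rewrite addnS -addSn IH RvarE [n.+1 * _]mulSn iotaD !map_cat.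
  have -> : (a.+1 * M.+1).+1 = (a * M.+1).+1 + M.+1 by rewrite mulSn; lia.
  rewrite word_sumS take_size_cat ?drop_size_cat ?size_map ?size_iota //.
  congr (_ + _)%R; congr (o (letter_of _)); rewrite -[(a * M.+1).+1]addn1 iotaDl.
  rewrite -!map_comp; apply/eq_in_map => k; rewrite mem_iota => /andP[k0 hk] /=.
  by rewrite -(prednK k0) jcolE //; lia.
by have := gen 0; rewrite add0n mul0n.
Qed.

(** The value of the word with rank [l]: its letters are the digits of [l] in base
    [m], that is, the blocks of [M.+1] binary digits. *)
Fixpoint rank_sum n l : R :=
  if n is n'.+1 then (o (letter (l %/ m ^ n')%N) + rank_sum n' (l %% m ^ n')%N)%R
  else 0%R.

Lemma rank_sumS n l : rank_sum n.+1 l =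
  (o (letter (l %/ m ^ n)%N) + rank_sum n (l %% m ^ n)%N)%R.
Proof. by []. Qed.

Lemma rank_sumE n l : word_sum n (bitw (n * M.+1) l) = rank_sum n l.
Proof.
elim: n l => // n IH l.
rewrite word_sumS rank_sumS mulSn -IH /letter -expnM [(M.+1 * n)]mulnC.
by rewrite bitw_div drop_bitw bitw_mod.
Qed.

Lemma evec_sum n l : l < 2 ^ (n * M.+1) -> forall x, Eset M n l x ->
  Sn o vs n x = rank_sum n l.
Proof. by move=> hl x [_ h]; rewrite SnE h evecE // rank_sumE. Qed.

Lemma mask_Jbar n N : row_end M (n * M.+1) <= N ->
  let mu := [seq i \in Jbar M n | i <- iota 1 N] in
  (forall T (f : nat -> T), [seq f j | j <- Jbar M n] = mask mu [seq f i | i <- iota 1 N])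
  /\ count id mu = n * M.+1.
Proof.
move=> hN mu.
have mono r1 r2 : r1 <= r2 -> row_end M r1 <= row_end M r2.
  by rewrite leq_eqVlt => /orP[/eqP->//|/row_end_mono h]; exact: ltnW (h M).
have hs : sorted ltn (Jbar M n).
  rewrite JbarE sorted_map; apply: sub_sorted (iota_ltn_sorted _ _).
  by move=> r1 r2; exact: row_end_mono.
have e : Jbar M n = [seq i <- iota 1 N | i \in Jbar M n].
  apply: (irr_sorted_eq ltn_trans ltnn) => //.
    by apply: sorted_filter; [exact: ltn_trans|exact: iota_ltn_sorted].
  move=> i; rewrite mem_filter; case: (boolP (i \in _)) => //= .
  rewrite JbarE => /mapP[r]; rewrite !mem_iota => /andP[r1 r2] ->.
  apply/esym/andP; split; last first.
    by rewrite add1n ltnS; apply: leq_trans hN; apply: mono; lia.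
  by have := row_end_mono M r1; lia.
split=> [T f|].
  by rewrite [in LHS]e filter_mask map_mask.
by rewrite /mu count_map -size_filter -e JbarE size_map size_iota.
Qed.

Lemma eps_bitw (x : R) N : (0 < x < 1)%R ->
  [seq eps x i | i <- iota 1 N] = bitw N (prefix x N).
Proof.
move=> x01; have : (0 <= x)%R by case/andP: x01 => /Order.POrderTheory.ltW.
move=> x0; elim: N => [|N IH] //.
have gen k j : [seq odd (k %/ 2 ^ (j - i)) | i <- iota 1 j] = bitw j k.
  elim: j => //= j IHj; rewrite subSS subn0; congr (_ :: _).
  rewrite -IHj -[2]/(1 + 1) iotaDl -map_comp; apply/eq_in_map => i.
  by rewrite mem_iota /= add1n subSS.
rewrite -gen; apply/eq_in_map => i; rewrite mem_iota => /andP[h1 h2].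
by rewrite (@eps_prefix _ _ N.+1).
Qed.

(** Some word of length [row_end M (n * M.+1)] has the given digits at the
    positions in [Jbar M n], by counting; it is the prefix of a point. *)
Lemma Eset_nonempty n l : l < 2 ^ (n * M.+1) -> exists x : R, Eset M n l x.
Proof.
move=> hl; set N := row_end M (n * M.+1).
have [h1 h2] := mask_Jbar (leqnn N); set mu := [seq _ | i <- _] in h1 h2.
have smu : size mu = N by rewrite size_map size_iota.
have : bitw (n * M.+1) l \in [seq mask mu w | w <- words N].
  have : 0 < count (pred1 (bitw (n * M.+1) l)) (words (count id mu)).
    by rewrite h2 -has_count has_pred1 mem_words size_bitw.
  have := count_mask mu (pred1 (bitw (n * M.+1) l)).
  rewrite smu; set c := count _ (words N); case: (posnP c) => [-> |].
    rewrite mul0n => /esym/eqP; rewrite muln_eq0 expn_eq0 /= => /eqP ->.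
    by rewrite ltnn.
  by rewrite /c -has_count => /hasP[w hw /eqP <-] _ _; apply: map_f.
rewrite wordsE -map_comp => /mapP[a]; rewrite mem_iota => /andP[_ ha] /= e.
have [x01 pa] := prefix_mid R ha.
eexists; split; first exact: x01.
by rewrite evecE // h1 eps_bitw // pa -e.
Qed.

(** The digits outside [Jbar M n] are free, so they contribute the same power of 2
    to the number of prefixes and to the number of favourable ones. *)
Lemma cdf_SnE n u : cdf_Sn o vs n u =
  ((count (fun l => rank_sum n l <= u)%R (iota 0 (2 ^ (n * M.+1))))%:R
    / 2 ^+ (n * M.+1))%:E%R.
Proof.
set N := row_end M (n * M.+1).
have [h1 h2] := mask_Jbar (leqnn N); set mu := [seq _ | i <- _] in h1 h2.
have smu : size mu = N by rewrite size_map size_iota.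
pose Q w := (word_sum n w <= u)%R.
have -> : cdf_Sn o vs n u = lebesgue_measure
    [set x : R | (0 < x < 1)%R /\ Q (mask mu (bitw N (prefix x N)))]%classic.
  congr (lebesgue_measure _); apply/seteqP; split=> x /= [x01 hx]; split=> //.
    by rewrite -eps_bitw // -h1 /Q -SnE.
  by rewrite SnE h1 eps_bitw.
rewrite (measure_prefix R N (fun a => Q (mask mu (bitw N a)))); congr EFin.
have := count_mask mu Q; rewrite smu h2 !wordsE !count_map.
rewrite (@eq_count _ (preim _ Q) (fun l => rank_sum n l <= u)%R); last first.
  by move=> l /=; rewrite /Q rank_sumE.
move=> /(congr1 (fun k => k%:R : R)%R); rewrite !natrM !natrX.
set a := (count _ _)%:R%R; set b := (count _ _)%:R%R => e.
have hN k : ((2 : R) ^+ k != 0)%R by rewrite expf_neq0 // pnatr_eq0.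
by apply/eqP; rewrite eqr_div // e mulrC.
Qed.

End Letters.

(** * The permutation as a list of ranks *)

Section Counting.
Variables (R : realType) (M : nat).
Notation m := (2 ^ M.+1)%N.
Variables (o : 'I_m -> R) (vs : 'I_m -> M.+1.-tuple bool).
Hypothesis vs_bij : bijective vs.
Local Notation letter := (letter vs).
Local Notation rank_sum := (rank_sum o vs).

Lemma iota_blocks a b :
  iota 0 (a * b) = flatten [seq [seq d * b + x | x <- iota 0 b] | d <- iota 0 a].
Proof.
elim: a => // a IH.
rewrite mulSn addnC iotaD IH -[in RHS](addn1 a) iotaD map_cat flatten_cat /= cats0.
by rewrite -[in LHS](addn0 (0 + a * b)) iotaDl.
Qed.

Fixpoint letter_count n l : 'I_m -> nat :=
  if n is n'.+1 then
    incr (letter_count n' (l %% m ^ n')) (letter (l %/ m ^ n'))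
  else fun=> 0.

Lemma sum_letter_count n l : \sum_s letter_count n l s = n.
Proof.
elim: n l => [|n IH] l /=; first by rewrite big1.
by rewrite sum_incr IH.
Qed.

Definition dotn (k : 'I_m -> nat) : R := (\sum_s (k s)%:R * o s)%R.

Lemma dotn_incr k s : dotn (incr k s) = (dotn k + o s)%R.
Proof.
rewrite /dotn /incr (eq_bigr (fun j => (k j)%:R * o j + (j == s)%:R * o j)%R); last first.
  by move=> j _; rewrite natrD mulrDl.
rewrite big_split /=; congr (_ + _)%R.
rewrite (bigD1 s) //= eqxx mul1r big1 ?addr0 // => j /negbTE ->.
by rewrite mul0r.
Qed.

Lemma rank_sum_dotn n l : rank_sum n l = dotn (letter_count n l).
Proof.
elim: n l => [|n IH] l; first by rewrite /dotn big1 // => s _; rewrite mul0r.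
by rewrite rank_sumS [letter_count n.+1 l]/= dotn_incr IH addrC.
Qed.

Definition decr (k : 'I_m -> nat) (s : 'I_m) : 'I_m -> nat :=
  fun j => k j - (j == s).

Definition number n (k : 'I_m -> nat) : nat :=
  count (fun l => [forall s, letter_count n l s == k s]) (iota 0 (m ^ n)).

Lemma block_divn n d x : x < m ^ n -> (d * m ^ n + x) %/ m ^ n = d.
Proof. by move=> hx; rewrite divnMDl ?divn_small ?addn0 // !expn_gt0. Qed.

Lemma block_modn n d x : x < m ^ n -> (d * m ^ n + x) %% m ^ n = x.
Proof. by move=> hx; rewrite modnMDl modn_small. Qed.

Lemma number_rec n k :
  number n.+1 k = \sum_(s | 0 < k s) number n (decr k s).
Proof.
rewrite /number (expnS m n) iota_blocks count_flatten -map_comp sumnE big_map.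
rewrite (eq_big_seq (fun d => if 0 < k (letter d) then number n (decr k (letter d)) else 0)).
  by rewrite -(big_map letter xpredT (fun s => if 0 < k s then number n (decr k s) else 0))
    (perm_big _ (letters vs_bij)) big_enum /= -big_mkcond.
move=> d _; rewrite [LHS]/= count_map; have [hk|hk] := posnP (k (letter d)).
  rewrite (@eq_in_count _ _ pred0) ?count_pred0 // => x.
  rewrite mem_iota => /andP[_ hx] /=; apply/negbTE/forallPn; exists (letter d).
  by rewrite block_divn // /incr eqxx hk addn1.
apply: eq_in_count => x; rewrite mem_iota => /andP[_ hx] /=.
rewrite block_divn // block_modn //; apply/forallP/forallP => h s; have := h s.
  by rewrite /decr => /eqP <-; rewrite /incr addnK.
rewrite /decr /incr => /eqP ->.
by case: (eqVneq s (letter d)) => [->|_]; rewrite ?subn0 ?addn0 // subnK.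
Qed.

(** The multinomial coefficient counts the words with given letter counts: a
    word with counts [k] starts, for some [s] with [k s > 0], with the letter [s],
    and for the rest of it the factorial of [k s] loses the factor [k s]. *)
Lemma number_fact n k : \sum_s k s = n -> number n k * \prod_s (k s)`! = n`!.
Proof.
elim: n k => [|n IH] k hk.
  have k0 s : k s = 0.
    by apply/eqP; rewrite -leqn0 -hk (bigD1 s) //= leq_addr.
  rewrite big1; last by move=> s _; rewrite k0.
  by rewrite muln1 /number /=; case: forallP => // -[] s; rewrite k0.
rewrite number_rec big_distrl /= (eq_bigr (fun s => k s * n`!)).
  rewrite -big_distrl /= factS -hk; congr (_ * _).
  rewrite [in RHS](bigID (fun s => 0 < k s)) /= [X in _ + X]big1 ?addn0 //.
  by move=> s; case: (k s).
move=> s ks; rewrite -(IH (decr k s)).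
  rewrite mulnCA; congr (_ * _).
  rewrite (bigD1 s) //= [in RHS](bigD1 s) //= mulnA; congr (_ * _).
    by rewrite /decr eqxx; case: (k s) ks => // j _; rewrite subn1 factS.
  by apply: eq_bigr => j /negbTE hj; rewrite /decr hj subn0.
apply/eqP; rewrite -eqSS -hk -addn1; apply/eqP.
rewrite (bigD1 s) //= [in RHS](bigD1 s) //= addnAC {1}/decr eqxx subnK //.
by congr (_ + _); apply: eq_bigr => j /negbTE hj; rewrite /decr hj subn0.
Qed.

Lemma multinomialE n (k : {ffun 'I_m -> 'I_n.+1}) : k \in Kset M n ->
  multinomial k = number n (fun s => k s).
Proof.
rewrite inE => /eqP hk; rewrite /multinomial -(number_fact hk) mulnK //.
by apply: prodn_gt0 => s; exact: fact_gt0.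
Qed.

Variable n : nat.
Local Notation ranks := (iota 0 (m ^ n)).

Definition count_vector l : {ffun 'I_m -> 'I_n.+1} :=
  [ffun s => inord (letter_count n l s)].

Lemma count_vectorE l s : count_vector l s = letter_count n l s :> nat.
Proof.
by rewrite ffunE inordK // ltnS -[leqRHS](sum_letter_count n l) (bigD1 s) //= leq_addr.
Qed.

Lemma count_vector_K l : count_vector l \in Kset M n.
Proof.
rewrite inE; apply/eqP; rewrite -[RHS](sum_letter_count n l).
by apply: eq_bigr => s _; rewrite count_vectorE.
Qed.

Lemma dot_count_vector l : dot o (count_vector l) = rank_sum n l.
Proof.
by rewrite rank_sum_dotn; apply: eq_bigr => s _; rewrite count_vectorE.
Qed.

Lemma SMC_count t : SMC o n t = count (fun l => rank_sum n l < v o n t)%R ranks.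
Proof.
rewrite /SMC (eq_bigr (fun k : {ffun 'I_m -> 'I_n.+1} =>
    \sum_(l <- ranks) (count_vector l == k))).
  rewrite exchange_big /= -sum1_count [RHS]big_mkcond; apply: eq_bigr => l _.
  rewrite big_mkcond (bigD1 (count_vector l)) //= big1 ?addn0.
    by rewrite count_vector_K dot_count_vector eqxx.
  by move=> k /negbTE hk; rewrite eq_sym hk if_same.
move=> k /andP[hk _]; rewrite multinomialE // /number -sum1_count big_mkcond.
apply: eq_bigr => l _ /=; case: forallP => h; case: eqP => //= e.
  case: e; apply/ffunP => s; apply: val_inj; rewrite /= count_vectorE.
  exact/eqP/h.
by case: h => s; rewrite -e count_vectorE.
Qed.

Lemma rank_sum_values l : rank_sum n l \in values o n.
Proof.
rewrite mem_sort mem_undup -dot_count_vector; apply: map_f.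
by rewrite mem_enum count_vector_K.
Qed.

Lemma values_sorted : sorted <%R (values o n).
Proof. by rewrite sort_lt_sorted undup_uniq. Qed.

Lemma v_lt t t' : t < size (values o n) -> t' < size (values o n) ->
  (v o n t < v o n t')%R = (t < t').
Proof. exact: (lt_sorted_ltn_nth 0%R values_sorted). Qed.

Lemma v_inj t t' : t < size (values o n) -> t' < size (values o n) ->
  v o n t = v o n t' -> t = t'.
Proof.
move=> h h' e; have := v_lt h h'; have := v_lt h' h.
by rewrite e ltxx; case: ltngtP.
Qed.

Lemma values_index l : exists2 j, j < size (values o n) & rank_sum n l = v o n j.
Proof.
exists (index (rank_sum n l) (values o n)); first by rewrite index_mem rank_sum_values.
by rewrite /v nth_index // rank_sum_values.
Qed.

Lemma Tn_lt t : (t <= Tn o n) = (t < size (values o n)).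
Proof.
rewrite /Tn; have : 0 < size (values o n).
  by have [j + _] := values_index 0; case: size.
by case: size.
Qed.

Lemma Tn_bound : Tn o n < n.+1 ^ m.
Proof.
have hs : size (values o n) <= n.+1 ^ m.
  rewrite size_sort (leq_trans (size_undup _)) // size_map -cardE.
  by rewrite (leq_trans (max_card _)) // card_ffun !card_ord.
by apply: leq_trans hs; rewrite -Tn_lt.
Qed.

Definition level t : nat := count (fun l => rank_sum n l == v o n t) ranks.

(** The value of a word is [v o n j] for exactly one [j], and the words counted
    are those with [j < t]. *)
Lemma count_below t (P : pred nat) : t <= size (values o n) ->
  (forall l j, j < size (values o n) -> rank_sum n l = v o n j -> P l = (j < t)) ->
  count P ranks = \sum_(t' < t) level t'.
Proof.
move=> ht hP; rewrite -sum1_count big_mkcond /=.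
rewrite [RHS](eq_bigr (fun t' : 'I_t => \sum_(l <- ranks) (rank_sum n l == v o n t'))).
  rewrite exchange_big /=; apply: eq_bigr => l _.
  have [j hj e] := values_index l; rewrite (hP l j) // e.
  case: ltnP => hjt.
    rewrite (bigD1 (Ordinal hjt)) //= eqxx big1 // => i hi.
    case: eqP => // /v_inj h; move/eqP: hi => -[]; apply: val_inj; rewrite /= h //.
    exact: leq_trans (ltn_ord i) ht.
  rewrite big1 // => i _; case: eqP => // /v_inj h.
  by have := ltn_ord i; rewrite -h //; [lia|exact: leq_trans (ltn_ord i) ht].
by move=> t' _; rewrite /level -sum1_count big_mkcond; apply: eq_bigr => l _; case: eqP.
Qed.

Lemma SMC_levels t : t <= Tn o n -> SMC o n t = \sum_(t' < t) level t'.
Proof.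
rewrite Tn_lt => ht; rewrite SMC_count; apply: count_below; first exact: ltnW.
by move=> l j hj ->; rewrite v_lt.
Qed.

Lemma count_le_levels t : t <= Tn o n ->
  count (fun l => rank_sum n l <= v o n t)%R ranks = \sum_(t' < t.+1) level t'.
Proof.
rewrite Tn_lt => ht; apply: count_below => // l j hj ->.
by rewrite leNgt v_lt // -leqNgt ltnS.
Qed.

Lemma sum_levels : \sum_(t < size (values o n)) level t = m ^ n.
Proof.
rewrite -(@count_below _ xpredT) ?count_predT ?size_iota // => l j hj _.
Qed.

Lemma level_exists l : l < m ^ n -> exists2 T, T <= Tn o n &
  \sum_(t < T) level t <= l < \sum_(t < T.+1) level t.
Proof.
rewrite -sum_levels => hl.
have ex : exists T, l < \sum_(t < T) level t by eexists; exact: hl.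
case: (ex_minnP ex) => -[|T] hT hmin; first by rewrite big_ord0 in hT.
exists T; first by rewrite Tn_lt; exact: hmin.
rewrite hT andbT leqNgt; apply/negP => h.
by have := hmin _ h; rewrite ltnn.
Qed.

Lemma expn_mn : m ^ n = 2 ^ (n * M.+1).
Proof. by rewrite -expnM mulnC. Qed.

(** The distribution function exceeds a point of [Dset M n l] from [v o n T] on:
    there it counts more than [l] words, before it at most [l]. *)
Lemma quantileE l T : T <= Tn o n ->
  \sum_(t < T) level t <= l < \sum_(t < T.+1) level t ->
  forall x, Dset M n l x -> quantile_Sn o vs n x = v o n T.
Proof.
move=> hT /andP[h1 h2] x /= [x0 /andP[hx1 hx2]].
have p0 : (0 < (2 : R) ^+ (n * M.+1))%R by rewrite exprn_gt0.
set A := [set t : R | (x%:E < cdf_Sn o vs n t)%E]%classic.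
have AE u : A u = (x * 2 ^+ (n * M.+1) <
    (count (fun l => rank_sum n l <= u)%R ranks)%:R)%R :> Prop.
  by rewrite /A /= cdf_SnE // -expn_mn lte_fin ltr_pdivlMr.
have vA : A (v o n T).
  rewrite AE count_le_levels //.
  move: hx2; rewrite ltr_pdivlMr // => hx2; apply: lt_le_trans hx2 _.
  by rewrite ler_nat.
have lbA : lbound A (v o n T).
  move=> u; rewrite AE => hu; rewrite leNgt; apply/negP => hlt.
  have : count (fun l => rank_sum n l <= u)%R ranks <= l.
    apply: leq_trans h1; rewrite -SMC_levels // SMC_count.
    by apply: sub_count => l' /= /le_lt_trans; exact.
  rewrite leqNgt => /negP; apply; rewrite -(ltr_nat R).
  by apply: le_lt_trans hu; move: hx1; rewrite ler_pdivrMr.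
apply/eqP; rewrite eq_le; apply/andP; split.
  by apply: ge_inf => //; exists (v o n T).
by apply: lb_le_inf => //; exists (v o n T).
Qed.

Lemma Dset_nonempty l : exists x : R, Dset M n l x.
Proof.
have p0 : (0 < (2 : R) ^+ (n * M.+1))%R by rewrite exprn_gt0.
exists ((l%:R + 2^-1) / 2 ^+ (n * M.+1))%R.
have l0 : (0 <= l%:R :> R)%R by [].
split; first by rewrite divr_gt0 //; lra.
by rewrite ler_pM2r ?invr_gt0 // ltr_pM2r ?invr_gt0 // -[l.+1%:R%R]natr1; apply/andP; split; lra.
Qed.

Lemma IStepE l T : T <= Tn o n ->
  \sum_(t < T) level t <= l < \sum_(t < T.+1) level t -> IStep o vs n l = T.
Proof.
move=> hT hl; rewrite /IStep; case: xgetP => [t -> [/= ht hq]|h].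
  have [x hx] := Dset_nonempty l.
  by apply: v_inj; rewrite -?Tn_lt // -(hq x hx) (quantileE hT hl).
by case: (h T); split=> //; exact: quantileE.
Qed.

Lemma IBE t : IB o vs n t = [seq l <- ranks | rank_sum n l == v o n t].
Proof.
rewrite /IB -expn_mn; apply: eq_in_filter => l; rewrite mem_iota => /andP[_ hl].
rewrite add0n expn_mn in hl; have [x hx] := Eset_nonempty R hl.
apply/asboolP/eqP => [h|h y hy]; first by rewrite -(evec_sum o vs_bij hl hx) h.
by rewrite (evec_sum o vs_bij hl hy).
Qed.

Lemma FpermE l T : T <= Tn o n ->
  \sum_(t < T) level t <= l < \sum_(t < T.+1) level t ->
  Fperm o vs n l = nth 0 [seq l' <- ranks | rank_sum n l' == v o n T]
                       (l - \sum_(t < T) level t).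
Proof.
move=> hT hl; rewrite /Fperm (IStepE hT hl) SMC_levels // IBE.
by congr nth; case/andP: hl => h _; rewrite add1n subSn.
Qed.

Hypothesis n0 : 0 < n.

(** For counts with sum [n] the remaining conditions of the oracle hold. *)
Lemma tau1E (k : 'I_m -> nat) t : t <= Tn o n -> \sum_s k s = n ->
  tau1 o (n :: rcons [seq k s | s <- enum 'I_m] t) = (dotn k == v o n t).
Proof.
move=> ht hk; pose kf : {ffun 'I_m -> 'I_n.+1} := [ffun s => inord (k s)].
have kfE s : kf s = k s :> nat.
  by rewrite ffunE inordK // ltnS -hk (bigD1 s) //= leq_addr.
have dE : dot o kf = dotn k by apply: eq_bigr => s _; rewrite kfE.
apply/asboolP/eqP => [[n' [t' [k' [e [_ ht'] hk' hd]]]]|h].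
  case: e => e1 /rcons_inj[e2 e3]; subst n' t'.
  rewrite -hd -dE; congr dot; apply/ffunP => s; apply: val_inj; rewrite /= kfE.
  by move/eq_in_map: e2 => -> //; rewrite mem_enum.
exists n, t, kf; split=> //; last by rewrite dE.
  by congr (_ :: rcons _ _); apply: eq_map => s; rewrite /= kfE.
rewrite inE; apply/eqP; rewrite -[RHS]hk; apply: eq_bigr => s _.
exact: kfE.
Qed.

Lemma acceptedE r k t : t <= Tn o n -> \sum_s k s + r = n ->
  accepted n (tau1 o) t letter r k =
  [seq l <- iota 0 (m ^ r) | (dotn k + rank_sum r l)%R == v o n t].
Proof.
move=> ht; elim: r k => [|r IH] k hk.
  by rewrite /= tau1E //; [rewrite addr0; case: ifP|rewrite -hk addn0].
rewrite (expnS m r) iota_blocks filter_flatten -map_comp; congr flatten.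
apply/eq_in_map => d _; rewrite [RHS]/= filter_map.
rewrite -/(accepted n (tau1 o) t letter r _) IH; last by rewrite sum_incr; lia.
congr map; apply: eq_in_filter => x.
rewrite mem_iota => /andP[_ hx].
by rewrite /= -/(rank_sum r.+1 _) rank_sumS block_divn // block_modn // dotn_incr addrA.
Qed.

Lemma accepted0E t : t <= Tn o n ->
  accepted n (tau1 o) t letter n (fun=> 0) =
  [seq l <- ranks | rank_sum n l == v o n t].
Proof.
move=> ht; rewrite acceptedE //; last by rewrite big1.
apply: eq_filter => l; rewrite /dotn big1 ?add0r // => s _; exact: mul0r.
Qed.

Lemma size_accepted0 t : t <= Tn o n ->
  size (accepted n (tau1 o) t letter n (fun=> 0)) = level t.
Proof. by move=> ht; rewrite accepted0E // size_filter. Qed.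

End Counting.

(** * The machine and its running time *)

Section Machine.
Variables (m : nat) (cs : seq ('I_m * seq bool)).

Definition machine : otm :=
  OTM (tm_state := option (pts (main cs))) (Some (entry (main cs)))
    (@rIn m) (@rQuery m) (@rOut m)
    (fun q => if q is Some p then code (fun p => Some p) None p
              else Halt _ _).

Lemma machine_computes tau n l s K u time :
  @run _ (@rQuery m) (oracle tau) (main cs) (@start m n l) s K ->
  map Some (s (@rOut m)) = u -> K <= time ->
  computes_within (oracle tau) machine (encode [:: n; l]) u time.
Proof.
move=> [k hk ex] <- ht; set w := encode _.
pose T : {ffun reg m -> tape} :=
  [ffun i => if i == @rIn m then ([::], w) else ([::], [::])].
have hT : holds T (@start m n l).
  move=> i; exists 0; rewrite cats0 ffunE /start; case: eqP => // _ /=.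
  by rewrite /w encode_num /= cats0.
pose prog (q : option (pts (main cs))) := if q is Some p then
  code (fun p => Some p) None p else Halt _ (reg m).
have [T' hT' e] := exec_sound (Some (entry (main cs))) (@rIn m) (@rOut m)
  (prog := prog) (e := fun p => Some p) (x := None) ex (fun p => erefl) hT.
have fixed j : iter j (@step (oracle tau) machine) (None, T') = (None, T').
  by elim: j => //= j ->.
rewrite /computes_within -(subnK (leq_trans hk ht)) iterD.
rewrite -[iter k _ _]/(iter k (@step (oracle tau) machine) (Some (entry (main cs)), T)).
rewrite [iter k _ _]e fixed; split=> //=.
exact: holds_word hT'.
Qed.

End Machine.

(** With [n.+1] in place of [n] no constant term is needed. *)
Definition poly_bounded (f : nat -> nat) : Prop :=
  exists c d, forall n, f n <= c * n.+1 ^ d.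

Lemma poly_bounded_const c : poly_bounded (fun=> c).
Proof. by exists c, 0 => n; rewrite muln1. Qed.

Lemma poly_bounded_id : poly_bounded id.
Proof. by exists 1, 1 => n; rewrite mul1n expn1. Qed.

Lemma poly_bounded_add f g : poly_bounded f -> poly_bounded g ->
  poly_bounded (fun n => f n + g n).
Proof.
move=> [c [d hf]] [c' [d' hg]]; exists (c + c'), (d + d') => n.
rewrite mulnDl leq_add // ?(leq_trans (hf n)) ?(leq_trans (hg n)) //;
  by rewrite leq_mul2l leq_pexp2l ?orbT // ?leq_addr ?leq_addl.
Qed.

Lemma poly_bounded_mul f g : poly_bounded f -> poly_bounded g ->
  poly_bounded (fun n => f n * g n).
Proof.
move=> [c [d hf]] [c' [d' hg]]; exists (c * c'), (d + d') => n.
by rewrite expnD mulnACA leq_mul.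
Qed.

Lemma poly_bounded_succ f : poly_bounded f -> poly_bounded (fun n => (f n).+1).
Proof.
move=> h; have [c [d hc]] := poly_bounded_add h (poly_bounded_const 1).
by exists c, d => n; rewrite -addn1.
Qed.

Lemma poly_bounded_exp f e : poly_bounded f -> poly_bounded (fun n => f n ^ e).
Proof.
move=> h; elim: e => [|e IH]; first exact: poly_bounded_const.
have [c [d hc]] := poly_bounded_mul h IH.
by exists c, d => n; rewrite expnS.
Qed.

Lemma poly_bounded_cost_main m (cs : seq ('I_m * seq bool)) c e k k' :
  poly_bounded (fun n => cost_main cs n (n.+1 ^ e) (n * k + k') c).
Proof.
rewrite /cost_main /cost_search /cost_unrank /cost_pick /cost_table /cost_stage
  /cost_extend /cost_fill_last /cost_ask /cost_lookup /volume /width.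
repeat first [exact: poly_bounded_const | exact: poly_bounded_id
  | apply: poly_bounded_exp | apply: poly_bounded_succ
  | apply: poly_bounded_add | apply: poly_bounded_mul].
Qed.

Lemma size_bprint l q : l < 2 ^ q -> size (bprint (nbits l)) <= q + 1.
Proof.
move=> hl; have : size (bin l) = size (bprint (nbits l)).
  by rewrite bin_nbits size_map.
rewrite size_map size_rev size_iota => <-; rewrite addn1 ltnS.
have [->|l0] := posnP l; first by [].
by rewrite ltnW // -(@ltn_exp2l 2) // (leq_ltn_trans _ hl) // trunc_logP.
Qed.

(** The search stops at the [T] with [l] in the block of the value [v o n T],
    because the tops of the tables are the lengths of the blocks; the time is
    bounded by replacing [T] by [n.+1 ^ m], the number of vectors with
    entries up to [n]. *)
Theorem theorem2 (R : realType) (M : nat) (O : R -> R)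
    (o : 'I_(2 ^ M.+1) -> R) (vs : 'I_(2 ^ M.+1) -> M.+1.-tuple bool)
    (hO : outcomes O o vs) :
  ptime_relative (tau1 o)
    (fun n l => (0 < n)%N /\ (l < 2 ^ (n * M.+1))%N)
    (Fperm o vs).
Proof.
have vs_bij := codes_bij hO.
set m := 2 ^ M.+1; pose cs := codes_on (letter vs) (bitw M.+1) (iota 0 m).
have [c [d hcost]] := poly_bounded_cost_main cs M.+1 m M.+1 1.
exists (machine cs), (c * 2 ^ d), d => n l [n0 hl].
have [T hT hlT] : exists2 T, T <= Tn o n & \sum_(t < T) level o vs n t <= l <
    \sum_(t < T.+1) level o vs n t.
  by apply: level_exists; rewrite ?expn_mn.
have headE t : t <= Tn o n -> bval (head [::] (table m (tau1 o) n t)) = level o vs n t.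
  move=> ht; rewrite -(size_accepted0 vs n0 ht).
  exact: (@head_table _ n (tau1 o) t (letter vs) (letters vs_bij)).
have split_at t : \sum_(t' < t.+1) level o vs n t' =
    \sum_(t' < t) level o vs n t' + level o vs n t by rewrite big_ord_recr.
have mono t t' : t <= t' ->
    \sum_(i < t) level o vs n i <= \sum_(i < t') level o vs n i.
  by move=> /subnK <-; elim: (t' - t) => // k IH; rewrite addSn split_at (leq_trans IH) ?leq_addr.
have [hlT1 hlT2] := andP hlT.
have restE t : t <= T ->
    bval (rest m (tau1 o) n l t) = l - \sum_(t' < t) level o vs n t'.
  elim: t => [_|t IH ht].
    by rewrite big_ord0 subn0 /rest /= bval_bprint bval_nbits.
  have hlt : ~~ ltb (rest m (tau1 o) n l t) (head [::] (table m (tau1 o) n t)).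
    rewrite ltbE IH ?(ltnW ht) // headE; last exact: leq_trans (ltnW ht) hT.
    by have := mono _ _ ht; rewrite split_at; lia.
  rewrite [rest _ _ _ _ _]/(reduceb (rest m (tau1 o) n l t) _) /reduceb (negPf hlt).
  rewrite bval_subb // IH ?(ltnW ht) // headE; last exact: leq_trans (ltnW ht) hT.
  by rewrite split_at subnDA.
have hge t : t < T -> ~~ ltb (rest m (tau1 o) n l t) (head [::] (table m (tau1 o) n t)).
  move=> ht; rewrite ltbE restE ?(ltnW ht) // headE; last exact: leq_trans (ltnW ht) hT.
  by have := mono _ _ ht; rewrite split_at; lia.
have hlt : ltb (rest m (tau1 o) n l T) (head [::] (table m (tau1 o) n T)).
  by rewrite ltbE restE // headE //; rewrite split_at in hlT2; lia.
have hlast : bval (rest m (tau1 o) n l T.+1) = l - \sum_(t' < T) level o vs n t'.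
  rewrite -restE // [rest _ _ _ _ T.+1]/(reduceb (rest m (tau1 o) n l T) _).
  by rewrite /reduceb hlt bval_padb ?leq_maxl.
have hcs : all (fun x => size x.2 <= M.+1) cs.
  by apply/allP => x /mapP[e _ ->]; rewrite /= size_bitw.
have [s hrun hout] := run_main hge hlt (size_bprint hl) hcs.
apply: (machine_computes hrun).
  rewrite hout; congr bin; rewrite (FpermE vs_bij hT hlT) -hlast.
  rewrite -(accepted0E vs n0 hT).
  apply: (@answer0 m n (tau1 o) T (letter vs) (bitw M.+1) M.+1 (letters vs_bij)) => //.
  - by move=> e _; rewrite size_bitw.
  - by move=> e he; rewrite bval_bitw modn_small.
  by rewrite hlast (size_accepted0 vs n0 hT); rewrite split_at in hlT2; lia.
have hTb : T <= n.+1 ^ m :=  leq_trans hT (ltnW (Tn_bound o vs n)).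
apply: leq_trans (leq_trans (hcost n) _).
  rewrite /cost_main !leq_add2r leq_add2l /cost_search leq_add2r.
  apply: leq_mul; first by rewrite ltnS.
  by rewrite 3!leq_add2r cost_table_mono.
have hn : n.+1 ^ d <= 2 ^ d * n ^ d.
  by rewrite -expnMn; case: (d) => // d'; rewrite leq_exp2r //; lia.
by rewrite -mulnA (leq_trans (_ : _ <= c * (2 ^ d * n ^ d))) ?leq_addr // leq_mul2l hn orbT.
Qed.
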